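(* Let $\mathcal{M}$ be a von Neumann algebra with faithful normal state $\varphi$, generated by self-adjoint elements $a_1,\dots,a_n$ which are free with respect to $\varphi$. Let $P\in\mathbb{C}\langle X_1,\dots,X_n\rangle$ have degree $m$, and suppose $C_1,\dots,C_n\in M_N(\mathbb{C}[z])$ and $u,v\in\mathbb{C}^N$ form a linearization of the resolvent of $P(a_1,\dots,a_n)$, i.e., for $z$ in some neighbourhood of $0$, $$(1-z^mP(a_1,\dots,a_n))^{-1}=u^t\Bigl(I_N-z\sum_{i=1}^nC_i\otimes a_i\Bigr)^{-1}v.$$ Let $1\le k<n$ and let $\mathcal{A}_k$ be the von Neumann subalgebra generated by $a_1,\dots,a_k$. Then for $z$ in some neighbourhood of $0$ $$\mathbb{E}_{\mathcal{A}_k}\bigl[(1-z^mP(a_1,\dots,a_n))^{-1}\bigr]=u^t\Bigl(I_N-z\bigl(C_1\otimes a_1+\dots+C_k\otimes a_k+(C_{k+1}F_{k+1}+\dots+C_nF_n)\otimes1\bigr)\Bigr)^{-1}v,$$ where $F_1,\dots,F_n$ is the unique solution, among tuples of $N\times N$ matrices whose entries are analytic functions of $z$ at $0$, of the system $$F_i(z)=\widetilde\eta_{a_i}\Bigl(z\bigl(I_N-z\sum_{j\ne i}C_jF_j(z)\bigr)^{-1}C_i\Bigr),\qquad i=1,\dots,n.$$ In particular, the moment generating function $M(z)=\varphi\bigl((1-zP(a_1,\dots,a_n))^{-1}\bigr)$ satisfies, for $z$ near $0$, $$M(z^m)=u^t\Bigl(I_N-z\sum_{j=1}^nC_jF_j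(z)\Bigr)^{-1}v.$$
   Context: $\mathbb{C}\langle X_1,\dots,X_n\rangle$ is the algebra of non-commutative polynomials. The elements $a_1,\dots,a_n$ are free if $\varphi(u_1\cdots u_r)=0$ whenever $r\ge1$, each $u_j$ is a polynomial in a single $a_{i_j}$ with $\varphi(u_j)=0$, and $i_j\ne i_{j+1}$ for all $j$. $\mathbb{E}_{\mathcal{A}_k}:\mathcal{M}\to\mathcal{A}_k$ is the conditional expectation preserving $\varphi$, i.e. $\mathbb{E}_{\mathcal{A}_k}[w]$ is the unique element of $\mathcal{A}_k$ with $\varphi(wa)=\varphi(\mathbb{E}_{\mathcal{A}_k}[w]a)$ for all $a\in\mathcal{A}_k$. The Boolean cumulants $\beta_n(a)=\beta_n(a,\dots,a)$ of a random variable $a$ are determined recursively by $\varphi(a^n)=\sum_{k=1}^n\beta_k(a)\varphi(a^{n-k})$, $n\ge1$. The shifted Boolean cumulant generating function is $\widetilde\eta_a(z)=\sum_{n=1}^\infty\beta_n(a)z^{n-1}$; applied to a square matrix $A$ of small norm, $\widetilde\eta_a(A)=\sum_{n\ge1}\beta_n(a)A^{n-1}$. For a matrix $C$ with scalar entries and $a\in\mathcal{M}$, $C\otimes a$ is the matrix $(c_{ij}a)_{ij}\in M_N(\mathcal{M})$. *)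

(* Defs.v *)
From HB Require Import structures.
From mathcomp Require Import all_boot all_order all_algebra.
From mathcomp Require Import finmap complex.
From mathcomp Require Import all_classical all_reals all_analysis.
(* monalg's notations clash with those of MathComp-Analysis *)
From mathcomp Require Import -(notations) monalg.
Set Implicit Arguments.
Unset Strict Implicit.
Unset Printing Implicit Defensive.
Import Order.TTheory GRing.Theory Num.Theory.
Import numFieldNormedType.Exports.

Local Open Scope classical_set_scope.
Local Open Scope ring_scope.

(* [R[i]] bundled as a [numClosedFieldType], so that its norm topology is
   inferred. *)
Definition Cplx (R : realType) : numClosedFieldType :=
  Num.ClosedField.clone R[i] _.

(* The norm of a [normedModType (Cplx R)] is [Cplx R]-valued, so [inner_normE]
   is an equation in [Cplx R]; [inner] is linear in its first argument. *)
HB.mixin Record hasInner (R : realType) H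
    & CompleteNormedModule (Cplx R) H := {
  inner : {dot H for (Num.conj : Cplx R -> Cplx R)};
  inner_normE : forall x : H, inner x x = `|x| ^+ 2
}.

#[short(type="hilbertType")]
HB.structure Definition Hilbert (R : realType) :=
  {H of CompleteNormedModule (Cplx R) H & hasInner R H}.

(* [B(H)].  Only a [pzRingType]: for [H = 0] it is the zero ring. *)
Record bop (R : realType) (H : hilbertType R) := Bop {
  bop_fun :> H -> H;
  bop_linear : linear bop_fun;
  bop_continuous : continuous bop_fun
}.

Section BoundedOperators.
Context (R : realType) (H : hilbertType R).
Implicit Types (x y : bop H) (c : Cplx R).

HB.instance Definition _ x :=
  GRing.isLinear.Build (Cplx R) H H *:%R (bop_fun x) (bop_linear x).

Lemma bopP x y : (forall u, x u = y u) -> x = y.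
Proof.
case: x y => [f lf cf] [g lg cg] /= /funext fg.
by case: _ / fg in lg cg *; congr Bop; exact: Prop_irrelevance.
Qed.

HB.instance Definition _ := gen_eqMixin (bop H).
HB.instance Definition _ := gen_choiceMixin (bop H).

Program Definition bop0 : bop H := @Bop R H (fun=> 0) _ _.
Next Obligation. by move=> c u v; rewrite scaler0 addr0. Qed.
Next Obligation. by move=> u; exact: cvg_cst. Qed.

Program Definition bop_opp x : bop H := @Bop R H (fun u => - x u) _ _.
Next Obligation. by move=> x c u v; rewrite linearP opprD scalerN. Qed.
Next Obligation. by move=> x u; apply: cvgN; exact: bop_continuous. Qed.

Program Definition bop_add x y : bop H := @Bop R H (fun u => x u + y u) _ _.
Next Obligation. by move=> x y c u v; rewrite !linearP scalerDr addrACA. Qed.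
Next Obligation. by move=> x y u; apply: cvgD; exact: bop_continuous. Qed.

Program Definition bop_scale c x : bop H := @Bop R H (fun u => c *: x u) _ _.
Next Obligation.
by move=> c x d u v; rewrite linearP scalerDr !scalerA mulrC.
Qed.
Next Obligation. by move=> c x u; apply: cvgZr; exact: bop_continuous. Qed.

Program Definition bop1 : bop H := @Bop R H id _ _.
Next Obligation. by []. Qed.
Next Obligation. by move=> u; exact: cvg_id. Qed.

Program Definition bop_mul x y : bop H := @Bop R H (x \o y) _ _.
Next Obligation. by move=> x y c u v /=; rewrite !linearP. Qed.
Next Obligation.
by move=> x y u; apply: continuous_comp; exact: bop_continuous.
Qed.

Fact bop_addA : associative bop_add.
Proof. by move=> x y z; apply: bopP => u /=; rewrite addrA. Qed.
Fact bop_addC : commutative bop_add.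
Proof. by move=> x y; apply: bopP => u /=; rewrite addrC. Qed.
Fact bop_add0 : left_id bop0 bop_add.
Proof. by move=> x; apply: bopP => u /=; rewrite add0r. Qed.
Fact bop_addN : left_inverse bop0 bop_opp bop_add.
Proof. by move=> x; apply: bopP => u /=; rewrite addNr. Qed.

HB.instance Definition _ :=
  GRing.isZmodule.Build (bop H) bop_addA bop_addC bop_add0 bop_addN.

Fact bop_mulA : associative bop_mul.
Proof. by move=> x y z; apply: bopP. Qed.
Fact bop_mul1l : left_id bop1 bop_mul.
Proof. by move=> x; apply: bopP. Qed.
Fact bop_mul1r : right_id bop1 bop_mul.
Proof. by move=> x; apply: bopP. Qed.
Fact bop_mulDl : left_distributive bop_mul bop_add.
Proof. by move=> x y z; apply: bopP. Qed.
Fact bop_mulDr : right_distributive bop_mul bop_add.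
Proof. by move=> x y z; apply: bopP => u /=; rewrite linearD. Qed.

HB.instance Definition _ := GRing.Zmodule_isPzRing.Build (bop H)
  bop_mulA bop_mul1l bop_mul1r bop_mulDl bop_mulDr.

Fact bop_scaleA c d x : bop_scale c (bop_scale d x) = bop_scale (c * d) x.
Proof. by apply: bopP => u /=; rewrite scalerA. Qed.
Fact bop_scale1 : left_id 1 bop_scale.
Proof. by move=> x; apply: bopP => u /=; rewrite scale1r. Qed.
Fact bop_scaleDr : right_distributive bop_scale +%R.
Proof. by move=> c x y; apply: bopP => u /=; rewrite scalerDr. Qed.
Fact bop_scaleDl x : {morph bop_scale^~ x : c d / c + d}.
Proof. by move=> c d; apply: bopP => u /=; rewrite scalerDl. Qed.

HB.instance Definition _ := GRing.Zmodule_isLmodule.Build (Cplx R) (bop H)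
  bop_scaleA bop_scale1 bop_scaleDr bop_scaleDl.

End BoundedOperators.

Section Inverse.
Context (A : pzRingType).

Definition is_inverse (x y : A) := x * y = 1 /\ y * x = 1.

Definition invertible (x : A) := exists y, is_inverse x y.

(* The two-sided inverse of [x], and [0] if there is none. *)
Definition rinv (x : A) : A := xget 0 [set y | is_inverse x y].

End Inverse.

Section VonNeumann.
Context (R : realType) (H : hilbertType R).
Implicit Types (x y : bop H) (S M : set (bop H)) (phi : bop H -> Cplx R).

Definition is_adjoint x y := forall u v : H, inner (x u) v = inner u (y v).

Definition selfadjoint x := is_adjoint x x.

Definition ell2 (xi : nat -> H) := cvgn (series (fun k => `|xi k| ^+ 2)).

Definition ell2_pair := {p : (nat -> H) * (nat -> H) | ell2 p.1 /\ ell2 p.2}.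

Definition vector_functional x (p : ell2_pair) : Cplx R :=
  lim (series (fun k => inner (x ((sval p).1 k)) ((sval p).2 k)) @ \oo).

(* [B(H)] with the ultraweak (sigma-weak) topology, the coarsest one making
   all the functionals [x |-> \sum_k <x xi_k, eta_k>] continuous. *)
Definition ultraweak : topologicalType :=
  initial_topology (vector_functional : bop H -> {ptws ell2_pair -> Cplx R}).

(* Von Neumann algebras on [H], as ultraweakly closed unital *-subalgebras. *)
Definition von_neumann M :=
  [/\ M 1,
      forall c x y, M x -> M y -> M (c *: x + y),
      forall x y, M x -> M y -> M (x * y),
      forall x, M x -> exists2 y, M y & is_adjoint x y
    & closed (M : set ultraweak)].

Definition vn_gen S : set (bop H) :=
  \bigcap_(N in [set N | von_neumann N /\ S `<=` N]) N.

(* A functional on [M] is represented by a function on all of [B(H)], whose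
   values outside [M] are irrelevant. *)
Definition faithful_normal_state M phi :=
  [/\ [/\ forall c x y, M x -> M y -> phi (c *: x + y) = c * phi x + phi y,
          forall x y, M x -> is_adjoint x y -> 0 <= phi (y * x)
        & phi 1 = 1],
      forall x y, M x -> is_adjoint x y -> phi (y * x) = 0 -> x = 0
    & {within (M : set ultraweak), continuous (phi : ultraweak -> Cplx R)}].

(* [e] is the [phi]-preserving conditional expectation of [w] onto [A]. *)
Definition is_cond_exp phi A w e :=
  unique [set e | A e /\ forall a, A a -> phi (w * a) = phi (e * a)] e.

End VonNeumann.

Section NoncommutativePolynomials.
Context (R : realType) (H : hilbertType R) (n : nat).

(* [C<X_1, ..., X_n>]: the algebra of the free monoid, whose elements are the
   words in [X_0, ..., X_(n-1)]. *)
Definition ncpoly := malg (fmonom 'I_n) (Cplx R).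

(* [mmeasure] is the degree plus one; the zero polynomial has degree [0]. *)
Definition ncdeg (P : ncpoly) := (mmeasure (@fdeg 'I_n) P).-1.

Definition nceval (P : ncpoly) (a : 'I_n -> bop H) : bop H :=
  \sum_(w <- msupp P) mcoeff w P *:
    \prod_(i <- (w : seq 'I_n)) a i.

Definition peval (p : {poly Cplx R}) (x : bop H) : bop H :=
  \sum_(k < size p) p`_k *: x ^+ k.

Definition free_elements (phi : bop H -> Cplx R) (a : 'I_n -> bop H) :=
  forall s : seq ('I_n * {poly Cplx R}), s != [::] ->
    sorted (fun t t' => t.1 != t'.1) s ->
    (forall t, t \in s -> phi (peval t.2 (a t.1)) = 0) ->
    phi (\prod_(t <- s) peval t.2 (a t.1)) = 0.

End NoncommutativePolynomials.

Section BooleanCumulants.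
Context (R : realType).

(* [:: beta_1; ...; beta_n] for the moments [m k = phi (a ^+ k)] *)
Fixpoint bool_cumulant_seq (m : nat -> Cplx R) n : seq (Cplx R) :=
  if n is n'.+1 then
    let s := bool_cumulant_seq m n' in
    rcons s (m n - \sum_(k < n') s`_k * m (n - k.+1)%N)
  else [::].

Definition bool_cumulant (m : nat -> Cplx R) n := (bool_cumulant_seq m n)`_n.-1.

Lemma size_bool_cumulant_seq m n : size (bool_cumulant_seq m n) = n.
Proof. by elim: n => //= n IHn; rewrite size_rcons IHn. Qed.

Lemma nth_bool_cumulant_seq m n k :
  (k < n)%N -> (bool_cumulant_seq m n)`_k = bool_cumulant m k.+1.
Proof.
elim: n => // n IHn; rewrite ltnS leq_eqVlt => /orP[/eqP -> //|kn].
by rewrite /= nth_rcons size_bool_cumulant_seq kn IHn.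
Qed.

Lemma bool_cumulantP m n : m 0 = 1 -> (0 < n)%N ->
  m n = \sum_(1 <= k < n.+1) bool_cumulant m k * m (n - k)%N.
Proof.
case: n => // n m0 _; rewrite big_nat_recr //= subnn m0 mulr1.
rewrite /bool_cumulant /= nth_rcons size_bool_cumulant_seq ltnn eqxx.
rewrite big_add1 /= big_mkord addrC -[LHS](subrK (\sum_(k < n)
  (bool_cumulant_seq m n)`_k * m (n.+1 - k.+1)%N)); congr (_ + _).
by apply: eq_bigr => k _; rewrite nth_bool_cumulant_seq.
Qed.

Variables (H : hilbertType R) (phi : bop H -> Cplx R) (N : nat).

(* the junk value of [lim] where the series diverges *)
Definition eta_tilde (a : bop H) (A : 'M[Cplx R]_N) : 'M[Cplx R]_N :=
  lim (series (fun k =>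
         bool_cumulant (fun j => phi (a ^+ j)) k.+1 *: A ^+ k) @ \oo).

End BooleanCumulants.

Section Linearization.
Context (R : realType) (H : hilbertType R) (n N : nat).
Implicit Types (C : 'I_n -> 'M[{poly Cplx R}]_N).
Implicit Types (F : 'I_n -> Cplx R -> 'M[Cplx R]_N).

Definition tens p q (A : 'M[Cplx R]_(p, q)) (x : bop H) : 'M[bop H]_(p, q) :=
  map_mx (fun c => c *: x) A.

Definition mxeval (A : 'M[{poly Cplx R}]_N) (z : Cplx R) : 'M[Cplx R]_N :=
  map_mx (horner^~ z) A.

(* [u^t X v] *)
Definition sandwich (u v : 'cV[Cplx R]_N) (X : 'M[bop H]_N) : bop H :=
  (tens u^T 1 *m X *m tens v 1) 0 0.

Definition resolvent_linearization (P : ncpoly R n) m (a : 'I_n -> bop H)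
    C (u v : 'cV[Cplx R]_N) :=
  \forall z \near (0 : Cplx R),
    let X := 1 - z ^+ m *: nceval P a in
    let Y := 1 - \sum_i tens (z *: mxeval (C i) z) (a i) in
    [/\ invertible X, invertible Y & rinv X = sandwich u v (rinv Y)].

Definition analytic_at0 (f : Cplx R -> Cplx R) :=
  exists c : nat -> Cplx R,
    \forall z \near (0 : Cplx R), series (fun k => c k * z ^+ k) @ \oo --> f z.

Definition subordination_system (phi : bop H -> Cplx R) (a : 'I_n -> bop H)
    C F :=
  \forall z \near (0 : Cplx R), forall i,
    F i z = eta_tilde phi (a i)
      (z *: (invmx (1 - z *: \sum_(j | j != i) mxeval (C j) z *m F j z)
             *m mxeval (C i) z)).

Definition is_solution phi a C F :=
  (forall i r s, analytic_at0 (fun z => F i z r s)) /\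
  subordination_system phi a C F.

End Linearization.

(* Main.v *)
(* Put D_i = z C_i(z), which is small, let F_1, ..., F_n be bounded, and set
   G = (1 - sum_j D_j F_j)^-1 and t_j = G (D_j a_j - D_j F_j).  The system says
   exactly that r_j = (1 - t_j)^-1 satisfies phi (r_j) = 1: eta_tilde is
   phi (a U), where U = 1 + (1 - phi)(A a U) is the resolvent of A a normalized
   by phi (U) = 1.  In X' = (1 - sum_j t_j)^-1 the product L_i = X' (1 - t_i),
   the sum of the words not ending in a_i, obeys
   L_i = 1 + sum_(j != i) L_j (r_j - 1), and X' t_j = L_j (r_j - 1).
   As the r_j - 1 are centered, freeness makes X' t_j orthogonal to all products
   of centered elements not starting with a_j.  Expanding X' around the resolvent
   X'_J = (1 - sum_(j in J) t_j)^-1,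
     X' - X'_J = sum_(j notin J) X' t_j X'_J,
   shows that X'_J G is the conditional expectation of the full resolvent
   X = X' G onto the algebra of the a_j, j in J.  For J empty and J = {i} this
   gives phi (X) = G and phi (X a_i) = F_i phi (X), so that small solutions are
   unique and given by an explicit formula, analytic in z; for each small z a
   solution exists by contraction. *)
Require Import Defs.
From HB Require Import structures.
From mathcomp Require Import all_boot all_order all_algebra.
From mathcomp Require Import complex.
From mathcomp Require Import all_classical all_reals all_analysis.
From mathcomp Require Import ring lra.
Set Implicit Arguments.
Unset Strict Implicit.
Unset Printing Implicit Defensive.
Import Order.TTheory GRing.Theory Num.Theory.
Import numFieldNormedType.Exports.
Local Open Scope classical_set_scope.
Local Open Scope ring_scope.

(** * Norms as real numbers *)

(** For most of the proof z is frozen, and the statements concern small scalar matrices D_i and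
    bounded F_i. A contraction at each z says nothing about the dependence on z, and it identifies
    solutions only under a bound fixed in advance. Hence the smallness threshold is a function of an
    arbitrary bound on F: the bound of the contraction serves existence, that of an analytic
    competitor serves uniqueness. Analyticity is read off from U = X phi(X)^-1: as phi(U) = 1, it
    solves U = 1 + (1 - phi)(sum_i D_i a_i U), an equation polynomial in z, and F_i = phi(U a_i) is
    linear in U. Orthogonality is expressed by annihilators of families of functionals bounded on M.
    These are norm-closed subspaces, so membership passes through Neumann series and fixed-point
    iterations. Norm limits do not reach all of the von Neumann algebra generated by the a_j; there
    normality of phi takes over. Normality also yields the bound K of phi on M, which enters the
    smallness constants together with the norms of the a_i and of the identity matrices.
    Contractions are arranged to have ratio 1/2. *)

Section RealNorm.
Context (R : realType).

Lemma real_complex0 : ((0 : R)%:C)%C = 0 :> Cplx R. Proof. by []. Qed.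

Lemma real_complexD (x y : R) : ((x + y)%:C)%C = (x%:C)%C + (y%:C)%C :> Cplx R.
Proof. exact: (raddfD (real_complex R)). Qed.

Lemma real_complexM (x y : R) : ((x * y)%:C)%C = (x%:C)%C * (y%:C)%C :> Cplx R.
Proof. exact: (rmorphM (real_complex R)). Qed.

Lemma real_complexX (x : R) n : ((x ^+ n)%:C)%C = (x%:C)%C ^+ n :> Cplx R.
Proof. exact: (rmorphXn (real_complex R)). Qed.

Lemma real_complex_le (x y : R) : ((x%:C)%C <= (y%:C)%C :> Cplx R) = (x <= y).
Proof. exact: complex.lecR. Qed.

Lemma real_complex_lt (x y : R) : ((x%:C)%C < (y%:C)%C :> Cplx R) = (x < y).
Proof. exact: complex.ltcR. Qed.

Lemma gt0_real_complex (e : Cplx R) : 0 < e ->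
  exists2 x : R, 0 < x & e = (x%:C)%C.
Proof.
move=> e0; have eE : e = ((complex.Re e)%:C)%C.
  by rewrite complex.RRe_real // gtr0_real.
by exists (complex.Re e) => //; rewrite -real_complex_lt -eE.
Qed.

Section Norm.
Context (V : normedModType (Cplx R)).
Implicit Types (u v : V).

(* norms over [Cplx R] are [Cplx R]-valued; [rn] is the norm as a real number *)
Definition rn u : R := complex.Re (`|u| : Cplx R).

Lemma rnE u : `|u| = ((rn u)%:C)%C :> Cplx R.
Proof. by rewrite /rn complex.RRe_real // ger0_real. Qed.

Lemma rn_ge0 u : 0 <= rn u.
Proof. by have := normr_ge0 u; rewrite rnE -real_complex0 real_complex_le. Qed.

Lemma rn_le u (k : R) : (rn u <= k) = (`|u| <= (k%:C)%C :> Cplx R).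
Proof. by rewrite rnE real_complex_le. Qed.

Lemma rnD u v : rn (u + v) <= rn u + rn v.
Proof. by rewrite rn_le real_complexD -!rnE ler_normD. Qed.

Lemma rnN u : rn (- u) = rn u. Proof. by rewrite /rn normrN. Qed.

Lemma rnB u v : rn (u - v) <= rn u + rn v.
Proof. by rewrite -(rnN v) rnD. Qed.

Lemma rn_distC u v : rn (u - v) = rn (v - u).
Proof. by rewrite -rnN opprB. Qed.

Lemma rn0 : rn 0 = 0. Proof. by rewrite /rn normr0. Qed.

Lemma rn_eq0 u : rn u = 0 -> u = 0.
Proof. by move=> u0; apply/eqP; rewrite -normr_eq0 rnE u0. Qed.

Lemma rn_sum (I : Type) (s : seq I) (P : pred I) (f : I -> V) :
  rn (\sum_(i <- s | P i) f i) <= \sum_(i <- s | P i) rn (f i).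
Proof.
elim/big_rec2: _ => [|i x y _ yx]; first by rewrite rn0.
by rewrite (le_trans (rnD _ _)) // lerD2l.
Qed.

Lemma cvg_rnP (s : nat -> V) (l : V) :
  s @ \oo --> l <->
  forall e : R, 0 < e -> exists n0, forall n, (n0 <= n)%N -> rn (l - s n) <= e.
Proof.
split=> [/cvgrPdist_le sl e e0|sl].
  have /sl[n0 _ n0P] : 0 < (e%:C)%C :> Cplx R.
    by rewrite -real_complex0 real_complex_lt.
  by exists n0 => n nn0; rewrite rn_le; apply: n0P.
apply/cvgrPdist_le => _ /gt0_real_complex[e e0 ->].
have [n0 n0P] := sl _ e0.
by exists n0 => // n /= nn0; rewrite -rn_le; apply: n0P.
Qed.

End Norm.

Lemma rnZ (V : normedModType (Cplx R)) (c : Cplx R) (u : V) : rn (c *: u) = rn c * rn u.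
Proof.
apply: (@complex.complexI R); rewrite -[LHS]rnE normrZ.
by rewrite [RHS]real_complexM -!rnE.
Qed.

Lemma rnM (c d : Cplx R) : rn (c * d) = rn c * rn d.
Proof. by rewrite -rnZ. Qed.

Lemma rn1 : rn (1 : Cplx R) = 1. Proof. by rewrite /rn normr1. Qed.

Lemma rn_conj (c : Cplx R) : rn (c^*) = rn c.
Proof. by rewrite /rn norm_conjC. Qed.

Lemma rnX (c : Cplx R) n : rn (c ^+ n) = rn c ^+ n.
Proof. by elim: n => [|n IHn]; rewrite ?rn1// !exprS rnM IHn. Qed.

Lemma near0P (P : Cplx R -> Prop) :
  (\forall z \near (0 : Cplx R), P z) <->
  exists2 d : R, 0 < d & forall z, rn z < d -> P z.
Proof.
split=> [/nbhs_ballP[_ /= /gt0_real_complex[d d0 ->] dP]|[d d0 dP]].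
  exists d => // z zd; apply: dP; rewrite /ball/= sub0r normrN rnE.
  by rewrite real_complex_lt.
apply/nbhs_ballP; exists (d%:C)%C => /=.
  by rewrite -real_complex0 real_complex_lt.
move=> z; rewrite /ball/= sub0r normrN rnE real_complex_lt; exact: dP.
Qed.

Lemma geometric_small (c q e : R) : 0 <= q < 1 -> 0 < e ->
  exists n0, forall n, (n0 <= n)%N -> c * q ^+ n <= e.
Proof.
move=> /andP[q0 q1] e0.
have /cvgrPdist_le/(_ e e0)[n0 _ n0P] : geometric c q @ \oo --> (0 : R).
  by apply: cvg_geometric; rewrite ger0_norm.
exists n0 => n /n0P; rewrite /geometric/= sub0r normrN; exact/le_trans/ler_norm.
Qed.

Lemma le0_of_geometric (x c q : R) : 0 <= q < 1 ->
  (forall n, x <= c * q ^+ n) -> x <= 0.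
Proof.
move=> q01 xc; apply/ler_addgt0Pr => e e0; rewrite add0r.
by have [n0 /(_ n0 (leqnn _))] := geometric_small c q01 e0; apply/le_trans/xc.
Qed.

Lemma cvg_geometric_dist (V : normedModType (Cplx R)) (s : nat -> V) (l : V)
    (c q : R) : 0 <= q < 1 -> (forall n, rn (l - s n) <= c * q ^+ n) ->
  s @ \oo --> l.
Proof.
move=> q01 sl; apply/cvg_rnP => e e0.
have [n0 n0P] := geometric_small c q01 e0.
by exists n0 => n nn0; apply: (le_trans (sl n)); exact: n0P.
Qed.

Lemma rn_geometric_tail (V : normedModType (Cplx R)) (s : nat -> V) (c q : R) :
  0 <= q < 1 -> (forall n, rn (s n.+1 - s n) <= c * q ^+ n) ->
  forall n p, rn (s (n + p)%N - s n) <= c / (1 - q) * q ^+ n.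
Proof.
move=> /andP[q0 q1] sc n p; have q1' : 0 < 1 - q by rewrite subr_gt0.
have c0 : 0 <= c by have := sc 0; rewrite expr0 mulr1; apply/le_trans/rn_ge0.
(* The sharper bound telescopes in p, so that the induction closes with equality. *)
suff: rn (s (n + p)%N - s n) <= c / (1 - q) * (q ^+ n - q ^+ (n + p)).
  move/le_trans; apply; rewrite ler_wpM2l ?divr_ge0 ?(ltW q1')//.
  by rewrite gerBl exprn_ge0.
elim: p => [|p IHp]; first by rewrite addn0 !subrr rn0 mulr0.
rewrite -(subrK (s (n + p)%N) (s (n + p.+1)%N)) -addrA.
rewrite (le_trans (rnD _ _))// addnS.
rewrite (le_trans (lerD (sc _) IHp))// [q ^+ (n + p).+1]exprS le_eqVlt.
by apply/orP; left; apply/eqP; field; rewrite gt_eqF.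
Qed.

Lemma rn_geometric_limit (V : normedModType (Cplx R)) (s : nat -> V) (c q : R)
    (l : V) : 0 <= q < 1 -> (forall n, rn (s n.+1 - s n) <= c * q ^+ n) ->
  s @ \oo --> l -> forall n, rn (l - s n) <= c / (1 - q) * q ^+ n.
Proof.
move=> q01 sc sl n; apply/ler_addgt0Pl => e e0.
have [n1 n1P] := (cvg_rnP _ _).1 sl _ e0.
rewrite -(subrK (s (n + n1)%N) l) -addrA (le_trans (rnD _ _))// lerD//.
  by rewrite n1P ?leq_addl.
exact: rn_geometric_tail.
Qed.

Lemma rn_real (x : R) : 0 <= x -> rn ((x%:C)%C : Cplx R) = x.
Proof.
by move=> x0; rewrite /rn complex.normc_def /= expr0n addr0 sqrtr_sqr ger0_norm.
Qed.

End RealNorm.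

Lemma geometric_limit (R : realType) (V : completeNormedModType (Cplx R))
    (s : nat -> V) (c q : R) : 0 <= q < 1 ->
  (forall n, rn (s n.+1 - s n) <= c * q ^+ n) ->
  exists l, forall n, rn (l - s n) <= c / (1 - q) * q ^+ n.
Proof.
move=> q01 sc; have step := rn_geometric_tail q01 sc.
have /cauchy_cvgP/cvg_ex[l sl] : cauchy (s @ \oo).
  apply: cauchy_exP => e /gt0_real_complex[{}e e0 ->].
  have e20 : 0 < e / 2 by rewrite divr_gt0.
  have [n0 n0P] := geometric_small (c / (1 - q)) q01 e20.
  exists (s n0); exists n0 => // n /= n0n.
  rewrite -ball_normE /= rnE rn_distC -(subnKC n0n) real_complex_lt.
  rewrite (le_lt_trans (step _ _))// (le_lt_trans (n0P _ (leqnn _)))//.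
  by rewrite ltr_pdivrMr// ltr_pMr// ltr1n.
by exists l; exact: rn_geometric_limit.
Qed.

(** * The operator norm on B(H) *)

Section OperatorNorm.
Context (R : realType) (H : hilbertType R).
Implicit Types (x y : bop H) (c : Cplx R).

Lemma bop_scaleAl c x y : c *: (x * y) = (c *: x) * y.
Proof. exact: bopP. Qed.

Lemma bop_scaleAr c x y : c *: (x * y) = x * (c *: y).
Proof. by apply: bopP => u /=; rewrite linearZ. Qed.

(** On the zero space the second condition holds for every real k; [0 <= k] keeps the set bounded
    below, so that [inf] is meaningful. *)
Definition op_bounds x : set R :=
  [set k | 0 <= k /\ forall u, rn (x u) <= k * rn u].

Definition opn x : R := inf (op_bounds x).

Lemma op_bounds_neq0 x : op_bounds x !=set0.
Proof.
have /linear_bounded_continuous/linear_boundedP : continuous x.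
  exact: bop_continuous.
move=> [k [/complex.complex_realP[{}k ->] kP]].
(* Boundedness provides the estimate for every number strictly above k; this one is also
   nonnegative. *)
exists (`|k| + 1); split=> [|u]; first by rewrite addr_ge0.
rewrite rn_le real_complexM -rnE; apply: kP.
by rewrite real_complex_lt (le_lt_trans (ler_norm k))// ltrDl.
Qed.

Lemma opn_ge0 x : 0 <= opn x.
Proof. by apply: lb_le_inf; [exact: op_bounds_neq0|move=> k []]. Qed.

Lemma opn_le x (k : R) : 0 <= k -> (forall u, rn (x u) <= k * rn u) ->
  opn x <= k.
Proof. by move=> k0 kP; apply: ge_inf => //; exists 0 => r []. Qed.

Lemma rn_opn x u : rn (x u) <= opn x * rn u.
Proof.
have [k [k0 kP]] := op_bounds_neq0 x.
have [u0|un0] := eqVneq (rn u) 0.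
  by rewrite u0 mulr0; have := kP u; rewrite u0 mulr0.
have up : 0 < rn u by rewrite lt_def un0 rn_ge0.
rewrite -ler_pdivrMr//; apply: lb_le_inf; first exact: op_bounds_neq0.
by move=> r [r0 rP]; rewrite ler_pdivrMr.
Qed.

Lemma opnD x y : opn (x + y) <= opn x + opn y.
Proof.
apply: opn_le => [|u]; first by rewrite addr_ge0 ?opn_ge0.
by rewrite mulrDl (le_trans (rnD _ _))// lerD ?rn_opn.
Qed.

Lemma opnM x y : opn (x * y) <= opn x * opn y.
Proof.
apply: opn_le => [|u]; first by rewrite mulr_ge0 ?opn_ge0.
rewrite (le_trans (rn_opn x (y u)))// -mulrA ler_wpM2l ?opn_ge0 ?rn_opn//.
Qed.

Lemma opnZ c x : opn (c *: x) <= rn c * opn x.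
Proof.
apply: opn_le => [|u]; first by rewrite mulr_ge0 ?opn_ge0 ?rn_ge0.
by rewrite rnZ -mulrA ler_wpM2l ?rn_ge0 ?rn_opn.
Qed.

(** Only an inequality, because the zero space gives 0. *)
Lemma opn1 : opn (1 : bop H) <= 1.
Proof. by apply: opn_le => // u; rewrite mul1r. Qed.

Lemma opn0 : opn (0 : bop H) = 0.
Proof.
apply/eqP; rewrite eq_le opn_ge0 andbT.
by apply: opn_le => // u; rewrite mul0r rn0.
Qed.

Lemma opnN x : opn (- x) = opn x.
Proof.
suff le_opnN y : opn (- y) <= opn y.
  by apply/eqP; rewrite eq_le le_opnN -{1}(opprK x) le_opnN.
by apply: opn_le => [|u]; rewrite ?opn_ge0// rnN rn_opn.
Qed.

Lemma opn_eq0 x : opn x <= 0 -> x = 0.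
Proof.
move=> x0; apply: bopP => u; apply: rn_eq0; apply/eqP; rewrite eq_le rn_ge0 andbT.
rewrite (le_trans (rn_opn _ _))// -(mul0r (rn u)) ler_wpM2r ?rn_ge0//.
Qed.

(** The sequence converges at each vector by completeness of H, with an error proportional to the
    norm of the vector. Linearity of the limit is uniqueness of limits, and the uniform error gives
    both its boundedness and the rate in operator norm. *)
Lemma bop_complete (x : nat -> bop H) (c q : R) : 0 <= q < 1 ->
  (forall n, opn (x n.+1 - x n) <= c * q ^+ n) ->
  exists y, forall n, opn (y - x n) <= c / (1 - q) * q ^+ n.
Proof.
move=> q01 xc; have /andP[q0 q1] := q01; have q1' : 0 < 1 - q by rewrite subr_gt0.
have c0 : 0 <= c by have := xc 0; rewrite expr0 mulr1; apply/le_trans/opn_ge0.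
have lP u : exists l, forall n, rn (l - x n u) <= c * rn u / (1 - q) * q ^+ n.
  apply: geometric_limit => // n; rewrite -mulrA [rn u * _]mulrC mulrA.
  apply: (le_trans (rn_opn (x n.+1 - x n) u)).
  by rewrite ler_wpM2r ?rn_ge0.
have [f fP] := choice lP.
have xf u : (fun n => x n u) @ \oo --> f u by apply: cvg_geometric_dist (fP u).
have flin : linear f.
  move=> d u v; have xl : (fun n => x n (d *: u + v)) @ \oo --> d *: f u + f v.
    rewrite (_ : (fun n => _) = (fun n => d *: x n u + x n v)).
      by apply: cvgD => //; apply: cvgZr.
    by apply/funext => n; rewrite linearP.
  exact: cvg_unique (xf _) xl.
have bnd n u : rn (f u - x n u) <= c / (1 - q) * q ^+ n * rn u.
  by rewrite (le_trans (fP u n))// le_eqVlt; apply/orP; left; apply/eqP; ring.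
have fbd u : rn (f u) <= (c / (1 - q) + opn (x 0)) * rn u.
  rewrite -(subrK (x 0 u) (f u)) (le_trans (rnD _ _))// mulrDl lerD ?rn_opn//.
  by have := bnd 0 u; rewrite expr0 mulr1.
pose L := GRing.isLinear.Build (Cplx R) H H *:%R f flin.
pose fL : {linear H -> H} := HB.pack f L.
have fcont : continuous f.
  apply: (@bounded_linear_continuous _ _ _ fL); apply/linear_boundedP.
  exists (((c / (1 - q) + opn (x 0))%:C)%C); split.
    by apply/complex.complex_realP; eexists.
  move=> r kr u; rewrite (@le_trans _ _ ((((c / (1 - q) + opn (x 0))%:C)%C : Cplx R) * `|u|))//.
    have := fbd u; rewrite rn_le real_complexM -rnE; exact.
  by rewrite ler_wpM2r// ltW.
exists (Bop flin fcont) => n; apply: opn_le => [|u].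
  by rewrite mulr_ge0 ?exprn_ge0// divr_ge0// ltW.
exact: bnd.
Qed.

End OperatorNorm.

(** * Complete norms, contractions and Neumann series *)

Section Norms.
Context (R : realType).

(** One interface for operators, scalars, matrices over either, and tuples of matrices. Definiteness
    starts from [f x <= 0] because limit arguments end with an upper bound. *)
Record is_norm (T : zmodType) (f : T -> R) : Prop := IsNorm {
  nrm_ge0 : forall x, 0 <= f x;
  nrm0 : f 0 = 0;
  nrmD : forall x y, f (x + y) <= f x + f y;
  nrmN : forall x, f (- x) = f x;
  nrm_eq0 : forall x, f x <= 0 -> x = 0 }.

Definition submultiplicative (T : pzRingType) (f : T -> R) :=
  forall x y, f (x * y) <= f x * f y.

(** Completeness for sequences with geometric steps: it covers Neumann series and contractions and
    passes entrywise to matrices and tuples. The ratio is kept, while the constant k is free since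
    entrywise constants add up. *)
Definition geo_complete (T : zmodType) (f : T -> R) :=
  forall (s : nat -> T) (c q : R), 0 <= q < 1 ->
    (forall n, f (s n.+1 - s n) <= c * q ^+ n) ->
    exists l, exists k, forall n, f (l - s n) <= k * q ^+ n.

Section NormTheory.
Context (T : zmodType) (f : T -> R) (fn : is_norm f).

Lemma nrmB x y : f (x - y) <= f x + f y.
Proof. by rewrite -(nrmN fn y) nrmD. Qed.

Lemma nrm_distC x y : f (x - y) = f (y - x).
Proof. by rewrite -(nrmN fn) opprB. Qed.

Lemma nrm_dist_add x y z : f (x - z) <= f (x - y) + f (y - z).
Proof. by rewrite (le_trans _ (nrmD fn _ _))// addrA subrK. Qed.

Lemma nrm_sum (I : Type) (s : seq I) (P : pred I) (g : I -> T) :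
  f (\sum_(i <- s | P i) g i) <= \sum_(i <- s | P i) f (g i).
Proof.
elim/big_rec2: _ => [|i x y _ yx]; first by rewrite (nrm0 fn).
by rewrite (le_trans (nrmD fn _ _)) // lerD2l.
Qed.

Lemma nrm_sum_le (I : finType) (P : pred I) (g : I -> T) (k : R) : 0 <= k ->
  (forall i, P i -> f (g i) <= k) -> f (\sum_(i | P i) g i) <= #|I|%:R * k.
Proof.
move=> k0 gk; rewrite (le_trans (nrm_sum _ _ _))//.
rewrite (le_trans (ler_sum _ gk))// mulr_natl -sumr_const.
by rewrite [leRHS](bigID P)/= lerDl sumr_ge0.
Qed.

(** Banach's fixed-point argument on a set S that is stable under limits with rate [q ^+ n].
    Choosing S as a closed subspace or a ball places the fixed point there at no extra cost. *)
Lemma picard (S : T -> Prop) (psi : T -> T) (x0 : T) (q : R) :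
  geo_complete f -> 0 <= q < 1 -> S x0 ->
  (forall x, S x -> S (psi x)) ->
  (forall x y, S x -> S y -> f (psi x - psi y) <= q * f (x - y)) ->
  (forall s l k, (forall n, S (s n)) -> (forall n, f (l - s n) <= k * q ^+ n) ->
    S l) ->
  exists2 x, S x & psi x = x.
Proof.
move=> fc q01 Sx0 Spsi psic Scl; have /andP[q0 q1] := q01.
pose s n := iter n psi x0.
have Ss n : S (s n) by elim: n => //= n; exact: Spsi.
have sP n : f (s n.+1 - s n) <= f (psi x0 - x0) * q ^+ n.
  elim: n => [|n IHn]; first by rewrite expr0 mulr1.
  rewrite (le_trans (psic _ _ (Ss n.+1) (Ss n)))// exprS mulrCA.
  by rewrite ler_wpM2l.
have [l [k lk]] := fc _ _ _ q01 sP.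
have Sl : S l by exact: Scl lk.
exists l => //; apply/eqP; rewrite -subr_eq0; apply/eqP/(nrm_eq0 fn).
(* One [k * q] comes from the contraction applied to [l] and [s n], the other from the distance of
   [l] to [s n.+1]. *)
apply: (@le0_of_geometric _ _ (2 * k * q) q) => // n.
rewrite (le_trans (nrm_dist_add _ (s n.+1) _))//.
rewrite (le_trans (lerD (psic _ _ Sl (Ss n)) (lexx _)))// [f (s _ - _)]nrm_distC.
rewrite (le_trans (lerD (ler_wpM2l q0 (lk n)) (lk n.+1)))// le_eqVlt exprS.
by apply/orP; left; apply/eqP; ring.
Qed.

End NormTheory.

Section RingNorm.
Context (T : pzRingType) (f : T -> R) (fn : is_norm f).
Hypothesis fM : submultiplicative f.

Lemma nrmX x n : f (x ^+ n) <= f 1 * f x ^+ n.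
Proof.
elim: n => [|n IHn]; first by rewrite mulr1.
by rewrite !exprS (le_trans (fM _ _))// mulrCA ler_wpM2l ?nrm_ge0.
Qed.

Lemma neumann t : geo_complete f -> f t < 1 -> invertible (1 - t).
Proof.
move=> fc t1; have t01 : 0 <= f t < 1 by rewrite nrm_ge0.
(* The ring is noncommutative: the fixed point of 1 + t x is a right inverse of 1 - t, that of 1 + x
   t a left inverse, and associativity makes them equal. *)
have [//|x y _ _|//|x _ xE] := @picard _ f fn (fun=> True) (fun x => 1 + t * x) 0 _ fc t01 I.
  by rewrite opprD addrACA subrr add0r -mulrBr.
have [//|x1 y _ _|//|y _ yE] := @picard _ f fn (fun=> True) (fun x => 1 + x * t) 0 _ fc t01 I.
  by rewrite opprD addrACA subrr add0r -mulrBl mulrC.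
have xr : (1 - t) * x = 1 by rewrite mulrBl mul1r -{1}xE addrK.
have yl : y * (1 - t) = 1 by rewrite mulrBr mulr1 -{1}yE addrK.
have xy : x = y by rewrite -[y]mulr1 -xr mulrA yl mul1r.
by exists x; split=> //; rewrite xy.
Qed.

(** The term [t * x] is absorbed into the left-hand side. The factor [f 1] stays because the
    identity matrix of size N has norm N for the scalar [mxnorm]. *)
Lemma nrm_inverse_le t x : f t <= 2^-1 -> x = 1 + t * x -> f x <= 2 * f 1.
Proof.
move=> t2 xE; have : f x <= f 1 + 2^-1 * f x.
  rewrite {1}xE (le_trans (nrmD fn _ _))// lerD2l (le_trans (fM _ _))//.
  by rewrite ler_wpM2r ?nrm_ge0.
by lra.
Qed.

End RingNorm.

Section MatrixNorm.
Context (N : nat).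

(** The entrywise l^1 norm is submultiplicative with constant 1 as soon as [f] is submultiplicative,
    and it dominates every entry. *)
Definition mxnorm (T : Type) (f : T -> R) (A : 'M[T]_N) : R :=
  \sum_i \sum_j f (A i j).

Lemma mxnorm_is_norm (T : zmodType) (f : T -> R) :
  is_norm f -> is_norm (mxnorm f).
Proof.
move=> fn; split=> [A||A B|A|A].
- by apply: sumr_ge0 => i _; apply: sumr_ge0 => j _; exact: nrm_ge0.
- by rewrite /mxnorm big1// => i _; rewrite big1// => j _; rewrite mxE (nrm0 fn).
- rewrite /mxnorm -big_split; apply: ler_sum => i _ /=.
  by rewrite -big_split; apply: ler_sum => j _; rewrite mxE (nrmD fn).
- by apply: eq_bigr => i _; apply: eq_bigr => j _; rewrite mxE (nrmN fn).
- move=> A0; apply/matrixP => i j; rewrite mxE; apply: (nrm_eq0 fn).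
  apply: le_trans A0; rewrite /mxnorm (bigD1 i)//= (bigD1 j)//= -addrA lerDl.
  by rewrite addr_ge0// !sumr_ge0// => *; rewrite ?sumr_ge0// => *; exact: nrm_ge0.
Qed.

Lemma mxnorm_entry (T : zmodType) (f : T -> R) (A : 'M[T]_N) i j :
  is_norm f -> f (A i j) <= mxnorm f A.
Proof.
move=> fn; rewrite /mxnorm (bigD1 i)//= (bigD1 j)//= -addrA lerDl.
by rewrite addr_ge0// !sumr_ge0// => *; rewrite ?sumr_ge0// => *; exact: nrm_ge0.
Qed.

Lemma mxnormM (T : pzRingType) (f : T -> R) : is_norm f ->
  submultiplicative f -> submultiplicative (mxnorm (T:=T) f).
Proof.
move=> fn fM A B.
apply: (@le_trans _ _ (\sum_i \sum_j \sum_k f (A i k) * f (B k j))).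
  apply: ler_sum => i _; apply: ler_sum => j _; rewrite mxE.
  by rewrite (le_trans (nrm_sum fn _ _ _))// ler_sum.
rewrite /mxnorm mulr_suml; apply: ler_sum => i _.
rewrite exchange_big mulr_suml /=; apply: ler_sum => k _.
rewrite -mulr_sumr ler_wpM2l ?nrm_ge0//.
rewrite [leRHS](bigD1 k)//= lerDl.
by rewrite !sumr_ge0// => *; rewrite ?sumr_ge0// => *; exact: nrm_ge0.
Qed.

Lemma mxnorm_le (T : Type) (f : T -> R) (A : 'M[T]_N) (k : R) :
  (forall i j, f (A i j) <= k) -> mxnorm f A <= N%:R * (N%:R * k).
Proof.
move=> Ak; rewrite -[N in leRHS]card_ord !mulr_natl -!sumr_const.
by apply: ler_sum => i _; apply: ler_sum => j _.
Qed.

Lemma mxnorm_complete (T : zmodType) (f : T -> R) : is_norm f ->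
  geo_complete f -> geo_complete (mxnorm (T:=T) f).
Proof.
move=> fn fc s c q q01 sP; have /andP[q0 q1] := q01.
have lP (ij : 'I_N * 'I_N) : exists lk : T * R, forall n,
    f (lk.1 - s n ij.1 ij.2) <= lk.2 * q ^+ n.
  have [n|l [k lk]] := fc (fun n => s n ij.1 ij.2) c q q01; last by exists (l, k).
  apply: le_trans (sP n); apply: le_trans (mxnorm_entry _ ij.1 ij.2 fn).
  by rewrite !mxE.
have [g gP] := choice lP.
exists (\matrix_(i, j) (g (i, j)).1), (\sum_i \sum_j (g (i, j)).2) => n.
rewrite mulr_suml; apply: ler_sum => i _; rewrite mulr_suml.
by apply: ler_sum => j _; rewrite !mxE; exact: (gP (i, j)).
Qed.

End MatrixNorm.

Lemma ffun_complete (I : finType) (T : zmodType) (f : T -> R) : is_norm f ->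
  geo_complete f -> geo_complete (fun g : {ffun I -> T} => \sum_i f (g i)).
Proof.
move=> fn fc s c q q01 sP; have /andP[q0 q1] := q01.
have lP i : exists lk : T * R, forall n, f (lk.1 - s n i) <= lk.2 * q ^+ n.
  have [n|l [k lk]] := fc (fun n => s n i) c q q01; last by exists (l, k).
  apply: le_trans (sP n); rewrite (bigD1 i)//= !ffunE lerDl.
  by rewrite sumr_ge0// => j _; exact: nrm_ge0.
have [g gP] := choice lP.
exists [ffun i => (g i).1], (\sum_i (g i).2) => n.
by rewrite mulr_suml; apply: ler_sum => i _; rewrite !ffunE; exact: gP.
Qed.

Lemma ffun_is_norm (I : finType) (T : zmodType) (f : T -> R) : is_norm f ->
  is_norm (fun g : {ffun I -> T} => \sum_i f (g i)).
Proof.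
move=> fn; split=> [g||g h|g|g g0].
- by apply: sumr_ge0 => i _; exact: nrm_ge0.
- by rewrite big1// => i _; rewrite ffunE (nrm0 fn).
- by rewrite -big_split; apply: ler_sum => i _; rewrite ffunE (nrmD fn).
- by apply: eq_bigr => i _; rewrite ffunE (nrmN fn).
- apply/ffunP => i; rewrite ffunE; apply: (nrm_eq0 fn); apply: le_trans g0.
  by rewrite (bigD1 i)//= lerDl sumr_ge0// => j _; exact: nrm_ge0.
Qed.

Lemma opn_is_norm (H : hilbertType R) : is_norm (@opn R H).
Proof.
split; [exact: opn_ge0|exact: opn0|exact: opnD|exact: opnN|exact: opn_eq0].
Qed.

Lemma opn_complete (H : hilbertType R) : geo_complete (@opn R H).
Proof.
by move=> s c q q01 /(bop_complete q01)[l lP]; exists l, (c / (1 - q)).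
Qed.

Lemma rn_is_norm (V : normedModType (Cplx R)) : is_norm (@rn R V).
Proof.
split; [exact: rn_ge0|exact: rn0|exact: rnD|exact: rnN|].
by move=> u u0; apply: rn_eq0; apply/eqP; rewrite eq_le u0 rn_ge0.
Qed.

End Norms.

(** * Convergence in the complex field through real and imaginary parts *)

Section ComplexSequences.
Context (R : realType).
Implicit Types (s : nat -> Cplx R) (z : Cplx R).

Lemma rn_Re z : `|complex.Re z| <= rn z.
Proof. by rewrite -real_complex_le -rnE; exact: complex.normc_ge_Re. Qed.

Lemma rn_i : rn (('i)%C : Cplx R) = 1.
Proof.
by rewrite /rn complex.normc_def /= expr0n add0r expr1n sqrtr1.
Qed.

Lemma rn_Im z : `|complex.Im z| <= rn z.
Proof.
have -> : rn z = rn ((- ('i)%C) * z : Cplx R).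
  by rewrite rnM rnN rn_i mul1r.
apply: le_trans (rn_Re _); case: z => a b /=.
by rewrite oppr0 mul0r mulN1r sub0r opprK.
Qed.

Lemma rn_le_ReIm z : rn z <= `|complex.Re z| + `|complex.Im z|.
Proof.
have rnr (x : R) : rn ((x%:C)%C : Cplx R) = `|x|.
  by rewrite /rn complex.normc_def /= expr0n addr0 sqrtr_sqr.
rewrite {1}[z]complex.complexE (le_trans (rnD _ _))// rnM rnr rnr.
by rewrite rn_i mul1r.
Qed.

Lemma cvg_ReIm s z :
  (fun n => complex.Re (s n)) @ \oo --> complex.Re z ->
  (fun n => complex.Im (s n)) @ \oo --> complex.Im z -> s @ \oo --> z.
Proof.
move=> sr si; apply/cvg_rnP => e e0.
have e20 : 0 < e / 2 by rewrite divr_gt0.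
have /cvgrPdist_le/(_ _ e20)[n0 _ n0P] := sr.
have /cvgrPdist_le/(_ _ e20)[n1 _ n1P] := si.
exists (maxn n0 n1) => n; rewrite geq_max => /andP[n0n n1n].
apply: (le_trans (rn_le_ReIm _)); rewrite (splitr e) lerD//.
  by apply: le_trans (n0P _ n0n); rewrite raddfB.
by apply: le_trans (n1P _ n1n); rewrite raddfB.
Qed.

Lemma cvg_Re s z : s @ \oo --> z ->
  (fun n => complex.Re (s n)) @ \oo --> complex.Re z.
Proof.
move=> /cvg_rnP sz; apply/cvgrPdist_le => e e0.
have [n0 n0P] := sz _ e0; exists n0 => // n /= nn0.
by rewrite (le_trans _ (n0P _ nn0))// -raddfB rn_Re.
Qed.

End ComplexSequences.

Section ComplexSeries.
Context (R : realType).
Implicit Types (s : nat -> Cplx R) (z : Cplx R).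

Lemma complex_abs_cvg s :
  cvgn (series (fun k => rn (s k))) -> cvgn (series s).
Proof.
move=> cs.
have cRe (f : Cplx R -> R) : (forall z, `|f z| <= rn z) ->
    cvgn (series (fun k => f (s k))).
  move=> frn; apply: normed_cvg; apply: series_le_cvg cs => k //=.
  exact: rn_ge0.
have /cvg_ex[a aP] := cRe _ (@rn_Re R).
have /cvg_ex[b bP] := cRe _ (@rn_Im R).
apply/cvg_ex; exists (a +i* b)%C; apply: cvg_ReIm => /=.
  rewrite (_ : (fun n => _) = series (fun k => complex.Re (s k)))//.
  by apply/funext => n; rewrite /series /= raddf_sum.
rewrite (_ : (fun n => _) = series (fun k => complex.Im (s k)))//.
by apply/funext => n; rewrite /series /= raddf_sum.
Qed.

Lemma rn_lim_le s z (k : R) : s @ \oo --> z -> (forall n, rn (s n) <= k) ->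
  rn z <= k.
Proof.
move=> /cvg_rnP sz sk; apply/ler_addgt0Pl => e e0.
have [n0 /(_ n0 (leqnn _)) n0P] := sz _ e0.
by rewrite -(subrK (s n0) z) (le_trans (rnD _ _))// lerD.
Qed.

(** The steps form an absolutely convergent series, whose partial sums telescope to [s n - s 0];
    completeness is thus inherited from R. *)
Lemma complex_geo_complete : geo_complete (@rn R (Cplx R)).
Proof.
move=> s c q q01 sP; have /andP[q0 q1] := q01.
have c0 : 0 <= c by have := sP 0%N; rewrite expr0 mulr1; apply/le_trans/rn_ge0.
pose d k := s k.+1 - s k.
have dE m n : \sum_(k < n) d (m + k)%N = s (m + n)%N - s m.
  elim: n => [|n IHn]; first by rewrite big_ord0 addn0 subrr.
  by rewrite big_ord_recr /= IHn /d addnS addrC addrA subrK.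
have /cvg_ex[l lP] : cvgn (series d).
  apply: complex_abs_cvg; apply: (@series_le_cvg _ _ (fun k => c * q ^+ k)) => //.
  - by move=> k; exact: rn_ge0.
  - by move=> k; rewrite mulr_ge0// exprn_ge0.
  - by apply: is_cvg_geometric_series; rewrite ger0_norm.
exists (l + s 0%N), (c / (1 - q)); apply: (rn_geometric_limit q01 sP).
apply/cvg_rnP => e e0.
have [n0 n0P] := (cvg_rnP _ _).1 lP _ e0; exists n0 => n nn0.
apply: le_trans (n0P n nn0).
by rewrite /series /= big_mkord (dE 0%N n) opprB addrA addrAC.
Qed.

End ComplexSeries.

(** * Estimates for the inner product *)

Section Inner.
Context (R : realType) (H : hilbertType R).
Implicit Types (u v : H) (c : Cplx R).

Lemma innerC u v : inner u v = (inner v u)^*.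
Proof. by rewrite (hermC inner) /= mul1r. Qed.

Lemma innerZl c u v : inner (c *: u) v = c * inner u v.
Proof. by rewrite linearZl_LR. Qed.

(** A form of Cauchy-Schwarz fit for sums over l^2 sequences. Rotating u by the phase c that makes
    the inner product nonnegative, one expands the nonnegative square norm of c u - v. *)
Lemma inner_le_sqr u v : rn (inner u v : Cplx R) <= rn u ^+ 2 + rn v ^+ 2.
Proof.
have [uv0|uvn0] := eqVneq (inner u v) 0.
  by rewrite uv0 rn0 addr_ge0// sqr_ge0.
set d := inner u v in uvn0 *.
have rd : rn d != 0.
  by apply: contraNneq uvn0 => /rn_eq0 ->.
pose c : Cplx R := d^* / ((rn d)%:C)%C.
have cd : c * d = ((rn d)%:C)%C.
  rewrite /c mulrAC [_ * d]mulrC -normCK rnE expr2 mulfK//.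
  by apply: contraNneq rd => -[->].
have rc : rn c = 1.
  have : rn (c * d) = rn d.
    by rewrite cd rn_real ?rn_ge0.
  by rewrite rnM -[RHS]mul1r => /(mulIf rd).
have := dnorm_ge0 (@inner R H) (c *: u - v).
rewrite dnormB dnormZ /= innerZl -/d cd conj_Creal; last first.
  by apply/complex.complex_realP; eexists.
rewrite !inner_normE !rnE rc expr1n mul1r -!rmorphXn -!rmorphD -rmorphB /=.
rewrite -real_complex0 real_complex_le; have := rn_ge0 d; lra.
Qed.

(** Applying the previous bound to x u directly would give the square of [opn x]. Dividing x u by
    [opn x] first keeps the bound linear in [opn x], as boundedness of the vector functionals
    requires. *)
Lemma inner_op_le (x : bop H) u v :
  rn (inner (x u) v : Cplx R) <= opn x * (rn u ^+ 2 + rn v ^+ 2).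
Proof.
have [x0|xn0] := eqVneq (opn x) 0.
  have -> : x = 0 by apply: opn_eq0; rewrite x0.
  by rewrite [(0 : bop H) u]/(0 : H) linear0l rn0 opn0 mul0r.
have xp : 0 < opn x by rewrite lt_def xn0 opn_ge0.
pose k : Cplx R := ((opn x)%:C)%C.
have k0 : k != 0 by apply: contraNneq xn0 => -[->].
have rk : rn k = opn x.
  by rewrite rn_real ?ltW.
have -> : x u = k *: (k^-1 *: x u) by rewrite scalerA divff// scale1r.
rewrite innerZl rnM rk ler_wpM2l ?opn_ge0// (le_trans (inner_le_sqr _ _))//.
have rkV : rn k^-1 = (opn x)^-1.
  by apply: (mulfI xn0); rewrite -[X in X * rn _]rk -rnM divff// rn1 divff.
rewrite lerD2r rnZ ler_pXn2r ?nnegrE ?mulr_ge0 ?rn_ge0// rkV.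
by rewrite ler_pdivrMl// rn_opn.
Qed.

End Inner.

(** * The ultraweak topology *)

Lemma is_cvg_seriesM (R : realType) (f : nat -> R) (k : R) :
  cvgn (series f) -> cvgn (series (fun n => k * f n)).
Proof.
move=> /cvg_ex[l fl]; apply/cvg_ex; exists (k * l).
rewrite (_ : series _ = fun n => k * series f n); first exact: cvgMr.
by apply/funext => n; rewrite /series /= mulr_sumr.
Qed.

Section Ultraweak.
Context (R : realType) (H : hilbertType R).
Implicit Types (x y w : bop H) (c : Cplx R) (p : ell2_pair H).

Lemma ell2P (xi : nat -> H) :
  ell2 xi <-> cvgn (series (fun k => rn (xi k) ^+ 2)).
Proof.
have sE n : series (fun k => `|xi k| ^+ 2) n =
    ((series (fun k => rn (xi k) ^+ 2) n)%:C)%C :> Cplx R.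
  rewrite /series /= (raddf_sum (real_complex R)).
  by apply: eq_bigr => k _; rewrite rnE -real_complexX.
split=> /cvg_ex[l lP]; apply/cvg_ex.
  exists (complex.Re (l : Cplx R)).
  rewrite (_ : series _ = fun n => complex.Re
    (series (fun k => `|xi k| ^+ 2) n : Cplx R)); first exact: cvg_Re lP.
  by apply/funext => n; rewrite sE.
exists ((l%:C)%C : Cplx R); apply: cvg_ReIm => /=.
  rewrite (_ : (fun n => _) = series (fun k => rn (xi k) ^+ 2))//.
  by apply/funext => n; rewrite sE.
rewrite (_ : (fun n => _) = fun=> 0); first exact: cvg_cst.
by apply/funext => n; rewrite sE.
Qed.

Let vf_dom p : cvgn (@series R (fun k =>
  rn ((sval p).1 k) ^+ 2 + rn ((sval p).2 k) ^+ 2)).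
Proof.
case: p => -[xi eta] /= [/ell2P cxi /ell2P ceta].
rewrite (_ : series _ = series (fun k => rn (xi k) ^+ 2) +
  series (fun k => rn (eta k) ^+ 2)); first exact: is_cvgD.
by apply/funext => n; rewrite /series /= big_split.
Qed.

(** The series is dominated by a summable one, so the [lim] in [vector_functional] is a genuine
    limit. *)
Lemma vf_cvg x p :
  series (fun k => inner (x ((sval p).1 k)) ((sval p).2 k)) @ \oo
    --> (vector_functional x p : Cplx R).
Proof.
apply: complex_abs_cvg.
apply: (@series_le_cvg _ _ (fun k => opn x *
    (rn ((sval p).1 k) ^+ 2 + rn ((sval p).2 k) ^+ 2))) => [k|k|k|].
- exact: rn_ge0.
- by rewrite mulr_ge0 ?opn_ge0// addr_ge0// sqr_ge0.
- exact: inner_op_le.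
- exact: is_cvg_seriesM (@vf_dom p).
Qed.

Lemma vf_unique x p (l : Cplx R) :
  series (fun k => inner (x ((sval p).1 k)) ((sval p).2 k)) @ \oo --> l ->
  vector_functional x p = l.
Proof. move=> xl; exact: cvg_unique _ (@vf_cvg x p) xl. Qed.

Lemma vf_linear c x y p : vector_functional (c *: x + y) p =
  c * vector_functional x p + vector_functional y p.
Proof.
apply: vf_unique.
rewrite (_ : series _ = fun n =>
  c *: series (fun k => inner (x ((sval p).1 k)) ((sval p).2 k)) n +
  series (fun k => inner (y ((sval p).1 k)) ((sval p).2 k)) n).
  by apply: cvgD; [apply: cvgZr|]; exact: vf_cvg.
apply/funext => n; rewrite /series /= scaler_sumr -big_split /=.
apply: eq_bigr => k _.
by rewrite linearDl linearZl_LR.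
Qed.

Lemma vf_bound p : exists k, forall x,
  rn (vector_functional x p : Cplx R) <= opn x * k.
Proof.
exists (lim (series (fun k =>
  rn ((sval p).1 k) ^+ 2 + rn ((sval p).2 k) ^+ 2) @ \oo)) => x.
apply: rn_lim_le (@vf_cvg x p) _ => n.
apply: (@le_trans _ _ (opn x * series (fun k =>
  rn ((sval p).1 k) ^+ 2 + rn ((sval p).2 k) ^+ 2) n)).
  rewrite /series /= mulr_sumr (le_trans (rn_sum _ _ _))// ler_sum// => k _.
  exact: inner_op_le.
rewrite ler_wpM2l ?opn_ge0//; apply: nondecreasing_cvgn_le => //.
by apply: nondecreasing_series => k _ _; rewrite addr_ge0// sqr_ge0.
Qed.

Lemma ell2_op x (xi : nat -> H) : ell2 xi -> ell2 (x \o xi).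
Proof.
move=> /ell2P cxi; apply/ell2P.
apply: (@series_le_cvg _ _ (fun k => opn x ^+ 2 * rn (xi k) ^+ 2)) => [k|k|k|].
- exact: sqr_ge0.
- by rewrite mulr_ge0 ?sqr_ge0.
- rewrite -exprMn ler_pXn2r ?nnegrE ?rn_ge0 ?rn_opn//.
  by rewrite mulr_ge0 ?opn_ge0 ?rn_ge0.
- exact: is_cvg_seriesM.
Qed.

(* right multiplication is transposed to the first vectors, left
   multiplication (by an operator having an adjoint) to the second ones *)
Lemma vf_mulr w p : exists q, forall x,
  vector_functional (x * w) p = vector_functional x q.
Proof.
case: p => -[xi eta] [/= exi eeta].
by exists (exist _ (w \o xi, eta) (conj (@ell2_op w _ exi) eeta)) => x.
Qed.

Lemma vf_mull w w' p : is_adjoint w w' -> exists q, forall x,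
  vector_functional (w * x) p = vector_functional x q.
Proof.
move=> ww'; case: p => -[xi eta] [/= exi eeta].
exists (exist _ (xi, w' \o eta) (conj exi (@ell2_op w' _ eeta))) => x.
apply: vf_unique => /=.
rewrite (_ : series _ = series (fun k => inner (x (xi k)) (w' (eta k)))).
  exact: (@vf_cvg x (exist _ (xi, w' \o eta) (conj exi (@ell2_op w' _ eeta)))).
by congr series; apply/funext => k; exact: ww'.
Qed.

(** Exchanging the two sequences of vectors conjugates the functional; this is ultraweak continuity
    of the adjoint. *)
Lemma vf_adjoint p : exists q, forall x y, is_adjoint x y ->
  vector_functional y p = (vector_functional x q : Cplx R)^*.
Proof.
case: p => -[xi eta] [/= exi eeta].
exists (exist _ (eta, xi) (conj eeta exi)) => x y xy.
apply: vf_unique; apply: (cvg_rnP _ _).2 => e e0 /=.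
have [n0 n0P] := (cvg_rnP _ _).1 (@vf_cvg x (exist _ (eta, xi) (conj eeta exi))) e e0.
exists n0 => n nn0; apply: le_trans (n0P n nn0).
rewrite le_eqVlt; apply/orP; left; apply/eqP.
rewrite -[RHS]rn_conj rmorphB; congr (rn (_ - _)).
rewrite /series /= rmorph_sum; apply: eq_bigr => k _.
by rewrite [LHS]innerC -xy.
Qed.

Lemma ptws_cvgP (I : Type) (V : topologicalType) (F : set_system (I -> V))
    (f : I -> V) : Filter F ->
  F --> (f : {ptws I -> V}) <-> forall i, (fun g => g i) @ F --> f i.
Proof.
move=> FF; have surj i : (fun g : I -> V => g i) @` setT = setT.
  by rewrite eqEsubset; split=> // v _; exists (fun=> v).
split=> [/cvg_sup Ff i|Ff].
  have h := (@cvg_image _ _ (fun g : I -> V => g i) F f FF (surj i)).1 (Ff i).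
  apply: cvg_trans h => Q /= [W FW <-].
  by apply: (@filterS _ F _ W _ _ FW) => g Wg; exists g.
apply/cvg_sup => i; apply/cvg_image => // W /Ff /= Wf.
exists ((fun g : I -> V => g i) @^-1` W) => //.
by rewrite image_preimage// surj.
Qed.

(** Stated for filters, since points of an ultraweak closure need not be limits of sequences. *)
Lemma ultraweak_cvgP (F : set_system (bop H)) (x : bop H) : Filter F ->
  F --> (x : ultraweak H) <->
  forall p, (fun y => vector_functional y p : Cplx R) @ F --> vector_functional x p.
Proof.
move=> FF; transitivity (@vector_functional R H @ F -->
    (vector_functional x : {ptws ell2_pair H -> Cplx R})); last exact: ptws_cvgP.
split=> [Fx|Fx].
  apply: cvg_trans (initial_continuous (x := (x : ultraweak H))).
  exact: cvg_app.
by move=> U [?/= [[W oW <-]]] /= Wx /filterS; apply; apply: Fx; exact: open_nbhs_nbhs.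
Qed.

End Ultraweak.

(** * Norm closures, ultraweak closures and generated algebras *)

Section Closures.
Context (R : realType) (H : hilbertType R).
Implicit Types (x y w : bop H) (c : Cplx R) (S N : set (bop H)).

(** The common frame for von Neumann algebras and for the annihilators of the freeness part:
    whatever is a limit of a geometric iteration inside stays inside. *)
Definition norm_closed S :=
  [/\ S 0, forall c x y, S x -> S y -> S (c *: x + y) &
      forall x, (forall e : R, 0 < e -> exists2 y, S y & opn (x - y) <= e) -> S x].

Lemma opn_cvg_ultraweak (s : nat -> bop H) x :
  (forall e : R, 0 < e -> exists n0, forall n, (n0 <= n)%N -> opn (x - s n) <= e) ->
  s @ \oo --> (x : ultraweak H).
Proof.
move=> sx; apply/ultraweak_cvgP => p; have [k kP] := vf_bound p.
apply: (cvg_rnP _ _).2 => e e0.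
have k1 : 0 < `|k| + 1 by rewrite ltr_pwDr.
have [n0 n0P] := sx (e / (`|k| + 1)) (divr_gt0 e0 k1).
exists n0 => n nn0.
have -> : vector_functional x p - vector_functional (s n) p =
    vector_functional (x - s n) p :> Cplx R.
  have -> : x - s n = -1 *: s n + x by rewrite scaleN1r addrC.
  by rewrite vf_linear mulN1r addrC.
rewrite (le_trans (kP _))// (@le_trans _ _ (opn (x - s n) * (`|k| + 1)))//.
  by rewrite ler_wpM2l ?opn_ge0// (le_trans (ler_norm k))// lerDl.
by rewrite -ler_pdivlMr// n0P.
Qed.

Lemma vn_norm_closed N : von_neumann N -> norm_closed N.
Proof.
move=> [N1 Nlin _ _ Ncl].
have N0 : N 0 by have := Nlin (-1) 1 1 N1 N1; rewrite scaleN1r addNr.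
split=> // x xN.
have /choice[s sP] n : exists y, N y /\ opn (x - y) <= n.+1%:R^-1.
  by have [|y Ny xy] := xN n.+1%:R^-1; [rewrite invr_gt0|exists y].
apply: (@closed_cvg _ (ultraweak H) \oo _ s N) => //.
  by apply: nearW => n; exact: (sP n).1.
apply: opn_cvg_ultraweak => e e0.
have /cvgrPdist_le/(_ _ e0)[n0 _ n0P] := @cvg_harmonic R.
exists n0 => n nn0; apply: le_trans (sP n).2 _.
have := n0P n nn0; rewrite sub0r normrN /harmonic /=; exact/le_trans/ler_norm.
Qed.

(** Stated in one variable because multiplication is in general only separately ultraweakly
    continuous; a product of two closure points is reached by two applications. *)
Lemma closure_map (g : bop H -> bop H) x (A B : set (ultraweak H)) :
  (forall G : set_system (bop H), ProperFilter G -> G --> (x : ultraweak H) ->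
     g @ G --> (g x : ultraweak H)) ->
  closure A x -> (forall y, A y -> closure B (g y)) -> closure B (g x).
Proof.
move=> gc; rewrite {1}closureEcvg => -[G FG [Gx GA]] AB.
apply: (@closed_cvg _ (ultraweak H) G _ g (closure B)).
- exact: closed_closure.
- by apply: GA => y Ay; exact: AB.
- exact: gc.
Qed.

Lemma lin_ultraweak c y x (G : set_system (bop H)) : Filter G ->
  G --> (x : ultraweak H) ->
  (fun x => c *: x + y) @ G --> (c *: x + y : ultraweak H).
Proof.
move=> FG /ultraweak_cvgP Gx; apply/ultraweak_cvgP => p.
suff: (fun z => vector_functional (c *: z + y) p : Cplx R) @ G -->
  vector_functional (c *: x + y) p by [].
rewrite vf_linear (_ : (fun _ => _) = fun x => c *: (vector_functional x p : Cplx R)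
  + vector_functional y p); last first.
  by apply/funext => z; rewrite vf_linear.
by apply: cvgD; [apply: cvgZr|exact: cvg_cst].
Qed.

Lemma mulr_ultraweak w x (G : set_system (bop H)) : Filter G ->
  G --> (x : ultraweak H) -> (fun x => x * w) @ G --> (x * w : ultraweak H).
Proof.
move=> FG /ultraweak_cvgP Gx; apply/ultraweak_cvgP => p.
have [q qP] := vf_mulr w p.
suff: (fun z => vector_functional (z * w) p : Cplx R) @ G -->
  vector_functional (x * w) p by [].
rewrite qP (_ : (fun _ => _) = fun x => (vector_functional x q : Cplx R))//.
by apply/funext => z; rewrite qP.
Qed.

Lemma mull_ultraweak w w' x (G : set_system (bop H)) : is_adjoint w w' ->
  Filter G ->
  G --> (x : ultraweak H) -> (fun x => w * x) @ G --> (w * x : ultraweak H).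
Proof.
move=> ww' FG /ultraweak_cvgP Gx; apply/ultraweak_cvgP => p.
have [q qP] := vf_mull p ww'.
suff: (fun z => vector_functional (w * z) p : Cplx R) @ G -->
  vector_functional (w * x) p by [].
rewrite qP (_ : (fun _ => _) = fun x => (vector_functional x q : Cplx R))//.
by apply/funext => z; rewrite qP.
Qed.

Lemma is_adjoint_sym x y : is_adjoint x y -> is_adjoint y x.
Proof. by move=> xy u v; rewrite innerC -xy -innerC. Qed.

Lemma is_adjointM x x' y y' : is_adjoint x x' -> is_adjoint y y' ->
  is_adjoint (x * y) (y' * x').
Proof. by move=> xx' yy' u v; rewrite [LHS]xx' yy'. Qed.

Lemma is_adjoint_lin c x x' y y' : is_adjoint x x' -> is_adjoint y y' ->
  is_adjoint (c *: x + y) (c^* *: x' + y').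
Proof.
move=> xx' yy' u v.
have -> : inner ((c *: x + y) u) v = c * inner (x u) v + inner (y u) v.
  by rewrite [LHS]linearDl linearZl_LR.
have -> : inner u ((c^* *: x' + y') v) = c * inner u (x' v) + inner u (y' v).
  by rewrite [LHS]linearDr linearZr_LR /= conjCK.
by rewrite xx' yy'.
Qed.

(** Adjoints need no constructor: when the generators are self-adjoint they are obtained by
    reversing the products and conjugating the scalars. *)
Inductive alg S : bop H -> Prop :=
| alg_one : alg S 1
| alg_gen x : S x -> alg S x
| alg_lin c x y : alg S x -> alg S y -> alg S (c *: x + y)
| alg_mul x y : alg S x -> alg S y -> alg S (x * y).

Lemma alg_adjoint S x : (forall y, S y -> selfadjoint y) -> alg S x ->
  exists y, alg S y /\ is_adjoint x y.
Proof.
move=> Ssa; elim=> [|{}x Sx|c {}x y _ [x' [Sx' xx']] _ [y' [Sy' yy']]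
  |{}x y _ [x' [Sx' xx']] _ [y' [Sy' yy']]].
- by exists 1; split=> //; exact: alg_one.
- by exists x; split; [exact: alg_gen|exact: Ssa].
- by exists (c^* *: x' + y'); split; [exact: alg_lin|exact: is_adjoint_lin].
- by exists (y' * x'); split; [exact: alg_mul|exact: is_adjointM].
Qed.

Lemma vn_alg N S x : von_neumann N -> S `<=` N -> alg S x -> N x.
Proof.
move=> [N1 Nlin Nmul _ _] SN.
by elim=> [//|{}x /SN//|c {}x y _ Nx _ Ny|{}x y _ Nx _ Ny]; [exact: Nlin|exact: Nmul].
Qed.

Lemma is_adjoint_unique x y z : is_adjoint x y -> is_adjoint x z -> y = z.
Proof.
move=> xy xz; apply: bopP => v; apply/eqP; rewrite -subr_eq0.
rewrite -(dnorm_eq0 (@inner R H)) linearBr /= -xy -xz subrr//.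
Qed.

(** Each algebra N of the intersection supplies an adjoint of its own; uniqueness of adjoints
    identifies all of them with y. *)
Lemma vn_gen_adjoint S x y : vn_gen S x -> is_adjoint x y -> vn_gen S y.
Proof.
move=> Sx xy N NS; case: (NS) => -[_ _ _ Nadj _] _.
by have [z Nz /(is_adjoint_unique xy) ->] := Nadj _ (Sx _ NS).
Qed.

Lemma vn_gen_norm_closed S : norm_closed (vn_gen S).
Proof.
split=> [N [vN SN]|c x y Sx Sy N NS|x xS N NS].
- by have [] := vn_norm_closed vN.
- have [_ Nlin _] := vn_norm_closed NS.1.
  by apply: Nlin; [exact: Sx|exact: Sy].
- have [_ _ Ncl] := vn_norm_closed NS.1.
  by apply: Ncl => e /xS[y Sy xy]; exists y => //; exact: Sy.
Qed.

End Closures.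

(** * Normal states *)

Section State.
Context (R : realType) (H : hilbertType R) (M : set (bop H)).
Context (phi : bop H -> Cplx R).
Hypothesis hM : von_neumann M.
Hypothesis hphi : faithful_normal_state M phi.
Implicit Types (x y w : bop H) (c : Cplx R) (S N : set (bop H)).

Lemma vn1 : M 1. Proof. by have [] := hM. Qed.

Lemma vn_lin c x y : M x -> M y -> M (c *: x + y).
Proof. by have [_ + _ _ _] := hM; exact. Qed.

Lemma vnM x y : M x -> M y -> M (x * y).
Proof. by have [_ _ + _ _] := hM; exact. Qed.

Lemma vn0 : M 0. Proof. by have [] := vn_norm_closed hM. Qed.

Lemma vnD x y : M x -> M y -> M (x + y).
Proof. by move=> Mx /(vn_lin 1 Mx); rewrite scale1r. Qed.

Lemma vnZ c x : M x -> M (c *: x).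
Proof. by move=> Mx; have := vn_lin c Mx vn0; rewrite addr0. Qed.

Lemma vnN x : M x -> M (- x).
Proof. by move=> Mx; rewrite -scaleN1r; exact: vnZ. Qed.

Lemma vnB x y : M x -> M y -> M (x - y).
Proof. by move=> Mx My; apply: vnD => //; exact: vnN. Qed.

Lemma vnX x n : M x -> M (x ^+ n).
Proof.
move=> Mx; elim: n => [|n IHn]; first by rewrite expr0; exact: vn1.
by rewrite exprS; exact: vnM.
Qed.

Lemma vn_sum (I : Type) (s : seq I) (P : pred I) (f : I -> bop H) :
  (forall i, P i -> M (f i)) -> M (\sum_(i <- s | P i) f i).
Proof. by move=> Mf; apply: big_ind => //; [exact: vn0|exact: vnD]. Qed.

Lemma phi_lin c x y : M x -> M y -> phi (c *: x + y) = c * phi x + phi y.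
Proof. by have [[+ _ _] _ _] := hphi; exact. Qed.

Lemma phi1 : phi 1 = 1. Proof. by have [[]] := hphi. Qed.

Lemma phi0 : phi 0 = 0.
Proof.
have := phi_lin (-1) vn1 vn1; rewrite scaleN1r addNr => ->.
by rewrite mulN1r addNr.
Qed.

Lemma phiD x y : M x -> M y -> phi (x + y) = phi x + phi y.
Proof. by move=> Mx /(phi_lin 1 Mx); rewrite scale1r mul1r. Qed.

Lemma phiZ c x : M x -> phi (c *: x) = c * phi x.
Proof.
by move=> Mx; have := phi_lin c Mx vn0; rewrite addr0 phi0 addr0.
Qed.

Lemma phiN x : M x -> phi (- x) = - phi x.
Proof. by move=> Mx; rewrite -scaleN1r phiZ// mulN1r. Qed.

Lemma phiB x y : M x -> M y -> phi (x - y) = phi x - phi y.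
Proof. by move=> Mx My; rewrite phiD ?phiN//; exact: vnN. Qed.

Lemma phi_sum (I : Type) (s : seq I) (P : pred I) (f : I -> bop H) :
  (forall i, P i -> M (f i)) ->
  phi (\sum_(i <- s | P i) f i) = \sum_(i <- s | P i) phi (f i).
Proof.
move=> Mf; suff [] : M (\sum_(i <- s | P i) f i) /\
  phi (\sum_(i <- s | P i) f i) = \sum_(i <- s | P i) phi (f i) by [].
apply: (big_rec2 (fun x c => M x /\ phi x = c)); first by split; [exact: vn0|exact: phi0].
move=> i x c /Mf Mfi [Mx <-].
by split; [exact: vnD|rewrite phiD].
Qed.

Lemma phi_cvg (G : set_system (bop H)) x : ProperFilter G ->
  G --> (x : ultraweak H) -> G M -> M x -> phi @ G --> phi x.
Proof.
move=> FG Gx GM Mx; have [_ _ /subspace_continuousP cphi] := hphi.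
apply: cvg_trans (cphi x Mx) => U /= phiU.
have := Gx _ phiU; apply: filter_app; apply: filterS GM => y My; exact.
Qed.

(* If [phi] were unbounded on [M], then elements with [phi x = 1] would tend to
   [0] in norm, hence ultraweakly. *)
Lemma phi_bounded : exists2 k : R, 0 <= k & forall x, M x -> rn (phi x) <= k * opn x.
Proof.
have [//|nb] := pselect (exists2 k : R, 0 <= k & forall x, M x -> rn (phi x) <= k * opn x).
have /choice[s sP] (n : nat) : exists x, [/\ M x, phi x = 1 & opn x <= 2^-1 ^+ n].
  have [//|xn] := pselect (exists x, [/\ M x, phi x = 1 & opn x <= 2^-1 ^+ n]).
  exfalso; apply: nb; exists (2 ^+ n); first exact: exprn_ge0.
  move=> x Mx; rewrite leNgt; apply/negP => px; apply: xn.
  have px0 : 0 < rn (phi x).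
    by rewrite (le_lt_trans _ px)// mulr_ge0 ?opn_ge0// exprn_ge0.
  have pxn0 : phi x != 0 by apply: contraTneq px0 => ->; rewrite rn0 ltxx.
  exists ((phi x)^-1 *: x); split; first exact: vnZ.
    by rewrite phiZ// mulVf.
  have rV : rn (phi x)^-1 = (rn (phi x))^-1.
    apply: (mulfI (lt0r_neq0 px0)).
    by rewrite -rnM divff// rn1 divff// lt0r_neq0.
  rewrite (le_trans (opnZ _ _))// rV ler_pdivrMl// exprVn ler_pdivlMr ?exprn_gt0//.
  by rewrite mulrC ltW.
have s0 : s @ \oo --> (0 : ultraweak H).
  apply: opn_cvg_ultraweak => e e0.
  have [|n0 n0P] := @geometric_small R 1 2^-1 e _ e0; first by apply/andP; split; lra.
  exists n0 => n /n0P; rewrite mul1r sub0r opnN; apply: le_trans.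
  by have [] := sP n.
have ps : phi @ (s @ \oo) --> phi 0.
  apply: (@phi_cvg (s @ \oo) 0 _ s0 _ vn0).
  by exists 0%N => // n _; have [] := sP n.
have : (fun n => phi (s n)) @ \oo --> (1 : Cplx R).
  rewrite (_ : (fun n => _) = fun=> 1); first exact: cvg_cst.
  by apply/funext => n; have [] := sP n.
move=> /(cvg_unique (@norm_hausdorff _ _) ps); rewrite phi0 => /eqP.
by rewrite eq_sym oner_eq0.
Qed.

(* The intersection of [M] with the ultraweak closure of [alg S] is a von
   Neumann algebra; since [M] provides the adjoints, Riesz' theorem is not
   needed. *)
Lemma phi_alg_vn_gen S x : S `<=` M -> (forall y, S y -> selfadjoint y) ->
  M x -> (forall y, alg S y -> phi (x * y) = 0) ->
  forall y, vn_gen S y -> phi (x * y) = 0.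
Proof.
move=> SM Ssa Mx xS y Sy.
have [x' Mx' xx'] : exists2 x', M x' & is_adjoint x x'.
  by have [_ _ _ + _] := hM; exact.
pose C : set (ultraweak H) := M `&` closure (alg S : set (ultraweak H)).
have algM z : alg S z -> M z by exact: vn_alg.
have algC z : alg S z -> C z.
  by move=> Sz; split; [exact: algM|exact: subset_closure].
have vC : von_neumann C.
  split.
  - by apply: algC; exact: alg_one.
  - move=> c z w [Mz Cz] [Mw Cw]; split; first exact: vn_lin.
    (* Sums are handled one variable at a time: first with [w1] still in the algebra, then with both
       terms in the closure. *)
    have step z1 w1 : alg S w1 -> closure (alg S : set (ultraweak H)) z1 ->
        closure (alg S : set (ultraweak H)) (c *: z1 + w1).
      move=> Sw1 Cz1; apply: (@closure_map _ _ (fun z => c *: z + w1) z1 _ _ _ Cz1) => [G FG Gz|t St].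
        exact: lin_ultraweak.
      by apply: subset_closure; exact: alg_lin.
    rewrite addrC -[w]scale1r.
    apply: (@closure_map _ _ (fun w => 1 *: w + c *: z) w _ _ _ Cw) => [G FG Gz|t St].
      exact: lin_ultraweak.
    by rewrite scale1r addrC; exact: step.
  - move=> z w [Mz Cz] [Mw Cw]; split; first exact: vnM.
    apply: (@closure_map _ _ (fun z => z * w) z _ _ _ Cz) => [G FG Gz|t St].
      exact: mulr_ultraweak.
    have [t' [_ tt']] := alg_adjoint Ssa St.
    apply: (@closure_map _ _ (fun w => t * w) w _ _ _ Cw) => [G FG Gz|t1 St1].
      exact: mull_ultraweak tt' _ _.
    by apply: subset_closure; exact: alg_mul.
  - move=> z [Mz Cz]; have [w Mw zw] : exists2 w, M w & is_adjoint z w.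
      by have [_ _ _ + _] := hM; exact.
    exists w => //; split=> //.
    (* [star] is meaningful only on [alg S]; the filter G contains [alg S], so its other values do
       not affect the limit. *)
    have /choice[star starP] t : exists t', alg S t -> alg S t' /\ is_adjoint t t'.
      have [St|] := pselect (alg S t); last by exists 0.
      by have [t' tP] := alg_adjoint Ssa St; exists t'.
    move: Cz; rewrite {1}closureEcvg => -[G FG [Gz GS]].
    apply: (@closed_cvg _ (ultraweak H) G _ star (closure (alg S : set (ultraweak H)))).
    + exact: closed_closure.
    + by apply: GS => t St; apply: subset_closure; exact: (starP t St).1.
    + apply/ultraweak_cvgP => p; have [q qP] := vf_adjoint p.
      rewrite (qP _ _ zw).
      have /ultraweak_cvgP/(_ q) Gq := Gz.
      have cconj : (fun t => (vector_functional t q : Cplx R)^*) @ G -->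
          (vector_functional z q : Cplx R)^*.
        apply/cvgrPdist_le => e e0.
        have /cvgrPdist_le/(_ e e0) := Gq.
        by apply: filterS => t; rewrite -rmorphB norm_conjC.
      suff: (fun t => vector_functional (star t) p : Cplx R) @ G -->
        (vector_functional z q : Cplx R)^* by [].
      apply: cvg_trans cconj; apply: near_eq_cvg.
      by apply: GS => t St /=; rewrite (qP _ _ (starP t St).2).
  - by apply: closedI; [have [] := hM|exact: closed_closure].
have [My Cy] : C y.
  by apply: Sy; split=> // z Sz; apply: algC; exact: alg_gen.
move: Cy; rewrite closureEcvg => -[G FG [Gy GS]].
have Gxy : (fun t => phi (x * t)) @ G --> phi (x * y).
  apply: (@phi_cvg ((fun t => x * t) @ G)); last exact: vnM.
    exact: mull_ultraweak xx' _ _.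
  by apply: GS => t St; apply: vnM => //; exact: algM.
have G0 : (fun t => phi (x * t)) @ G --> (0 : Cplx R).
  have G0 : (fun _ : bop H => 0 : Cplx R) @ G --> (0 : Cplx R) by exact: cvg_cst.
  apply: cvg_trans G0; apply: near_eq_cvg.
  by apply: GS => t St /=; rewrite xS.
exact: (cvg_unique (@norm_hausdorff _ _) Gxy G0).
Qed.

End State.

(** The limit defining [eta_tilde] is taken for the max norm of matrices; this reduces it to
    estimates in [mxnorm]. *)
Lemma rn_mx_le (R : realType) (N : nat) (A : 'M[Cplx R]_N) :
  rn A <= mxnorm (@rn R (Cplx R)) A.
Proof.
have nA : `|A| = mx_norm A by [].
have [A0|/mx_norm_neq0[[i j] Aij]] := eqVneq (mx_norm A) 0.
  by rewrite {1}/rn nA A0 (nrm_ge0 (mxnorm_is_norm _ (rn_is_norm _))).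
rewrite {1}/rn nA Aij; exact: (mxnorm_entry A i j (rn_is_norm _)).
Qed.

(** * Matrices over B(H) and over the scalars *)

Section Matrices.
Context (R : realType) (H : hilbertType R) (N : nat).
Implicit Types (A B : 'M[Cplx R]_N) (X Y : 'M[bop H]_N) (x y : bop H).

Notation nm := (mxnorm (@opn R H)).
Notation cn := (mxnorm (@rn R (Cplx R))).

Lemma nm_is_norm : is_norm (nm : 'M[bop H]_N -> R).
Proof. exact/mxnorm_is_norm/opn_is_norm. Qed.

Lemma nmM : submultiplicative (nm : 'M[bop H]_N -> R).
Proof. by apply: mxnormM; [exact: opn_is_norm|exact: opnM]. Qed.

Lemma nm_complete : geo_complete (nm : 'M[bop H]_N -> R).
Proof. by apply: mxnorm_complete; [exact: opn_is_norm|exact: opn_complete]. Qed.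

Lemma cn_is_norm : is_norm (cn : 'M[Cplx R]_N -> R).
Proof. exact/mxnorm_is_norm/rn_is_norm. Qed.

Lemma cnM : submultiplicative (cn : 'M[Cplx R]_N -> R).
Proof.
by apply: mxnormM; [exact: rn_is_norm|move=> x y; rewrite rnM].
Qed.

Lemma cn_complete : geo_complete (cn : 'M[Cplx R]_N -> R).
Proof.
by apply: mxnorm_complete; [exact: rn_is_norm|exact: complex_geo_complete].
Qed.

Lemma tensM A B x y : tens A x * tens B y = tens (A *m B) (x * y).
Proof.
apply/matrixP => i j; rewrite !mxE scaler_suml; apply: eq_bigr => k _.
by rewrite !mxE -bop_scaleAl -bop_scaleAr scalerA.
Qed.

Lemma tensDl A B x : tens (A + B) x = tens A x + tens B x.
Proof. by apply/matrixP => i j; rewrite !mxE scalerDl. Qed.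

Lemma tensNl A x : tens (- A) x = - tens A x.
Proof. by apply/matrixP => i j; rewrite !mxE scaleNr. Qed.

Lemma tensBl A B x : tens (A - B) x = tens A x - tens B x.
Proof. by rewrite tensDl tensNl. Qed.

Lemma tensBr A x y : tens A (x - y) = tens A x - tens A y.
Proof. by apply/matrixP => i j; rewrite !mxE scalerBr. Qed.

Lemma tensZr A (c : Cplx R) x : tens A (c *: x) = tens (c *: A) x.
Proof. by apply/matrixP => i j; rewrite !mxE scalerA mulrC. Qed.

Lemma tens0l x : tens (0 : 'M[Cplx R]_N) x = 0.
Proof. by apply/matrixP => i j; rewrite !mxE scale0r. Qed.

Lemma tens_suml (I : Type) (s : seq I) (P : pred I) (F : I -> 'M[Cplx R]_N) x :
  tens (\sum_(i <- s | P i) F i) x = \sum_(i <- s | P i) tens (F i) x.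
Proof.
exact: (big_morph (fun A => tens A x) (fun A B => tensDl A B x) (tens0l x)).
Qed.

Lemma tens11 : tens (1 : 'M[Cplx R]_N) (1 : bop H) = 1.
Proof.
by apply/matrixP => i j; rewrite !mxE; case: (i == j); rewrite ?scale1r ?scale0r.
Qed.

Lemma nm_tens A x : nm (tens A x) <= cn A * opn x.
Proof.
rewrite /mxnorm mulr_suml ler_sum// => i _; rewrite mulr_suml ler_sum// => j _.
by rewrite mxE opnZ.
Qed.

Lemma nm_tens1 A : nm (tens A (1 : bop H)) <= cn A.
Proof.
rewrite (le_trans (nm_tens _ _))// -[leRHS]mulr1 ler_wpM2l ?opn1//.
exact: nrm_ge0 cn_is_norm _.
Qed.

Definition mx_in (S : set (bop H)) X := forall i j, S (X i j).

Section ClosedSubspace.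
Variables (S : set (bop H)) (Scl : norm_closed S).

Lemma norm_closed0 : S 0. Proof. by have [] := Scl. Qed.

Lemma norm_closed_lin c x y : S x -> S y -> S (c *: x + y).
Proof. by have [_ + _] := Scl; exact. Qed.

Lemma norm_closedD x y : S x -> S y -> S (x + y).
Proof. by move=> Sx /(norm_closed_lin 1 Sx); rewrite scale1r. Qed.

Lemma norm_closedZ c x : S x -> S (c *: x).
Proof. by move=> Sx; have := norm_closed_lin c Sx norm_closed0; rewrite addr0. Qed.

Lemma norm_closed_sum (I : Type) (s : seq I) (P : pred I) (f : I -> bop H) :
  (forall i, P i -> S (f i)) -> S (\sum_(i <- s | P i) f i).
Proof.
by move=> Sf; apply: big_ind => //; [exact: norm_closed0|exact: norm_closedD].
Qed.

Lemma mx_in0 : mx_in S 0.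
Proof. by move=> i j; rewrite mxE; exact: norm_closed0. Qed.

Lemma mx_inD X Y : mx_in S X -> mx_in S Y -> mx_in S (X + Y).
Proof. by move=> SX SY i j; rewrite mxE; exact: norm_closedD. Qed.

Lemma mx_inN X : mx_in S X -> mx_in S (- X).
Proof. by move=> SX i j; rewrite mxE -scaleN1r; exact: norm_closedZ. Qed.

Lemma mx_inB X Y : mx_in S X -> mx_in S Y -> mx_in S (X - Y).
Proof. by move=> SX SY; apply: mx_inD => //; exact: mx_inN. Qed.

Lemma mx_in_sum (I : Type) (s : seq I) (P : pred I) (F : I -> 'M[bop H]_N) :
  (forall i, P i -> mx_in S (F i)) -> mx_in S (\sum_(i <- s | P i) F i).
Proof.
by move=> SF; apply: big_ind => //; [exact: mx_in0|exact: mx_inD].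
Qed.

Lemma mx_in_tens A x : S x -> mx_in S (tens A x).
Proof. by move=> Sx i j; rewrite mxE; exact: norm_closedZ. Qed.

Lemma mx_in_scr A X : mx_in S X -> mx_in S (X * tens A 1).
Proof.
move=> SX i j; rewrite mxE; apply: norm_closed_sum => k _.
by rewrite mxE -bop_scaleAr mulr1; exact: norm_closedZ.
Qed.

Lemma mx_in_limit X (s : nat -> 'M[bop H]_N) (c q : R) : 0 <= q < 1 ->
  (forall r, mx_in S (s r)) -> (forall r, nm (X - s r) <= c * q ^+ r) ->
  mx_in S X.
Proof.
move=> q01 Ss Xs i j; have [_ _] := Scl; apply=> e e0.
have [n0 /(_ n0 (leqnn _)) n0P] := geometric_small c q01 e0.
exists (s n0 i j); first exact: Ss.
apply: le_trans n0P; apply: le_trans (Xs n0).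
by have := mxnorm_entry (X - s n0) i j (opn_is_norm H); rewrite !mxE.
Qed.

(** Cutting the Neumann series after r terms leaves t^r X. The hypothesis concerns powers of t only,
    so that the lemma applies to [central], which is handled merely as a closed subspace. *)
Lemma mx_in_inverse (t X : 'M[bop H]_N) : nm t < 1 -> (forall k, mx_in S (t ^+ k)) ->
  X = 1 + t * X -> mx_in S X.
Proof.
move=> t1 St XE; have t01 : 0 <= nm t < 1 by rewrite (nrm_ge0 nm_is_norm).
apply: (@mx_in_limit X (fun r => \sum_(k < r) t ^+ k) (nm 1 * nm X) _ t01).
  by move=> r; exact: mx_in_sum.
move=> r; have -> : X - \sum_(k < r) t ^+ k = t ^+ r * X.
  elim: r => [|r IHr]; first by rewrite big_ord0 subr0 mul1r.
  by rewrite big_ord_recr /= opprD addrA IHr {1}XE mulrDr mulr1 addrAC subrr add0r mulrA -exprSr.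
rewrite (le_trans (nmM _ _))// mulrAC ler_wpM2r ?(nrm_ge0 nm_is_norm)//.
exact: nrmX nm_is_norm nmM _ _.
Qed.

End ClosedSubspace.

Lemma mx_in_mul (S : set (bop H)) X Y : norm_closed S ->
  (forall x y, S x -> S y -> S (x * y)) -> mx_in S X -> mx_in S Y ->
  mx_in S (X * Y).
Proof.
move=> Scl SM SX SY i j; rewrite mxE; apply: norm_closed_sum => // k _.
exact: SM.
Qed.

Lemma mx_in_exp (S : set (bop H)) X k : norm_closed S -> S 1 ->
  (forall x y, S x -> S y -> S (x * y)) -> mx_in S X -> mx_in S (X ^+ k).
Proof.
move=> Scl S1 SM SX; elim: k => [|k IHk].
  by rewrite expr0 -tens11; exact: mx_in_tens.
by rewrite exprS; exact: mx_in_mul.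
Qed.

Lemma unitmx_1B A : cn A < 1 -> 1 - A \in unitmx.
Proof.
move=> A1; have [B [AB _]] := neumann cn_is_norm cnM cn_complete A1.
by have [] := mulmx1_unit AB.
Qed.

Lemma cn_inv_le A : cn A <= 2^-1 -> cn (invmx (1 - A)) <= 2 * cn (1 : 'M[Cplx R]_N).
Proof.
move=> A2; apply: (nrm_inverse_le cn_is_norm cnM A2).
have A1 : 1 - A \in unitmx by apply: unitmx_1B; apply: le_lt_trans A2 _; lra.
by have := mulmxV A1; rewrite mulmxBl mul1mx => /eqP; rewrite subr_eq => /eqP.
Qed.

Lemma nm_inverse_le (t X : 'M[bop H]_N) : nm t <= 2^-1 -> X = 1 + t * X ->
  nm X <= 2 * nm (1 : 'M[bop H]_N).
Proof. by move=> t2; exact: (nrm_inverse_le nm_is_norm nmM t2). Qed.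

End Matrices.

(** * Boolean cumulants as a resolvent expansion *)

Section ResolventSeries.
Context (R : realType) (E : zmodType) (f : E -> R).
Variables (S : E -> Prop) (T : E -> E) (x0 : E) (tau : R).
Hypotheses (S0 : S 0) (SB : forall x y, S x -> S y -> S (x - y)).
Hypotheses (ST : forall x, S x -> S (T x)) (Sx0 : S x0).
Hypothesis TB : forall x y, S x -> S y -> T (x - y) = T x - T y.
Hypotheses (tau0 : 0 <= tau) (Tle : forall x, S x -> f (T x) <= tau * f x).

(** Unrolling the equation r times leaves the r-th iterate of T at x. T is additive on S only,
    because [phi] is linear on M only. *)
Lemma resolvent_series x : S x -> x = x0 + T x ->
  forall r, f (x - \sum_(k < r) iter k T x0) <= f x * tau ^+ r.
Proof.
move=> Sx xE r; set s := fun r => \sum_(k < r) iter k T x0.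
have SD u v : S u -> S v -> S (u + v).
  move=> Su Sv; rewrite -[v]opprK -[- v]sub0r.
  by apply: SB => //; apply: SB.
have Siter k : S (iter k T x0) by elim: k => //= k; exact: ST.
have Ss m : S (s m) by apply: big_ind => //.
have T0 : T 0 = 0 by rewrite -{1}[0]subr0 TB// subrr.
have TD u v : S u -> S v -> T (u + v) = T u + T v.
  move=> Su Sv; rewrite -{1}[v]opprK -[- v]sub0r TB//; last exact: SB.
  by rewrite TB// T0 sub0r opprK.
have sS m : s m.+1 = x0 + T (s m).
  rewrite /s big_ord_recl /=; congr (_ + _).
  elim: m => [|m IHm]; first by rewrite !big_ord0.
  rewrite big_ord_recr IHm big_ord_recr /= TD//; exact: Ss.
elim: r => [|r IHr]; first by rewrite big_ord0 subr0 expr0 mulr1.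
rewrite -/(s r.+1) sS {1}xE opprD addrACA subrr add0r -TB//.
rewrite (le_trans (Tle _))//; first exact: SB.
by rewrite exprS mulrCA ler_wpM2l.
Qed.

End ResolventSeries.

Section StateMatrices.
Context (R : realType) (H : hilbertType R) (M : set (bop H)).
Context (phi : bop H -> Cplx R) (N : nat).
Hypothesis hM : von_neumann M.
Hypothesis hphi : faithful_normal_state M phi.
Variable K : R.
Hypotheses (K0 : 0 <= K) (hK : forall x, M x -> rn (phi x) <= K * opn x).
Implicit Types (A B : 'M[Cplx R]_N) (X Y : 'M[bop H]_N) (x y : bop H).

Notation nm := (mxnorm (@opn R H)).
Notation cn := (mxnorm (@rn R (Cplx R))).
Let nmN := @nm_is_norm R H N.
Let cnN := @cn_is_norm R N.

(** This is id tensor phi, a bimodule map over the scalar matrices. *)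
Definition phm X : 'M[Cplx R]_N := map_mx phi X.

Let Mcl := vn_norm_closed hM.

Lemma phm_scl A X : mx_in M X -> phm (tens A 1 * X) = A *m phm X.
Proof.
move=> MX; apply/matrixP => i j; rewrite !mxE.
have E k : tens A 1 i k * X k j = A i k *: X k j.
  by rewrite mxE -bop_scaleAl mul1r.
rewrite (phi_sum hM hphi) => [|k _]; last by rewrite E; exact: vnZ.
by apply: eq_bigr => k _; rewrite E (phiZ hM hphi)// mxE.
Qed.

Lemma phm_scr A X : mx_in M X -> phm (X * tens A 1) = phm X *m A.
Proof.
move=> MX; apply/matrixP => i j; rewrite !mxE.
have E k : X i k * tens A 1 k j = A k j *: X i k.
  by rewrite mxE -bop_scaleAr mulr1.
rewrite (phi_sum hM hphi) => [|k _]; last by rewrite E; exact: vnZ.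
by apply: eq_bigr => k _; rewrite E (phiZ hM hphi)// mxE mulrC.
Qed.

Lemma phmD X Y : mx_in M X -> mx_in M Y -> phm (X + Y) = phm X + phm Y.
Proof.
by move=> MX MY; apply/matrixP => i j; rewrite !mxE (phiD hphi).
Qed.

Lemma phmB X Y : mx_in M X -> mx_in M Y -> phm (X - Y) = phm X - phm Y.
Proof.
move=> MX MY; apply/matrixP => i j; rewrite !mxE.
by rewrite -(phiB hM hphi).
Qed.

Lemma phm_tens A x : M x -> phm (tens A x) = phi x *: A.
Proof.
by move=> Mx; apply/matrixP => i j; rewrite !mxE (phiZ hM hphi)// mulrC.
Qed.

Lemma phm_tens1 A : phm (tens A 1) = A.
Proof. by rewrite phm_tens ?(phi1 hphi) ?scale1r//; exact: vn1. Qed.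

Lemma phm1 : phm 1 = 1. Proof. by rewrite -tens11 phm_tens1. Qed.

Lemma phm_sum (I : Type) (s : seq I) (P : pred I) (f : I -> 'M[bop H]_N) :
  (forall i, P i -> mx_in M (f i)) ->
  phm (\sum_(i <- s | P i) f i) = \sum_(i <- s | P i) phm (f i).
Proof.
move=> Mf; apply/matrixP => i j; rewrite mxE !summxE (phi_sum hM hphi).
  by apply: eq_bigr => k _; rewrite mxE.
by move=> k /Mf; exact.
Qed.

Lemma cn_phm X : mx_in M X -> cn (phm X) <= K * nm X.
Proof.
move=> MX; rewrite /mxnorm mulr_sumr ler_sum// => i _.
by rewrite mulr_sumr ler_sum// => j _; rewrite mxE hK.
Qed.

Definition centering X := X - tens (phm X) 1.

Lemma mx_in_centering X : mx_in M X -> mx_in M (centering X).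
Proof.
move=> MX; apply: mx_inB => //; apply: mx_in_tens => //; exact: vn1.
Qed.

Lemma centeringB X Y : mx_in M X -> mx_in M Y ->
  centering (X - Y) = centering X - centering Y.
Proof. by move=> MX MY; rewrite /centering phmB// tensBl !opprD !opprK addrACA. Qed.

Lemma phm_centering X : mx_in M X -> phm (centering X) = 0.
Proof.
move=> MX; rewrite phmB ?phm_tens1 ?subrr//; apply: mx_in_tens => //.
exact: vn1.
Qed.

Lemma nm_centering X : mx_in M X -> nm (centering X) <= (1 + K) * nm X.
Proof.
move=> MX; rewrite (le_trans (nrmB nmN _ _))// mulrDl mul1r lerD2l.
by rewrite (le_trans (nm_tens1 _ _))// cn_phm.
Qed.

Section Cumulants.
Variables (a : bop H) (Ma : M a).

Let T x := a * x - phi (a * x) *: (1 : bop H).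

Let MT k : M (iter k T 1).
Proof.
elim: k => [|k Mk] /=; first exact: vn1.
by apply: vnB => //; [exact: vnM|apply: vnZ => //; exact: vn1].
Qed.

(* Iterating [a x = T x + phi (a x)] from [x = 1] expands [a ^+ n] into the
   recursion defining the Boolean cumulants. *)
Lemma bool_cumulant_iter k :
  bool_cumulant (fun j => phi (a ^+ j)) k.+1 = phi (a * iter k T 1).
Proof.
have powE n : a ^+ n = iter n T 1 +
    \sum_(k < n) phi (a * iter k T 1) *: a ^+ (n - k.+1).
  elim: n => [|n IHn]; first by rewrite big_ord0 addr0.
  rewrite exprS {1}IHn mulrDr big_ord_recr /= subnn expr0 mulr_sumr.
  rewrite {2}/T [X in _ = _ + X]addrC addrA subrK; congr (_ + _).
  apply: eq_bigr => i _.
  by rewrite -bop_scaleAr -exprS -subSn.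
have momE n : phi (a ^+ n.+1) =
    \sum_(k < n.+1) phi (a * iter k T 1) * phi (a ^+ (n - k)).
  have Mt i : M (phi (a * iter i T 1) *: a ^+ (n.+1 - i.+1)).
    by apply: vnZ => //; exact: vnX.
  have M1 := vn1 hM; have MaT := vnM hM Ma (MT n).
  rewrite powE (phiD hphi (MT n.+1)); last exact: vn_sum.
  rewrite (phi_sum hM hphi)// /= {1}/T (phiB hM hphi MaT (vnZ hM _ M1)).
  rewrite (phiZ hM hphi _ M1) (phi1 hphi) mulr1 subrr add0r.
  by apply: eq_bigr => i _; rewrite (phiZ hM hphi)// ?subSS//; exact: vnX.
(* Both families satisfy the same recursion for the moments. The earlier terms agree by induction
   and cancel, and the last one has coefficient phi(1) = 1. *)
elim/ltn_ind: k => k IHk.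
have := @bool_cumulantP R (fun j => phi (a ^+ j)) k.+1 (phi1 hphi) isT.
rewrite momE big_add1 /= big_mkord !big_ord_recr /= subnn expr0 (phi1 hphi) !mulr1.
under [X in _ = X + _ -> _]eq_bigr => i _ do rewrite IHk// subSS.
by move=> /addrI ->; rewrite subnn expr0 (phi1 hphi) mulr1.
Qed.

Variable A : 'M[Cplx R]_N.
(** [1 + K] bounds [centering], so this makes [bool_step A] a contraction of ratio 1/2. *)
Hypothesis Asmall : (1 + K) * (cn A * opn a) <= 2^-1.

Definition bool_step B X := centering (tens B a * X).

Lemma mx_in_bool_step B X : mx_in M X -> mx_in M (bool_step B X).
Proof.
move=> MX; apply: mx_in_centering; apply: mx_in_mul => //; first exact: vnM.
exact: mx_in_tens.
Qed.

Lemma bool_stepB B X Y : mx_in M X -> mx_in M Y ->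
  bool_step B (X - Y) = bool_step B X - bool_step B Y.
Proof.
have MaB Z : mx_in M Z -> mx_in M (tens B a * Z).
  by move=> MZ; apply: mx_in_mul => //; [exact: vnM|exact: mx_in_tens].
by move=> MX MY; rewrite /bool_step mulrBr centeringB//; exact: MaB.
Qed.

Lemma nm_bool_step B X : mx_in M X ->
  nm (bool_step B X) <= (1 + K) * (cn B * opn a) * nm X.
Proof.
move=> MX; apply: le_trans (nm_centering _) _.
  by apply: mx_in_mul => //; [exact: vnM|exact: mx_in_tens].
rewrite -mulrA ler_wpM2l ?addr_ge0// (le_trans (nmM _ _))// ler_wpM2r ?nm_tens//.
exact: nrm_ge0 nmN _.
Qed.

Lemma nm_bool_step_le X : mx_in M X -> nm (bool_step A X) <= 2^-1 * nm X.
Proof.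
move=> MX; rewrite (le_trans (nm_bool_step _ MX))// ler_wpM2r//.
exact: nrm_ge0 nmN _.
Qed.

Lemma mx_in1 : mx_in M (1 : 'M[bop H]_N).
Proof. by rewrite -tens11; apply: mx_in_tens => //; exact: vn1. Qed.

Lemma bool_resolvent_exists : exists2 U, mx_in M U & U = 1 + bool_step A U.
Proof.
have h01 : 0 <= (2^-1 : R) < 1 by apply/andP; split; lra.
have [||X Y MX MY|s l k Ms ls|U MU UE] := @picard _ _ _ nmN (mx_in M)
    (fun X => 1 + bool_step A X) 1 _ (@nm_complete _ _ _) h01.
- exact: mx_in1.
- move=> X MX; apply: mx_inD => //; [exact: mx_in1|exact: mx_in_bool_step].
- rewrite opprD addrACA subrr add0r -bool_stepB//.
  by apply: nm_bool_step_le; exact: mx_inB.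
- exact: (mx_in_limit Mcl h01 Ms ls).
- by exists U.
Qed.

Lemma nm_bool_resolvent U : mx_in M U -> U = 1 + bool_step A U ->
  nm U <= 2 * nm (1 : 'M[bop H]_N).
Proof.
move=> MU UE; have : nm U <= nm (1 : 'M[bop H]_N) + 2^-1 * nm U.
  by rewrite {1}UE (le_trans (nrmD nmN _ _))// lerD2l nm_bool_step_le.
by lra.
Qed.

Lemma phm_bool_resolvent U : mx_in M U -> U = 1 + bool_step A U -> phm U = 1.
Proof.
move=> MU ->; rewrite phmD ?phm1; [|exact: mx_in1|exact: mx_in_bool_step].
rewrite phm_centering ?addr0//.
by apply: mx_in_mul => //; [exact: vnM|exact: mx_in_tens].
Qed.

Lemma mx_in_tensa B X : mx_in M X -> mx_in M (tens B a * X).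
Proof.
by move=> MX; apply: mx_in_mul => //; [exact: vnM|exact: mx_in_tens].
Qed.

(** The iterates remain pure tensors; this is how cumulants of the scalar variable become
    coefficients of a power series in a matrix. *)
Lemma iter_bool_step B k : iter k (bool_step B) 1 = tens (B ^+ k) (iter k T 1).
Proof.
elim: k => [|k IHk] /=; first by rewrite expr0 tens11.
rewrite IHk /bool_step tensM /centering phm_tens; last exact: vnM.
by rewrite -tensZr -tensBr exprS.
Qed.

(** By [iter_bool_step] and [bool_cumulant_iter], the partial sums of [eta_tilde] are the images
    under [phm] of a times the truncated expansion of U. The truncation error halves at each
    step. *)
Lemma eta_tildeE U : mx_in M U -> U = 1 + bool_step A U ->
  eta_tilde phi a A = phm (tens 1 a * U).
Proof.
move=> MU UE; have h01 : 0 <= (2^-1 : R) < 1 by apply/andP; split; lra.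
have dist r : nm (U - \sum_(k < r) iter k (bool_step A) 1) <= nm U * 2^-1 ^+ r.
  apply: (@resolvent_series _ _ _ (mx_in M) (bool_step A) 1) => //.
  - exact: mx_in0.
  - exact: mx_inB.
  - exact: mx_in_bool_step.
  - exact: mx_in1.
  - exact: bool_stepB.
  - exact: nm_bool_step_le.
have Miter k : mx_in M (iter k (bool_step A) 1).
  by rewrite iter_bool_step; apply: mx_in_tens.
have cv : series (fun k => bool_cumulant (fun j => phi (a ^+ j)) k.+1 *: A ^+ k)
    @ \oo --> phm (tens 1 a * U).
  apply: (@cvg_geometric_dist _ _ _ _ (K * (cn (1 : 'M[Cplx R]_N) * opn a * nm U)) _ h01) => r.
  apply: le_trans (rn_mx_le _) _.
  have -> : series (fun k => bool_cumulant (fun j => phi (a ^+ j)) k.+1 *: A ^+ k) r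
      = phm (tens 1 a * \sum_(k < r) iter k (bool_step A) 1).
    rewrite /series /= big_mkord mulr_sumr phm_sum => [|k _].
      apply: eq_bigr => k _; rewrite iter_bool_step tensM phm_tens ?mul1mx.
        by rewrite bool_cumulant_iter.
      exact: vnM.
    exact: mx_in_tensa.
  have Ms : mx_in M (\sum_(k < r) iter k (bool_step A) 1) by exact: mx_in_sum.
  rewrite -phmB; [|exact: mx_in_tensa..].
  rewrite -mulrBr (le_trans (cn_phm _))//; first by apply: mx_in_tensa; exact: mx_inB.
  rewrite -!mulrA ler_wpM2l// mulrA (le_trans (nmM _ _))//.
  rewrite (@le_trans _ _ (cn (1 : 'M[Cplx R]_N) * opn a * nm (U - \sum_(k < r) iter k (bool_step A) 1)))//.
    by rewrite ler_wpM2r ?nm_tens// (nrm_ge0 nmN).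
  by rewrite -!mulrA ler_wpM2l ?(nrm_ge0 cnN)// ler_wpM2l ?opn_ge0.
exact: (cvg_lim (@norm_hausdorff _ _) cv).
Qed.

Lemma eta_tilde_le : cn (eta_tilde phi a A) <=
  K * (cn (1 : 'M[Cplx R]_N) * opn a * (2 * nm (1 : 'M[bop H]_N))).
Proof.
have [U MU UE] := bool_resolvent_exists; rewrite (eta_tildeE MU UE).
rewrite (le_trans (cn_phm (mx_in_tensa _ MU)))// ler_wpM2l// (le_trans (nmM _ _))//.
rewrite ler_pM ?nm_tens ?(nrm_ge0 nmN)//; exact: nm_bool_resolvent.
Qed.

(* The normalized resolvent [U = 1 + bool_step A U] is [X (1 - A eta(A))], and
   [phm U = 1]. *)
Lemma eta_tilde_resolvent X : mx_in M X -> X = 1 + X * tens A a ->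
  phm X *m (1 - A *m eta_tilde phi a A) = 1 /\
  phm (tens 1 a * X) *m (1 - A *m eta_tilde phi a A) = eta_tilde phi a A.
Proof.
move=> MX XE; have [U MU UE] := bool_resolvent_exists.
set W := 1 - A *m _.
(* The equation for U says that (1 - A a) U is the scalar matrix 1 - phi(A a U), which is W. *)
have UX : U = X * tens W 1.
  have U1 : (1 - tens A a) * U = tens W 1.
    rewrite mulrBl mul1r {1}UE /bool_step /centering addrA addrAC addrK.
    have -> : tens A a * U = tens A 1 * (tens 1 a * U).
      by rewrite mulrA tensM mulmx1 mul1r.
    rewrite phm_scl; last exact: mx_in_tensa.
    by rewrite -(eta_tildeE MU UE) /W tensBl tens11.
  rewrite -U1 mulrA mulrBr mulr1.
  by move/eqP: XE; rewrite -subr_eq => /eqP ->; rewrite mul1r.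
split; first by rewrite -phm_scr// -UX; exact: phm_bool_resolvent.
rewrite -phm_scr; last exact: mx_in_tensa.
by rewrite -mulrA -UX -(eta_tildeE MU UE).
Qed.

End Cumulants.

Lemma eta_tilde_lipschitz (a : bop H) A B : M a ->
  (1 + K) * (cn A * opn a) <= 2^-1 -> (1 + K) * (cn B * opn a) <= 2^-1 ->
  cn (eta_tilde phi a A - eta_tilde phi a B) <=
  K * (cn (1 : 'M[Cplx R]_N) * opn a * (2 * ((1 + K) * opn a * (2 * nm (1 : 'M[bop H]_N))))) *
  cn (A - B).
Proof.
move=> Ma As Bs.
have [U MU UE] := bool_resolvent_exists Ma As.
have [V MV VE] := bool_resolvent_exists Ma Bs.
rewrite (eta_tildeE Ma As MU UE) (eta_tildeE Ma Bs MV VE).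
rewrite -phmB; [|exact: mx_in_tensa..].
rewrite -mulrBr.
have MUV : mx_in M (U - V) by exact: mx_inB.
rewrite (le_trans (cn_phm (mx_in_tensa Ma _ MUV)))// -!mulrA ler_wpM2l//.
rewrite (le_trans (nmM _ _))// [leRHS]mulrA ler_pM ?nm_tens ?(nrm_ge0 nmN)//.
(* The change of argument is isolated in the first term; the second is a contraction of the unknown
   difference and is absorbed on the left. *)
have UVE : U - V = bool_step a (A - B) U + bool_step a B (U - V).
  rewrite bool_stepB// {1}UE {1}VE opprD addrACA subrr add0r addrA.
  rewrite /bool_step tensBl mulrBl centeringB ?subrK//; exact: mx_in_tensa.
have : nm (U - V) <= (1 + K) * (cn (A - B) * opn a) * nm U + 2^-1 * nm (U - V).
  rewrite {1}UVE (le_trans (nrmD nmN _ _))// lerD ?nm_bool_step//.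
  exact: nm_bool_step_le.
have := nm_bool_resolvent Ma As MU UE.
have c0 : 0 <= (1 + K) * (cn (A - B) * opn a).
  by rewrite !mulr_ge0 ?addr_ge0 ?opn_ge0 ?(nrm_ge0 cnN).
move=> /(ler_wpM2l c0); lra.
Qed.

End StateMatrices.

(** * Freeness *)

Section PolynomialEvaluation.
Context (R : realType) (H : hilbertType R).
Implicit Types (p q : {poly Cplx R}) (x : bop H) (c : Cplx R).

Lemma peval_widen p x m : (size p <= m)%N ->
  peval p x = \sum_(k < m) p`_k *: x ^+ k.
Proof.
move=> pm; rewrite /peval (big_ord_widen m (fun k => p`_k *: x ^+ k))//.
rewrite big_mkcond; apply: eq_bigr => k _; case: ltnP => // /(nth_default 0) ->.
by rewrite scale0r.
Qed.

Lemma peval_lin c p q x : peval (c *: p + q) x = c *: peval p x + peval q x.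
Proof.
pose m := maxn (size p) (size q).
rewrite (@peval_widen (c *: p + q) x m); last first.
  rewrite (leq_trans (size_polyD _ _))// geq_max leq_maxr andbT.
  by rewrite (leq_trans (size_scale_leq _ _))// leq_maxl.
rewrite (@peval_widen p x m) ?leq_maxl// (@peval_widen q x m) ?leq_maxr//.
rewrite scaler_sumr -big_split; apply: eq_bigr => k _ /=.
by rewrite coefD coefZ scalerDl scalerA.
Qed.

Lemma pevalC c x : peval c%:P x = c *: (1 : bop H).
Proof.
rewrite (@peval_widen _ _ 1) ?size_polyC_leq1// big_ord_recl big_ord0 addr0.
by rewrite coefC /= expr0.
Qed.

Lemma pevalXn k x : peval 'X^k x = x ^+ k.
Proof.
rewrite (@peval_widen _ _ k.+1) ?size_polyXn// big_ord_recr /= coefXn eqxx scale1r.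
rewrite big1 ?add0r// => i _; rewrite coefXn.
by rewrite (ltn_eqF (ltn_ord i)) scale0r.
Qed.

Lemma pevalXM p x : peval ('X * p) x = x * peval p x.
Proof.
rewrite (@peval_widen _ _ (size p).+1); last first.
  by rewrite (leq_trans (size_polyMleq _ _))// size_polyX.
rewrite big_ord_recl coefXM /= scale0r add0r /peval mulr_sumr.
by apply: eq_bigr => k _; rewrite coefXM /= exprS bop_scaleAr.
Qed.

Lemma pevalBC p c x : peval (p - c%:P) x = peval p x - c *: (1 : bop H).
Proof.
by rewrite addrC -scaleN1r peval_lin pevalC scalerA mulN1r scaleNr addrC.
Qed.

End PolynomialEvaluation.

Section Freeness.
Context (R : realType) (H : hilbertType R) (M : set (bop H)).
Context (phi : bop H -> Cplx R) (n : nat) (a : 'I_n -> bop H).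
Hypothesis hM : von_neumann M.
Hypothesis hphi : faithful_normal_state M phi.
Hypothesis Ma : forall i, M (a i).
Hypothesis hfree : free_elements phi a.
Variable K : R.
Hypotheses (K0 : 0 <= K) (hK : forall x, M x -> rn (phi x) <= K * opn x).
Implicit Types (x y w : bop H) (c : Cplx R).

(** Conditions are imposed on M alone, as the values of [phi] elsewhere are arbitrary. *)
Definition bounded_functional (l : bop H -> Cplx R) :=
  (forall c x y, M x -> M y -> l (c *: x + y) = c * l x + l y) /\
  exists2 k : R, 0 <= k & forall x, M x -> rn (l x) <= k * opn x.

Lemma bounded_functional_phi y z : M y -> M z ->
  bounded_functional (fun x => phi (y * x * z)).
Proof.
move=> My Mz; split=> [c x x' Mx Mx'|].
  rewrite mulrDr mulrDl -bop_scaleAr -bop_scaleAl (phi_lin hphi)//.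
    by apply: (vnM hM) => //; exact: (vnM hM).
  by apply: (vnM hM) => //; exact: (vnM hM).
exists (K * (opn y * opn z)); first by rewrite !mulr_ge0 ?opn_ge0.
move=> x Mx; rewrite (le_trans (hK _))//.
  by apply: (vnM hM) => //; exact: (vnM hM).
rewrite -[leRHS]mulrA ler_wpM2l// (le_trans (opnM _ _))// [leRHS]mulrAC ler_wpM2r ?opn_ge0//.
exact: opnM.
Qed.

Lemma bounded_functionalB (l l' : bop H -> Cplx R) c : bounded_functional l ->
  bounded_functional l' -> bounded_functional (fun x => l x - c * l' x).
Proof.
move=> [llin [k k0 kl]] [llin' [k' k0' kl']]; split=> [d x y Mx My|].
  by rewrite llin// llin'//; ring.
exists (k + rn c * k'); first by rewrite addr_ge0// mulr_ge0 ?rn_ge0.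
move=> x Mx; rewrite (le_trans (rnB _ _))// mulrDl lerD ?kl//.
by rewrite rnM -mulrA ler_wpM2l ?rn_ge0 ?kl'.
Qed.

(** The source of closedness for [annihilator], [central] and [orth_mult]: each is rewritten as a
    common zero set of functionals built from x |-> phi(y x z). *)
Lemma norm_closed_annihilator (L : set (bop H -> Cplx R)) :
  (forall l, L l -> bounded_functional l) ->
  norm_closed [set x | M x /\ forall l, L l -> l x = 0].
Proof.
move=> Lb; have [M0 _ Mc] := vn_norm_closed hM; split.
- split=> // l /Lb[llin _].
  have := llin (-1) _ _ M0 M0; rewrite scaler0 addr0 => ->.
  by rewrite mulN1r addNr.
- move=> c x y [Mx Lx] [My Ly]; split; first exact: (vn_lin hM).
  by move=> l Ll; have [-> //] := Lb l Ll; rewrite Lx// Ly// mulr0 addr0.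
- move=> x xL; have Mx : M x.
    by apply: Mc => e /xL[y [My _] xy]; exists y.
  split=> // l Ll; have [llin [k k0 kl]] := Lb l Ll.
  apply: rn_eq0; apply/eqP; rewrite eq_le rn_ge0 andbT.
  apply/ler_addgt0Pr => e e0; rewrite add0r.
  have k1 : 0 < k + 1 by rewrite ltr_wpDl.
  have [y [My Ly] xy] := xL (e / (k + 1)) (divr_gt0 e0 k1).
  have -> : l x = l (x - y).
    by rewrite addrC -scaleN1r llin// Ly// mulr0 add0r.
  rewrite (le_trans (kl _ (vnB hM Mx My)))//.
  rewrite (@le_trans _ _ ((k + 1) * opn (x - y)))//.
    by rewrite ler_wpM2r ?opn_ge0// lerDl.
  by rewrite mulrC -ler_pdivlMr.
Qed.

Definition word (s : seq ('I_n * {poly Cplx R})) : bop H :=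
  \prod_(t <- s) peval t.2 (a t.1).

(** The empty word is centered; in [orth] it contributes the condition phi(x) = 0. *)
Definition centered s := sorted (fun t t' => t.1 != t'.1) s /\
  forall t, t \in s -> phi (peval t.2 (a t.1)) = 0.

Lemma vn_peval p i : M (peval p (a i)).
Proof. by apply: (vn_sum hM) => k _; apply: (vnZ hM); exact: (vnX hM). Qed.

Lemma vn_word s : M (word s).
Proof.
rewrite /word; elim/big_ind: _ => [||t _]; [exact: vn1|exact: vnM|].
exact: vn_peval.
Qed.

Lemma word_cons t s : word (t :: s) = peval t.2 (a t.1) * word s.
Proof. by rewrite /word big_cons. Qed.

Definition starts_with i (s : seq ('I_n * {poly Cplx R})) :=
  if s is t :: _ then t.1 == i else false.

Lemma centered_cons i p s : centered s -> ~~ starts_with i s ->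
  centered ((i, p - (phi (peval p (a i)))%:P) :: s).
Proof.
move=> [ss cs] si; split.
  by case: s ss si {cs} => //= t s -> /[!andbT]; rewrite eq_sym.
move=> t; rewrite inE => /predU1P[->|/cs //] /=.
rewrite pevalBC (phiB hM hphi) ?(phiZ hM hphi) ?(phi1 hphi) ?mulr1 ?subrr//.
- exact: vn1.
- exact: vn_peval.
- by apply: (vnZ hM); exact: vn1.
Qed.

Lemma centered_behead t s : centered (t :: s) -> centered s.
Proof.
move=> [ss cs]; split; first exact: path_sorted ss.
by move=> t' st'; apply: cs; rewrite inE st' orbT.
Qed.

Definition annihilator (P : seq ('I_n * {poly Cplx R}) -> bool) : set (bop H) :=
  [set x | M x /\ forall s, centered s -> P s -> phi (x * word s) = 0].

Lemma annihilator_norm_closed P : norm_closed (annihilator P).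
Proof.
have := @norm_closed_annihilator
  [set l | exists s, [/\ centered s, P s & l = fun x => phi (1 * x * word s)]].
have -> : [set x | M x /\ forall l, [set l | exists s, [/\ centered s, P s &
    l = fun x => phi (1 * x * word s)]] l -> l x = 0] = annihilator P.
  apply/seteqP; split=> x [Mx xP]; split=> //.
    move=> s cs Ps; rewrite -[x]mul1r.
    by apply: (xP (fun x => phi (1 * x * word s))); exists s.
  by move=> _ [s [cs Ps ->]]; rewrite mul1r; exact: xP.
apply=> _ [s [_ _ ->]]; apply: bounded_functional_phi; [exact: vn1|exact: vn_word].
Qed.

(* The closed span of [1] and of the alternating words not ending in [a i] is
   replaced with the annihilator [pre i] of the words starting with [a i]:
   freeness gives [pre1], and multiplication by a centered element of the
   algebra of [a i] maps [pre i] into [post i]. *)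
Definition pre i := annihilator (starts_with i).
Definition post i := annihilator (fun s => ~~ starts_with i s).
Definition orth (J : pred 'I_n) := annihilator (all (fun t => J t.1)).

Lemma pre1 i : pre i 1.
Proof.
split=> [|s [ss cs] si]; first exact: vn1.
by rewrite mul1r; apply: hfree => //; case: s si {ss cs}.
Qed.

Lemma post_pre i j : i != j -> post j `<=` pre i.
Proof.
move=> ij x [Mx xP]; split=> // s cs si; apply: xP => //.
by case: s si {cs} => //= t s /eqP ->.
Qed.

Lemma post_orth j (J : pred 'I_n) : ~~ J j -> post j `<=` orth J.
Proof.
move=> Jj x [Mx xP]; split=> // s cs sJ; apply: xP => //.
by case: s sJ {cs} => //= t s /andP[Jt _]; apply: contraNneq Jj => <-.
Qed.

(** Stands in for the closed algebra generated by [a i]. It retains the factorization used later,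
    which is linear in r and therefore survives norm limits. *)
Definition central i : set (bop H) := [set r | M r /\ forall x s,
  pre i x -> centered s -> ~~ starts_with i s ->
  phi (x * r * word s) = phi r * phi (x * word s)].

Lemma central_norm_closed i : norm_closed (central i).
Proof.
have := @norm_closed_annihilator [set l | exists x s, [/\ pre i x, centered s,
  ~~ starts_with i s &
  l = fun r => phi (x * r * word s) - phi (x * word s) * phi (1 * r * 1)]].
have -> : [set r | M r /\ forall l, [set l | exists x s, [/\ pre i x, centered s,
    ~~ starts_with i s & l = fun r =>
      phi (x * r * word s) - phi (x * word s) * phi (1 * r * 1)]] l -> l r = 0] =
    central i.
  apply/seteqP; split=> r [Mr rP]; split=> //.
    move=> x s ix cs si.
    have := rP (fun r => phi (x * r * word s) - phi (x * word s) * phi (1 * r * 1)).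
    rewrite mul1r mulr1 [phi (x * word s) * _]mulrC => h.
    by apply/eqP; rewrite -subr_eq0 h//; exists x, s.
  move=> _ [x [s [ix cs si ->]]]; by rewrite mul1r mulr1 rP// mulrC subrr.
apply=> _ [x [s [[Mx _] _ _ ->]]]; apply: bounded_functionalB.
  by apply: bounded_functional_phi => //; exact: vn_word.
by apply: bounded_functional_phi; exact: vn1.
Qed.

(** Once centered, p(a_i) can be put in front of s to form a centered word starting with [a i],
    which x annihilates; expanding the centering gives the factorization. *)
Lemma central_peval i p : central i (peval p (a i)).
Proof.
split=> [|x s [Mx xP] cs si]; first exact: vn_peval.
have := xP _ (centered_cons p cs si) (eqxx i).
have M1 := vn1 hM; have Mp := vn_peval p i; have Ms := vn_word s.
rewrite word_cons /= pevalBC mulrBl mulrBr -bop_scaleAl mul1r -bop_scaleAr.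
rewrite (phiB hM hphi); first last.
- by apply: (vnZ hM); exact: (vnM hM).
- by do 2 apply: (vnM hM) => //.
rewrite (phiZ hM hphi); last exact: (vnM hM).
by move=> /eqP; rewrite subr_eq0 mulrA => /eqP.
Qed.

Lemma pre_central_post i x r : pre i x -> central i r ->
  post i (x * (r - phi r *: (1 : bop H))).
Proof.
move=> ix [Mr rP]; have [Mx _] := ix; have M1 := vn1 hM.
have M1' : M (phi r *: (1 : bop H)) by exact: (vnZ hM).
split=> [|s cs si]; first by apply: (vnM hM) => //; exact: (vnB hM).
have Ms := vn_word s.
rewrite mulrBr mulrBl (phiB hM hphi); first last.
- by do 2 apply: (vnM hM) => //.
- by do 2 apply: (vnM hM) => //.
rewrite rP// -bop_scaleAr mulr1 -bop_scaleAl (phiZ hM hphi) ?subrr//.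
exact: (vnM hM).
Qed.

Lemma orth_peval (J : pred 'I_n) i p x s : J i -> orth J x -> centered s ->
  ~~ starts_with i s -> all (fun t => J t.1) s ->
  phi (x * (peval p (a i) * word s)) = 0.
Proof.
move=> Ji [Mx xP] cs si sJ.
have M1 := vn1 hM; have Mp := vn_peval p i; have Ms := vn_word s.
have := xP _ (centered_cons p cs si); rewrite /= Ji sJ => /(_ isT).
rewrite word_cons /= pevalBC mulrBl mulrBr -bop_scaleAl mul1r -bop_scaleAr.
rewrite (phiB hM hphi); first last.
- by apply: (vnZ hM); exact: (vnM hM).
- by do 2 apply: (vnM hM) => //.
rewrite (phiZ hM hphi); last exact: (vnM hM).
by rewrite xP// mulr0 subr0.
Qed.

(** If the word starts with [a i], the new factor merges with its first letter into the polynomial X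
    p, and the tail starts elsewhere by alternation. Otherwise [a i] is itself a new letter. *)
Lemma orth_gen (J : pred 'I_n) i x : J i -> orth J x -> orth J (x * a i).
Proof.
move=> Ji Jx; have [Mx xP] := Jx; split=> [|s cs sJ]; first exact: (vnM hM).
rewrite -mulrA; have [si|si] := boolP (starts_with i s); last first.
  by rewrite -(expr1 (a i)) -pevalXn; exact: orth_peval Jx _ _ _.
case: s cs sJ si => // -[j p] s cs /= /andP[_ sJ] /eqP ji; rewrite {j}ji in cs *.
rewrite word_cons /= [a i * _]mulrA -pevalXM; apply: orth_peval Jx _ _ _ => //.
  exact: centered_behead cs.
by case: cs => + _; case: s {sJ} => //= t s /andP[/[1!eq_sym]].
Qed.

Lemma orth_alg (J : pred 'I_n) x y : orth J x -> alg (a @` [set i | J i]) y ->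
  orth J (x * y).
Proof.
move=> + Jy; have [_ Jlin _] := annihilator_norm_closed (all (fun t => J t.1)).
elim: Jy x => [|_ [i Ji <-]|c y1 y2 _ IH1 _ IH2|y1 y2 _ IH1 _ IH2] x Jx.
- by rewrite mulr1.
- exact: orth_gen.
- by rewrite mulrDr -bop_scaleAr; apply: Jlin; [exact: IH1|exact: IH2].
- by rewrite mulrA; apply: IH2; exact: IH1.
Qed.

Lemma phi_orth J x : orth J x -> phi x = 0.
Proof.
move=> [_ xP]; have := xP [::] _ isT; rewrite /word big_nil mulr1; apply.
by split.
Qed.

(** The right multipliers of [orth J] form a closed algebra containing the [a j] with j in J, hence
    the entries of the resolvent X'_J. *)
Definition orth_mult (J : pred 'I_n) : set (bop H) :=
  [set r | M r /\ forall x, orth J x -> orth J (x * r)].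

Lemma orth_mult_norm_closed J : norm_closed (orth_mult J).
Proof.
have := @norm_closed_annihilator [set l | exists x s, [/\ orth J x, centered s,
  all (fun t => J t.1) s & l = fun r => phi (x * r * word s)]].
have -> : [set r | M r /\ forall l, [set l | exists x s, [/\ orth J x, centered s,
    all (fun t => J t.1) s & l = fun r => phi (x * r * word s)]] l -> l r = 0] =
    orth_mult J.
  apply/seteqP; split=> r [Mr rP]; split=> //.
    move=> x Jx; split=> [|s cs sJ]; first by apply: (vnM hM) => //; case: Jx.
    by apply: (rP (fun r => phi (x * r * word s))); exists x, s.
  by move=> _ [x [s [Jx cs sJ ->]]]; have [_] := rP _ Jx; exact.
apply=> _ [x [s [[Mx _] _ _ ->]]].
by apply: bounded_functional_phi => //; exact: vn_word.
Qed.

End Freeness.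

(** * The subordination formula *)

Section Subordination.
Context (R : realType) (H : hilbertType R) (M : set (bop H)).
Context (phi : bop H -> Cplx R) (n : nat) (a : 'I_n -> bop H) (N : nat).
Hypothesis hM : von_neumann M.
Hypothesis hphi : faithful_normal_state M phi.
Hypothesis Ma : forall i, M (a i).
Hypothesis hfree : free_elements phi a.
Variable K : R.
Hypotheses (K0 : 0 <= K) (hK : forall x, M x -> rn (phi x) <= K * opn x).

Notation nm := (mxnorm (@opn R H)).
Notation cn := (mxnorm (@rn R (Cplx R))).
Notation sc A := (tens A (1 : bop H)).
Let nmN := @nm_is_norm R H N.
Let cnN := @cn_is_norm R N.
Let Mcl := vn_norm_closed hM.

Variables D F : 'I_n -> 'M[Cplx R]_N.

(** In the notation of the overview, [Gimx] is the inverse of G and [tmx j] is t_j; [Bmx j] is the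
    argument of [eta_tilde] in the j-th equation. *)
Definition Qmx j := 1 - \sum_(l | l != j) D l *m F l.
Definition Gimx := 1 - \sum_l D l *m F l.
Definition Bmx j := invmx (Qmx j) *m D j.
Definition tmx j := tens (invmx Gimx *m D j) (a j) - sc (invmx Gimx *m D j *m F j).

Variable eps : R.
Hypothesis eps0 : 0 <= eps.
Hypothesis uQ : forall j, Qmx j \in unitmx.
Hypothesis uG : Gimx \in unitmx.
Hypothesis Bsmall : forall j, (1 + K) * (cn (Bmx j) * opn (a j)) <= 2^-1.
Hypothesis FE : forall j, F j = eta_tilde phi (a j) (Bmx j).
Hypothesis tsmall : forall j, nm (tmx j) <= eps.
(** [eps1] makes Neumann series available for every partial sum of the [tmx j]. [eps2] makes the
    iteration for the L_j contract by 1/2, as r_j - 1 = t_j r_j has norm at most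
    [eps * (2 * nm 1)]. *)
Hypothesis eps1 : n%:R * eps <= 2^-1.
Hypothesis eps2 : n%:R * (eps * (2 * nm (1 : 'M[bop H]_N))) <= 2^-1.

Let G := invmx Gimx.
Let GK : G *m Gimx = 1. Proof. exact: mulVmx. Qed.
Let KG : Gimx *m G = 1. Proof. exact: mulmxV. Qed.
Let QK j : invmx (Qmx j) *m Qmx j = 1. Proof. exact: mulVmx. Qed.
Let KQ j : Qmx j *m invmx (Qmx j) = 1. Proof. exact: mulmxV. Qed.

Let GimxE j : Gimx = Qmx j - D j *m F j.
Proof. by rewrite /Gimx (bigD1 j)//= opprD addrA addrAC. Qed.

Let QGE j : invmx (Qmx j) *m Gimx = 1 - Bmx j *m F j.
Proof. by rewrite (GimxE j) mulmxBr QK mulmxA. Qed.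

Let scM A B : sc A * sc B = sc (A *m B) :> 'M[bop H]_N.
Proof. by rewrite tensM mulr1. Qed.

Let sc_tens A B x : sc A * tens B x = tens (A *m B) x :> 'M[bop H]_N.
Proof. by rewrite tensM mul1r. Qed.

Lemma tensBa_lt1 j : nm (tens (Bmx j) (a j)) < 1.
Proof.
apply: (@le_lt_trans _ _ 2^-1); last by lra.
rewrite (le_trans (nm_tens _ _))// (le_trans _ (Bsmall j))// ler_peMl ?lerDl//.
by rewrite mulr_ge0 ?opn_ge0// (nrm_ge0 cnN).
Qed.

(** Powers of B_j tensor a_j are B_j^k tensor a_j^k, so the Neumann series stays in [central]. The
    two identities come from [eta_tilde_resolvent] at B_j, where the system turns [eta_tilde] into
    F_j. *)
Lemma local_resolvent j : exists2 X : 'M[bop H]_N,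
  is_inverse (1 - tens (Bmx j) (a j)) X &
  [/\ mx_in M X, mx_in (central M phi a j) X,
      phm phi X *m (1 - Bmx j *m F j) = 1 &
      phm phi (tens 1 (a j) * X) = F j *m phm phi X].
Proof.
have [X [XV VX]] := neumann nmN (@nmM _ _ _) (@nm_complete _ _ _) (tensBa_lt1 j).
have XE : X = 1 + tens (Bmx j) (a j) * X.
  by rewrite -XV mulrBl mul1r subrK.
have XE' : X = 1 + X * tens (Bmx j) (a j).
  by rewrite -VX mulrBr mulr1 subrK.
exists X => //.
have expE k : tens (Bmx j) (a j) ^+ k = tens (Bmx j ^+ k) (a j ^+ k) :> 'M[bop H]_N.
  elim: k => [|k IHk]; first by rewrite !expr0 tens11.
  by rewrite !exprS IHk tensM.
have MX : mx_in M X.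
  apply: (mx_in_inverse Mcl (tensBa_lt1 j) _ XE) => k; rewrite expE.
  by apply: mx_in_tens => //; exact: vnX.
have [h1 h2] := eta_tilde_resolvent hM hphi K0 hK (Ma j) (Bsmall j) MX XE'.
rewrite -FE in h1 h2.
split=> //.
  have Ccl := central_norm_closed hM hphi Ma K0 hK j.
  apply: (mx_in_inverse Ccl (tensBa_lt1 j) _ XE) => k; rewrite expE.
  by apply: mx_in_tens => //; rewrite -pevalXn; exact: central_peval.
by rewrite -[F j]h2 -mulmxA (mulmx1C h1) mulmx1.
Qed.

(** Since the inverse of G is Q_j - D_j F_j, the scalar part 1 + G D_j F_j of 1 - t_j equals G Q_j;
    factoring it out leaves B_j a_j. *)
Lemma tmxE j : 1 - tmx j = sc (G *m Qmx j) * (1 - tens (Bmx j) (a j)).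
Proof.
rewrite mulrBr mulr1 sc_tens /Bmx -mulmxA [Qmx j *m _]mulmxA KQ mul1mx.
have -> : G *m Qmx j = 1 + G *m D j *m F j.
  rewrite -[Qmx j](subrK (D j *m F j)) -GimxE mulmxDr GK mulmxA.
  by [].
by rewrite tensDl tens11 /tmx opprB addrA.
Qed.

(** The inverse is the local resolvent times Q_j^-1 G^-1 = 1 - B_j F_j, and the system says exactly
    that this factor inverts phi of the local resolvent. *)
Lemma local_shifted_resolvent j : exists2 r : 'M[bop H]_N,
  is_inverse (1 - tmx j) r & mx_in (central M phi a j) r /\ phm phi r = 1.
Proof.
have [X [XV VX] [MX CX pX _]] := local_resolvent j.
have Ccl := central_norm_closed hM hphi Ma K0 hK j.
exists (X * sc (invmx (Qmx j) *m Gimx)); first split.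
- rewrite tmxE -mulrA [_ * (X * _)]mulrA XV mul1r scM.
  by rewrite -mulmxA [Qmx j *m _]mulmxA KQ mul1mx GK tens11.
- rewrite tmxE -mulrA [sc _ * (_ * _)]mulrA scM.
  by rewrite -mulmxA [Gimx *m _]mulmxA KG mul1mx QK tens11 mul1r.
- split; first exact: mx_in_scr.
  by rewrite (phm_scr hM hphi)// QGE.
Qed.

Lemma mx_in_tmx (S : set (bop H)) j : norm_closed S -> S 1 -> S (a j) ->
  mx_in S (tmx j).
Proof. by move=> Scl S1 Sa; apply: mx_inB => //; exact: mx_in_tens. Qed.

Lemma nm_sum_tmx (J : pred 'I_n) : nm (\sum_(j | J j) tmx j) <= 2^-1.
Proof.
rewrite (le_trans (nrm_sum_le nmN eps0 _))//.
by rewrite card_ord.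
Qed.

Lemma shifted_resolvent (J : pred 'I_n) : exists X : 'M[bop H]_N,
  is_inverse (1 - \sum_(j | J j) tmx j) X.
Proof.
apply: (neumann nmN (@nmM _ _ _) (@nm_complete _ _ _)).
by apply: le_lt_trans (nm_sum_tmx J) _; lra.
Qed.

(* With [X * tmx j = L j * (r j - 1)], the family [L i = X * (1 - tmx i)] (the sum
   of the words not ending in [a i]) is the fixed point of the contraction
   [L |-> (1 + \sum_(j != i) L j (r j - 1))_i], which preserves
   the closed subspaces [pre i]. *)
Lemma resolvent_pre (X : 'M[bop H]_N) i : is_inverse (1 - \sum_j tmx j) X ->
  mx_in (pre M phi a i) (X * (1 - tmx i)).
Proof.
move=> [XV VX].
have /choice[r rP] j : exists r : 'M[bop H]_N, is_inverse (1 - tmx j) r /\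
    (mx_in (central M phi a j) r /\ phm phi r = 1).
  by have [r ? ?] := local_shifted_resolvent j; exists r.
pose L j := X * (1 - tmx j).
have LrE j : L j * (r j - 1) = X * tmx j.
  rewrite /L -mulrA mulrBr mulr1; have [[-> _] _] := rP j.
  by rewrite opprB addrC subrK.
have LE j : L j = 1 + \sum_(l | l != j) L l * (r l - 1).
  rewrite (eq_bigr (fun l => X * tmx l)) => [|l _]; last exact: LrE.
  rewrite -mulr_sumr -VX -mulrDr; congr (_ * _).
  have E (x y z : 'M[bop H]_N) : x - (y + z) + z = x - y.
    by rewrite opprD addrA subrK.
  by rewrite (bigD1 j)//= E.
pose Ls := fix Ls (k : nat) : 'I_n -> 'M[bop H]_N := if k is k'.+1 then
  fun j => 1 + \sum_(l | l != j) Ls k' l * (r l - 1) else fun=> 0.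
have precl j : norm_closed (pre M phi a j).
  exact: (annihilator_norm_closed hM hphi Ma K0 hK (starts_with j)).
have rB l (Y : 'M[bop H]_N) : mx_in (pre M phi a l) Y ->
    mx_in (post M phi a l) (Y * (r l - 1)).
  move=> pY i' k; rewrite mxE.
  apply: norm_closed_sum => [|j _]; first exact: (annihilator_norm_closed hM hphi Ma K0 hK).
  have [_ [Cr pr]] := rP l.
  (* As [phm phi (r l)] is the identity matrix, subtracting 1 centers every entry at once. *)
  have -> : (r l - 1) j k = r l j k - phi (r l j k) *: (1 : bop H).
    rewrite !mxE; congr (_ - _).
    have -> : phi (r l j k) = (phm phi (r l)) j k by rewrite mxE.
    by rewrite pr mxE; case: (j == k); rewrite ?scale1r ?scale0r.
  by apply: (pre_central_post hM hphi Ma).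
have Lspre k j : mx_in (pre M phi a j) (Ls k j).
  elim: k j => [|k IHk] j /=; first by apply: mx_in0.
  apply: mx_inD => //.
    by rewrite -tens11; apply: mx_in_tens => //; exact: (pre1 hM hfree).
  apply: mx_in_sum => // l lj i' j'; apply: (@post_pre _ _ _ _ _ _ _ l).
    by rewrite eq_sym.
  exact: rB.
have h01 : 0 <= (2^-1 : R) < 1 by apply/andP; split; lra.
have rle l : nm (r l - 1) <= eps * (2 * nm (1 : 'M[bop H]_N)).
  have [[rV Vr] _] := rP l.
  have rE : r l = 1 + tmx l * r l by rewrite -rV mulrBl mul1r subrK.
  rewrite {1}rE addrAC subrr add0r (le_trans (nmM _ _))//.
  apply: ler_pM; rewrite ?(nrm_ge0 nmN)//; apply: nm_inverse_le rE.
  by have := nm_sum_tmx (pred1 l); rewrite big_pred1_eq.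
pose c := \sum_j nm (L j).
have Ldist k : \sum_j nm (L j - Ls k j) <= c * 2^-1 ^+ k.
  elim: k => [|k IHk].
    by rewrite expr0 mulr1; apply: ler_sum => j _; rewrite subr0.
  have s0 : 0 <= \sum_j nm (L j - Ls k j).
    by apply: sumr_ge0 => j _; exact: (nrm_ge0 nmN).
  (* Each of the n components is bounded by the sum of all previous errors times the bound [rle];
     [eps2] turns the total factor into 1/2. *)
  rewrite exprS mulrCA (le_trans _ (ler_wpM2l _ IHk))//.
  rewrite (@le_trans _ _ (n%:R * (eps * (2 * nm (1 : 'M[bop H]_N))) *
    \sum_j nm (L j - Ls k j)))//; last exact: ler_wpM2r.
  rewrite -mulrA -[n in n%:R]card_ord mulr_natl -sumr_const ler_sum// => j _.
  rewrite {1}LE /= opprD addrACA subrr add0r -sumrB mulr_sumr.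
  rewrite (le_trans (nrm_sum nmN _ _ _))//.
  rewrite [leRHS](bigID (fun l => l != j))/= ler_wpDr//.
    apply: sumr_ge0 => l _; rewrite mulr_ge0 ?(nrm_ge0 nmN)//.
    by rewrite (le_trans (nrm_ge0 nmN _) (rle l)).
  apply: ler_sum => l _; rewrite -mulrBl (le_trans (nmM _ _))// mulrC.
  by rewrite ler_wpM2r ?(nrm_ge0 nmN).
apply: (@mx_in_limit _ _ _ _ (precl i) _ (fun k => Ls k i) c _ h01) => [k|k].
  exact: Lspre.
rewrite (le_trans _ (Ldist k))// [leRHS](bigD1 i)//= lerDl sumr_ge0// => j _.
exact: (nrm_ge0 nmN).
Qed.

(** With r_j inverse to 1 - t_j, one has (1 - t_j)(r_j - 1) = t_j: an element of [pre] is multiplied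
    by a centered one. *)
Lemma resolvent_post (X : 'M[bop H]_N) j : is_inverse (1 - \sum_j tmx j) X ->
  mx_in (post M phi a j) (X * tmx j).
Proof.
move=> XV; have [r [rV _] [Cr pr]] := local_shifted_resolvent j.
have pX := resolvent_pre j XV.
have -> : X * tmx j = X * (1 - tmx j) * (r - 1).
  rewrite -mulrA; congr (_ * _).
  by rewrite [RHS]mulrBr mulr1 rV opprB addrC subrK.
move=> i k; rewrite mxE.
apply: norm_closed_sum => [|l _]; first exact: (annihilator_norm_closed hM hphi Ma K0 hK).
have -> : (r - 1) l k = r l k - phi (r l k) *: (1 : bop H).
  rewrite !mxE; congr (_ - _).
  have -> : phi (r l k) = (phm phi r) l k by rewrite mxE.
  by rewrite pr mxE; case: (l == k); rewrite ?scale1r ?scale0r.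
by apply: (pre_central_post hM hphi Ma).
Qed.

(** S is left arbitrary because it is used with M, with the von Neumann algebra of the [a j] and
    with [orth_mult]. *)
Lemma sub_resolvent_in (J : pred 'I_n) (X : 'M[bop H]_N) (S : set (bop H)) :
  is_inverse (1 - \sum_(j | J j) tmx j) X ->
  norm_closed S -> S 1 -> (forall x y, S x -> S y -> S (x * y)) ->
  (forall j, J j -> S (a j)) -> mx_in S X.
Proof.
move=> [XV _] Scl S1 SM Sa.
apply: (@mx_in_inverse _ _ _ _ Scl (\sum_(j | J j) tmx j)).
- by apply: le_lt_trans (nm_sum_tmx J) _; lra.
- move=> k; apply: mx_in_exp => //; apply: mx_in_sum => // j Jj.
  by apply: mx_in_tmx => //; exact: Sa.
- by rewrite -{1}XV mulrBl mul1r subrK.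
Qed.

Lemma subordination (J : pred 'I_n) : exists X XJ : 'M[bop H]_N,
  [/\ is_inverse (1 - \sum_i tens (D i) (a i)) X,
      is_inverse (1 - (\sum_(i | J i) tens (D i) (a i) +
                       sc (\sum_(i | ~~ J i) D i *m F i))) XJ,
      mx_in M X,
      mx_in (vn_gen (a @` [set i | J i])) XJ &
      mx_in (orth M phi a J) (X - XJ)].
Proof.
have [Y YV] := shifted_resolvent xpredT.
have [YJ YJV] := shifted_resolvent J.
(* Since G = 1 + G sum_l D_l F_l, the scalar terms indexed by P cancel and G factors out on the
   left. This returns from the t_j to the original variables. *)
have tsum (P : pred 'I_n) : 1 - \sum_(j | P j) tmx j =
    sc G * (1 - (\sum_(i | P i) tens (D i) (a i) + sc (\sum_(i | ~~ P i) D i *m F i))).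
  rewrite mulrBr mulr1 mulrDr scM mulr_sumr.
  have -> : \sum_(i | P i) sc G * tens (D i) (a i) =
      \sum_(i | P i) tens (G *m D i) (a i) :> 'M[bop H]_N.
    by apply: eq_bigr => i _; rewrite sc_tens.
  have GE : G = 1 + G *m (\sum_(i | P i) D i *m F i) + G *m (\sum_(i | ~~ P i) D i *m F i).
    have DF : \sum_l D l *m F l =
        \sum_(i | P i) D i *m F i + \sum_(i | ~~ P i) D i *m F i.
      by rewrite (bigID P).
    by rewrite -addrA -mulmxDr -DF -GK -mulmxDr subrK mulmx1.
  have E (x y w : 'M[bop H]_N) : x + y - (w + y) = x - w.
    by rewrite opprD addrACA subrr addr0.
  rewrite {1}GE !tensDl tens11 E sumrB opprB addrA; congr (_ + _ - _).
  by rewrite mulmx_sumr tens_suml; apply: eq_bigr => i _; rewrite mulmxA.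
have inv (P : pred 'I_n) Z : is_inverse (1 - \sum_(j | P j) tmx j) Z ->
    is_inverse (1 - (\sum_(i | P i) tens (D i) (a i) +
      sc (\sum_(i | ~~ P i) D i *m F i))) (Z * sc G).
  rewrite tsum => -[ZV VZ]; split; last by rewrite -mulrA.
  set W := 1 - _ in ZV VZ *.
  have scK : sc Gimx * sc G = 1 :> 'M[bop H]_N by rewrite scM KG tens11.
  have scK' : sc G * sc Gimx = 1 :> 'M[bop H]_N by rewrite scM GK tens11.
  have -> : W * (Z * sc G) = sc Gimx * (sc G * W * Z) * sc G.
    by rewrite !mulrA scK mul1r.
  by rewrite ZV mulr1.
have Jcl := orth_mult_norm_closed hM hphi Ma K0 hK J.
have Ocl : norm_closed (orth M phi a J).
  exact: (annihilator_norm_closed hM hphi Ma K0 hK _).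
exists (Y * sc G), (YJ * sc G); split.
- have := inv xpredT Y YV; rewrite [\sum_(i | ~~ _) _]big_pred0_eq.
  by rewrite tens0l addr0.
- exact: inv YJV.
- apply: mx_in_scr => //; apply: sub_resolvent_in YV Mcl _ _ _ => //.
    exact: vn1.
  exact: vnM.
- apply: mx_in_scr; first exact: vn_gen_norm_closed.
  apply: sub_resolvent_in YJV (vn_gen_norm_closed _) _ _ _.
  + by move=> S [[]].
  + move=> x y Sx Sy S SS; have [[_ _ SM _ _] _] := SS.
    by apply: SM; [exact: Sx|exact: Sy].
  + by move=> j Jj S [_ SS]; apply: SS; exists j.
- rewrite -mulrBl; apply: mx_in_scr => //.
  have -> : Y - YJ = Y * (\sum_(j | ~~ J j) tmx j) * YJ.
    have [_ VY] := YV; have [YJV1 _] := YJV.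
    have -> : \sum_(j | ~~ J j) tmx j =
        (1 - \sum_(j | J j) tmx j) - (1 - \sum_j tmx j).
      by rewrite [\sum_j tmx j](bigID J)/= !opprD !opprK addrACA subrr add0r addrA addNr add0r.
    by rewrite mulrBr VY mulrBl -mulrA YJV1 mulr1 mul1r.
  (* For j outside J, X' t_j lies in [post j], hence in [orth J], and right multiplication by the
     entries of [YJ] preserves it. *)
  have JY : mx_in (orth_mult M phi a J) YJ.
    apply: sub_resolvent_in YJV Jcl _ _ _.
    + by split=> [|x Jx]; [exact: vn1|rewrite mulr1].
    + move=> x y [Mx Jx] [My Jy]; split=> [|z Jz]; first exact: (vnM hM).
      by rewrite mulrA; apply: Jy; exact: Jx.
    + by move=> j Jj; split=> // x Jx; exact: (orth_gen hM hphi Ma).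
  move=> i k; rewrite mxE; apply: norm_closed_sum => // l _.
  have [_] := JY l k; apply.
  rewrite mulr_sumr; apply: mx_in_sum => // j Jj i' k'.
  by apply: (post_orth Jj); exact: resolvent_post.
Qed.

End Subordination.

Lemma is_inverse_unique (A : pzRingType) (x y z : A) :
  is_inverse x y -> is_inverse x z -> y = z.
Proof. by move=> [_ yx] [xz _]; rewrite -[y]mulr1 -xz mulrA yx mul1r. Qed.

Lemma rinvE (A : pzRingType) (x y : A) : is_inverse x y -> rinv x = y.
Proof.
by move=> xy; apply: xget_unique => // z xz; exact: is_inverse_unique xz xy.
Qed.

(** * The system at a fixed small z: consequences and existence of solutions *)

Section SmallSystem.
Context (R : realType) (H : hilbertType R) (M : set (bop H)).
Context (phi : bop H -> Cplx R) (n : nat) (a : 'I_n -> bop H) (N : nat).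
Hypothesis hM : von_neumann M.
Hypothesis hphi : faithful_normal_state M phi.
Hypothesis Ma : forall i, M (a i).
Hypothesis hsa : forall i, selfadjoint (a i).
Hypothesis hfree : free_elements phi a.
Variable K : R.
Hypotheses (K0 : 0 <= K) (hK : forall x, M x -> rn (phi x) <= K * opn x).

Notation nm := (mxnorm (@opn R H)).
Notation cn := (mxnorm (@rn R (Cplx R))).
Notation sc A := (tens A (1 : bop H)).
Let nmN := @nm_is_norm R H N.
Let cnN := @cn_is_norm R N.
Let Mcl := vn_norm_closed hM.
Implicit Types (D F : 'I_n -> 'M[Cplx R]_N).

Definition solves D F := forall i,
  F i = eta_tilde phi (a i) (invmx (1 - \sum_(j | j != i) D j *m F j) *m D i).

Let alpha := \sum_i opn (a i).
Let kappa := cn (1 : 'M[Cplx R]_N).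
Let nu := nm (1 : 'M[bop H]_N).

Let alpha0 : 0 <= alpha. Proof. by apply: sumr_ge0 => i _; exact: opn_ge0. Qed.
Let kappa0 : 0 <= kappa. Proof. exact: (nrm_ge0 cnN). Qed.
Let nu0 : 0 <= nu. Proof. exact: (nrm_ge0 nmN). Qed.

Let opn_alpha i : opn (a i) <= alpha.
Proof.
by rewrite /alpha (bigD1 i)//= lerDl sumr_ge0// => j _; exact: opn_ge0.
Qed.

Lemma small_multiples (s : seq R) : (forall x, x \in s -> 0 <= x) ->
  exists2 e : R, 0 < e <= 1 & forall x, x \in s -> x * e <= 2^-1.
Proof.
move=> s0; pose S := \sum_(x <- s) x.
have S0 : 0 <= S.
  by rewrite /S big_seq; apply: sumr_ge0 => x; exact: s0.
have S1 : 0 < 2 * (1 + S) by rewrite mulr_gt0// ltr_pwDl.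
exists (2 * (1 + S))^-1.
  by rewrite invr_gt0 S1 invf_le1//; lra.
move=> x xs; have xS : x <= S.
  rewrite /S (big_rem x)//= lerDl big_seq; apply: sumr_ge0 => y /mem_rem.
  exact: s0.
by rewrite ler_pdivrMr//; lra.
Qed.

Lemma cn_sumM D F (P : pred 'I_n) (e k : R) : 0 <= e -> 0 <= k ->
  (forall i, cn (D i) <= e) -> (forall i, cn (F i) <= k) ->
  cn (\sum_(l | P l) D l *m F l) <= n%:R * k * e.
Proof.
move=> e0 k0 De Fk; rewrite (le_trans (nrm_sum_le cnN (mulr_ge0 k0 e0) _))//.
  move=> i _; rewrite (le_trans (cnM _ _))// mulrC ler_pM ?(nrm_ge0 cnN)//.
by rewrite card_ord mulrA.
Qed.

Lemma unitmx_1B_sum D F (P : pred 'I_n) (e k : R) : 0 <= e -> 0 <= k ->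
  (forall i, cn (D i) <= e) -> (forall i, cn (F i) <= k) ->
  n%:R * k * e <= 2^-1 ->
  1 - \sum_(l | P l) D l *m F l \in unitmx /\
  cn (invmx (1 - \sum_(l | P l) D l *m F l)) <= 2 * kappa.
Proof.
move=> e0 k0 De Fk ek; have S2 := le_trans (cn_sumM P e0 k0 De Fk) ek.
by split; [apply: unitmx_1B; apply: le_lt_trans S2 _; lra|exact: cn_inv_le].
Qed.

(** The threshold e depends on F only through k, so the conclusions hold for every solution within
    that bound, however it was obtained. *)
Lemma small_solution (k : R) : 0 <= k -> exists2 e : R, 0 < e &
  forall D F, (forall i, cn (D i) <= e) -> (forall i, cn (F i) <= k) ->
  solves D F ->
  [/\ 1 - \sum_l D l *m F l \in unitmx,
    exists X, [/\ is_inverse (1 - \sum_i tens (D i) (a i)) X, mx_in M X,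
      phm phi X = invmx (1 - \sum_l D l *m F l) &
      forall j, phm phi (X * tens 1 (a j)) = F j *m phm phi X] &
    forall J : pred 'I_n, exists X XJ, [/\
      is_inverse (1 - \sum_i tens (D i) (a i)) X,
      is_inverse (1 - (\sum_(i | J i) tens (D i) (a i) +
                       sc (\sum_(i | ~~ J i) D i *m F i))) XJ,
      mx_in (vn_gen (a @` [set i | J i])) XJ &
      forall y, vn_gen (a @` [set i | J i]) y ->
        forall i j, phi (X i j * y) = phi (XJ i j * y)]].
Proof.
move=> k0.
(* G has norm at most [2 * kappa] and D_j at most e, so [t * e] bounds t_j = G D_j (a_j - F_j). *)
pose t := 2 * kappa * (alpha + k).
have t0 : 0 <= t by rewrite !mulr_ge0 ?addr_ge0.
(* In order: invertibility of the matrices 1 - sum D_l F_l, smallness of B_j, and the conditions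
   [eps1] and [eps2] for [t * e]. *)
have [|e /andP[e0 _] eP] := small_multiples
    (s := [:: n%:R * k; (1 + K) * (2 * kappa * alpha); n%:R * t;
             n%:R * (t * (2 * nu))]).
  by move=> x; rewrite !inE => /or4P[] /eqP ->; rewrite !mulr_ge0 ?addr_ge0.
exists e => // D F De Fk sDF; have e0' := ltW e0.
have h1 : n%:R * k * e <= 2^-1 by apply: eP; rewrite !inE eqxx.
have h2 : (1 + K) * (2 * kappa * alpha) * e <= 2^-1 by apply: eP; rewrite !inE eqxx ?orbT.
have h3 : n%:R * t * e <= 2^-1 by apply: eP; rewrite !inE eqxx ?orbT.
have h4 : n%:R * (t * (2 * nu)) * e <= 2^-1 by apply: eP; rewrite !inE eqxx ?orbT.
have Qb j := unitmx_1B_sum (fun l => l != j) e0' k0 De Fk h1.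
have [uG Gb] := unitmx_1B_sum xpredT e0' k0 De Fk h1.
have uQ j : Qmx D F j \in unitmx by have [] := Qb j.
have Bb j : cn (Bmx D F j) <= 2 * kappa * e.
  by rewrite (le_trans (cnM _ _))// ler_pM ?(nrm_ge0 cnN)//; have [] := Qb j.
have Bsmall j : (1 + K) * (cn (Bmx D F j) * opn (a j)) <= 2^-1.
  apply: le_trans h2; rewrite -mulrA ler_wpM2l ?addr_ge0// mulrAC.
  by rewrite ler_pM ?(nrm_ge0 cnN) ?opn_ge0.
have tsmall j : nm (tmx a D F j) <= t * e.
  have GD : cn (invmx (Gimx D F) *m D j) <= 2 * kappa * e.
    by rewrite (le_trans (cnM _ _))// ler_pM ?(nrm_ge0 cnN).
  have ke0 : 0 <= 2 * kappa * e by rewrite !mulr_ge0.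
  rewrite (le_trans (nrmB nmN _ _))// /t mulrAC mulrDr lerD//.
    rewrite (le_trans (nm_tens _ _))// ler_pM ?(nrm_ge0 cnN) ?opn_ge0//.
  rewrite (le_trans (nm_tens1 _ _))// (le_trans (cnM _ _))//.
  by rewrite ler_pM ?(nrm_ge0 cnN).
have te0 : 0 <= t * e by rewrite mulr_ge0.
have e1 : n%:R * (t * e) <= 2^-1 by rewrite mulrA.
have e2 : n%:R * (t * e * (2 * nu)) <= 2^-1.
  by apply: le_trans h4; rewrite le_eqVlt; apply/orP; left; apply/eqP; ring.
have sub := subordination hM hphi Ma hfree K0 hK te0 uQ uG Bsmall sDF tsmall e1 e2.
have phmJ (J : pred 'I_n) (X XJ : 'M[bop H]_N) : mx_in M X -> mx_in M XJ ->
    mx_in (orth M phi a J) (X - XJ) -> phm phi X = phm phi XJ.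
  move=> MX MXJ O; apply/eqP; rewrite -subr_eq0 -(phmB hM hphi)//.
  by apply/eqP/matrixP => i j; rewrite !mxE; have := phi_orth (O i j); rewrite !mxE.
have genM (J : pred 'I_n) : vn_gen (a @` [set i | J i]) `<=` M.
  by move=> x; apply; split=> // _ [i _ <-].
split=> //.
- have [X [X0 [XV X0V MX X0J O0]]] := sub pred0.
  exists X; split=> //.
    have MX0 : mx_in M X0 by move=> i j; exact: (genM pred0 _ (X0J i j)).
    rewrite (phmJ _ _ _ MX MX0 O0).
    have -> : X0 = sc (invmx (1 - \sum_l D l *m F l)).
      apply: is_inverse_unique X0V _.
      rewrite big_pred0_eq add0r -tens11 -tensBl.
      by split; rewrite tensM mulr1 ?mulmxV ?mulVmx//; exact: tens11.
    exact: (phm_tens1 hM hphi).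
  move=> j; have [X' [Xj [XV' XjV _ XjJ Oj]]] := sub (pred1 j).
  rewrite (is_inverse_unique XV' XV) in Oj.
  have MXj : mx_in M Xj by move=> i l; exact: (genM (pred1 j) _ (XjJ i l)).
  have [Y [YV VY] [MY _ _ pY]] :=
    local_resolvent hM hphi Ma K0 hK Bsmall sDF j.
  have XjE : Xj = Y * sc (invmx (Qmx D F j)).
    apply: is_inverse_unique XjV _.
    have -> : 1 - (\sum_(i | pred1 j i) tens (D i) (a i) +
        sc (\sum_(i | ~~ pred1 j i) D i *m F i)) =
        sc (Qmx D F j) * (1 - tens (Bmx D F j) (a j)).
      rewrite big_pred1_eq mulrBr mulr1 tensM mul1r mulmxA mulmxV// mul1mx.
      by rewrite [in RHS]tensBl tens11 opprD addrA addrAC.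
    split.
      rewrite -mulrA [_ * (Y * _)]mulrA YV mul1r tensM mulr1 mulmxV//.
      exact: tens11.
    rewrite -mulrA [sc _ * (_ * _)]mulrA tensM mulr1 mulVmx// [tens _ _]tens11.
    by rewrite mul1r.
  (* The cumulant identity has a_j on the left of the local resolvent, while orthogonality allows
     multiplication on the right only; the two agree because B tensor a_j commutes with 1 tensor
     a_j. *)
  have comm : Y * tens 1 (a j) = tens 1 (a j) * Y.
    have c : tens 1 (a j) * (1 - tens (Bmx D F j) (a j)) =
        (1 - tens (Bmx D F j) (a j)) * tens 1 (a j) :> 'M[bop H]_N.
      by rewrite mulrBr mulrBl mulr1 mul1r !tensM mul1mx mulmx1.
    rewrite -[LHS]mulr1 -YV mulrA -[Y * _ * _]mulrA c !mulrA VY mul1r//.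
  have MY' : mx_in M (tens 1 (a j) * Y).
    by apply: mx_in_mul => //; [exact: vnM|exact: mx_in_tens].
  have -> : phm phi (X * tens 1 (a j)) = phm phi (Xj * tens 1 (a j)).
    apply: (phmJ (pred1 j)).
    + by apply: mx_in_mul => //; [exact: vnM|exact: mx_in_tens].
    + by apply: mx_in_mul => //; [exact: vnM|exact: mx_in_tens].
    + have tE r l : tens (1 : 'M[Cplx R]_N) (a j) r l = (r == l)%:R *: a j.
        by rewrite !mxE.
      rewrite -mulrBl => i l; rewrite mxE (bigD1 l)//= big1 => [|r rl].
        rewrite addr0 tE eqxx scale1r.
        by apply: (orth_gen hM hphi Ma) => //=.
      by rewrite tE (negbTE rl) scale0r mulr0.
  have -> : Xj * tens 1 (a j) = tens 1 (a j) * Y * sc (invmx (Qmx D F j)).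
    rewrite XjE -comm -!mulrA; congr (_ * _).
    by rewrite !tensM mulmx1 mul1mx mul1r mulr1.
  rewrite (phm_scr hM hphi)// pY (phmJ _ _ _ MX MXj Oj) XjE (phm_scr hM hphi)//.
  by rewrite mulmxA.
- move=> J; have [X [XJ [XV XJV MX XJJ O]]] := sub J.
  exists X, XJ; split=> // y Jy i j; apply/eqP; rewrite -subr_eq0.
  have My := genM J _ Jy.
  rewrite -(phiB hM hphi); first last.
  + by apply: vnM => //; exact: (genM J _ (XJJ i j)).
  + exact: vnM.
  rewrite -mulrBl; have -> : X i j - XJ i j = (X - XJ) i j by rewrite !mxE.
  (* Orthogonality is known against the algebra of the [a i], i in J, and normality of the state
     extends it to the von Neumann algebra. *)
  apply/eqP; apply: (phi_alg_vn_gen hM hphi _ _ _ _ Jy).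
  + by move=> _ [l _ <-].
  + by move=> _ [l _ <-].
  + by have [] := O i j.
  + move=> z Jz; exact: (phi_orth (orth_alg hM hphi Ma K0 hK (O i j) Jz)).
Qed.

Lemma solution_exists : exists2 k : R, 0 <= k & exists2 e : R, 0 < e &
  forall D, (forall i, cn (D i) <= e) ->
    exists2 F, forall i, cn (F i) <= k & solves D F.
Proof.
(* [k] and [lam] are the constants of [eta_tilde_le] and [eta_tilde_lipschitz], with every norm
   [opn (a i)] replaced by the larger [alpha]. *)
pose k := K * (kappa * alpha * (2 * nu)).
pose lam := K * (kappa * alpha * (2 * ((1 + K) * alpha * (2 * nu)))).
have k0 : 0 <= k by rewrite !mulr_ge0.
have lam0 : 0 <= lam by rewrite !mulr_ge0 ?addr_ge0.
exists k => //.
have [|e /andP[e0 el1] eP] := small_multiples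
    (s := [:: n%:R * k; (1 + K) * (2 * kappa * alpha);
              n%:R * (lam * (2 * kappa) * (2 * kappa))]).
  by move=> x; rewrite !inE => /or3P[] /eqP ->; rewrite !mulr_ge0 ?addr_ge0.
exists e => // D De; have e0' := ltW e0.
have h1 : n%:R * k * e <= 2^-1 by apply: eP; rewrite !inE eqxx.
have h2 : (1 + K) * (2 * kappa * alpha) * e <= 2^-1 by apply: eP; rewrite !inE eqxx ?orbT.
have h3 : n%:R * (lam * (2 * kappa) * (2 * kappa)) * e <= 2^-1.
  by apply: eP; rewrite !inE eqxx ?orbT.
pose psi (F : {ffun 'I_n -> 'M[Cplx R]_N}) : {ffun 'I_n -> 'M[Cplx R]_N} :=
  [ffun i => eta_tilde phi (a i) (Bmx D F i)].
pose S (F : {ffun 'I_n -> 'M[Cplx R]_N}) := forall i, cn (F i) <= k.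
have Bsmall (F : {ffun 'I_n -> 'M[Cplx R]_N}) i : S F -> (1 + K) * (cn (Bmx D F i) * opn (a i)) <= 2^-1.
  move=> SF; have [_ Qb] := unitmx_1B_sum (fun l => l != i) e0' k0 De SF h1.
  apply: le_trans h2; rewrite -mulrA ler_wpM2l ?addr_ge0// mulrAC.
  rewrite ler_pM ?(nrm_ge0 cnN) ?opn_ge0// (le_trans (cnM _ _))//.
  by rewrite ler_pM ?(nrm_ge0 cnN).
have h01 : 0 <= (2^-1 : R) < 1 by apply/andP; split; lra.
have [||F F' SF SF'|s l c Ss ls|F SF FE] := @picard _ _ _ (ffun_is_norm 'I_n cnN) S psi
  0 _ (ffun_complete cnN (@cn_complete _ _)) h01.
- by move=> i; rewrite ffunE (nrm0 cnN).
- move=> F SF i; rewrite ffunE.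
  rewrite (le_trans (eta_tilde_le hM hphi K0 hK (Ma i) (Bsmall _ _ SF)))//.
  rewrite ler_wpM2l// ler_wpM2r//; first by rewrite mulr_ge0.
  by rewrite ler_wpM2l// opn_alpha.
- set d := \sum_i cn ((F - F') i).
  have d0 : 0 <= d by apply: sumr_ge0 => i _; exact: (nrm_ge0 cnN).
  have Bd i : cn (Bmx D F i - Bmx D F' i) <= 2 * kappa * (2 * kappa) * e * d.
    have [uQ Qb] := unitmx_1B_sum (fun l => l != i) e0' k0 De SF h1.
    have [uQ' Qb'] := unitmx_1B_sum (fun l => l != i) e0' k0 De SF' h1.
    have -> : Bmx D F i - Bmx D F' i = invmx (Qmx D F i) *m
        (\sum_(l | l != i) D l *m (F l - F' l)) *m invmx (Qmx D F' i) *m D i.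
      rewrite -mulmxBl; congr (_ *m _).
      have -> : \sum_(l | l != i) D l *m (F l - F' l) = Qmx D F' i - Qmx D F i.
        rewrite /Qmx opprB addrC addrA subrK -sumrB.
        by apply: eq_bigr => l _; rewrite mulmxBr.
      by rewrite mulmxBr mulmxBl -mulmxA mulmxV// mulmx1 mulVmx// mul1mx.
    (* The factor e comes from the D_l in the difference of the Q_i; the outer D_i is bounded by 1
       through [e <= 1]. *)
    rewrite (le_trans (cnM _ _))// (@le_trans _ _ (2 * kappa * (e * d) * (2 * kappa) * 1))//.
      rewrite ler_pM ?(nrm_ge0 cnN)//; last exact: le_trans (De i) _.
      rewrite (le_trans (cnM _ _))// ler_pM ?(nrm_ge0 cnN)//.
      rewrite (le_trans (cnM _ _))// ler_pM ?(nrm_ge0 cnN)//.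
      rewrite (le_trans (nrm_sum cnN _ _ _))// /d mulr_sumr.
      rewrite [leRHS](bigID (fun l => l != i))/= ler_wpDr//.
        by apply: sumr_ge0 => l _; rewrite mulr_ge0 ?(nrm_ge0 cnN).
      apply: ler_sum => l _; rewrite (le_trans (cnM _ _))//.
      by rewrite !ffunE ler_pM ?(nrm_ge0 cnN).
    by rewrite le_eqVlt; apply/orP; left; apply/eqP; ring.
  apply: (@le_trans _ _ (n%:R * (lam * (2 * kappa) * (2 * kappa)) * e * d)); last exact: ler_wpM2r.
  rewrite -!mulrA -[n in n%:R]card_ord mulr_natl -sumr_const ler_sum// => i _.
  rewrite !ffunE.
  rewrite (le_trans (eta_tilde_lipschitz hM hphi K0 hK (Ma i) (Bsmall _ _ SF) (Bsmall _ _ SF')))//.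
  rewrite (@le_trans _ _ (lam * (2 * kappa * (2 * kappa) * e * d)))//.
    rewrite ler_pM ?(nrm_ge0 cnN) ?mulr_ge0 ?addr_ge0 ?opn_ge0//.
    rewrite ler_wpM2l// ler_pM ?mulr_ge0 ?addr_ge0 ?opn_ge0// ?ler_wpM2l//.
    by rewrite ler_wpM2r ?mulr_ge0// ler_wpM2l ?addr_ge0.
  by rewrite le_eqVlt; apply/orP; left; apply/eqP; rewrite /lam; ring.
- move=> i; rewrite -subr_le0; apply: (@le0_of_geometric _ _ c _ h01) => m.
  rewrite lerBlDl (le_trans _ (lerD (Ss m i) (ls m)))//.
  rewrite -[l i](subrK (s m i)) addrC (le_trans (nrmD cnN _ _))// lerD2l.
  rewrite [leRHS](bigD1 i)//= !ffunE lerDl.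
  by apply: sumr_ge0 => j _; exact: (nrm_ge0 cnN).
- by exists F => // i; rewrite -{1}FE ffunE.
Qed.

End SmallSystem.

(** * Analyticity *)

Section Analyticity.
Context (R : realType) (H : hilbertType R) (M : set (bop H)).
Context (phi : bop H -> Cplx R) (n : nat) (a : 'I_n -> bop H) (N : nat).
Hypothesis hM : von_neumann M.
Hypothesis hphi : faithful_normal_state M phi.
Hypothesis Ma : forall i, M (a i).
Variable K : R.
Hypotheses (K0 : 0 <= K) (hK : forall x, M x -> rn (phi x) <= K * opn x).
Variable C : 'I_n -> 'M[{poly Cplx R}]_N.

Notation nm := (mxnorm (@opn R H)).
Notation cn := (mxnorm (@rn R (Cplx R))).
Let nmN := @nm_is_norm R H N.
Let cnN := @cn_is_norm R N.
Let Mcl := vn_norm_closed hM.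

Definition mscale (z : Cplx R) (X : 'M[bop H]_N) : 'M[bop H]_N :=
  map_mx (fun x => z *: x) X.

Lemma mscaleA z w X : mscale z (mscale w X) = mscale (z * w) X.
Proof. by apply/matrixP => i j; rewrite !mxE scalerA. Qed.

Lemma mscale1 X : mscale 1 X = X.
Proof. by apply/matrixP => i j; rewrite !mxE scale1r. Qed.

Lemma mscaleMr z X Y : mscale z (X * Y) = X * mscale z Y.
Proof.
apply/matrixP => i j; rewrite !mxE scaler_sumr; apply: eq_bigr => k _.
by rewrite mxE bop_scaleAr.
Qed.

Lemma mscaleMl z X Y : mscale z (X * Y) = mscale z X * Y.
Proof.
apply/matrixP => i j; rewrite !mxE scaler_sumr; apply: eq_bigr => k _.
by rewrite mxE bop_scaleAl.
Qed.

Lemma mscaleB z X Y : mscale z (X - Y) = mscale z X - mscale z Y.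
Proof. by apply/matrixP => i j; rewrite !mxE scalerBr. Qed.

Lemma mscale_sum z (I : Type) (s : seq I) (P : pred I) (f : I -> 'M[bop H]_N) :
  mscale z (\sum_(i <- s | P i) f i) = \sum_(i <- s | P i) mscale z (f i).
Proof.
apply: (big_morph (mscale z)) => [X Y|]; apply/matrixP => i j; rewrite !mxE.
  exact: scalerDr.
exact: scaler0.
Qed.

Lemma mscale_tens z A x : mscale z (tens A x) = tens (z *: A) x.
Proof. by apply/matrixP => i j; rewrite !mxE scalerA. Qed.

Lemma mx_in_mscale z X : mx_in M X -> mx_in M (mscale z X).
Proof. by move=> MX i j; rewrite mxE; exact: vnZ. Qed.

Lemma phm_mscale z X : mx_in M X -> phm phi (mscale z X) = z *: phm phi X.
Proof. by move=> MX; apply/matrixP => i j; rewrite !mxE (phiZ hM hphi). Qed.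

Lemma centering_mscale z X : mx_in M X ->
  centering phi (mscale z X) = mscale z (centering phi X).
Proof. by move=> MX; rewrite /centering phm_mscale// mscaleB mscale_tens. Qed.

Lemma nm_mscale z X : nm (mscale z X) <= rn z * nm X.
Proof.
rewrite /mxnorm mulr_sumr ler_sum// => i _; rewrite mulr_sumr ler_sum// => j _.
by rewrite mxE opnZ.
Qed.

Let p := \max_i \max_r \max_s size (C i r s).
Let Cd i d : 'M[Cplx R]_N := map_mx (fun q : {poly Cplx R} => q`_d) (C i).

Lemma mxevalE i z : mxeval (C i) z = \sum_(d < p) z ^+ d *: Cd i d.
Proof.
apply/matrixP => r s; rewrite summxE mxE (@horner_coef_wide _ p); last first.
  apply: leq_trans (leq_bigmax (F := fun i => \max_r \max_s size (C i r s)) i).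
  apply: leq_trans (leq_bigmax (F := fun r => \max_s size (C i r s)) r).
  exact: (leq_bigmax (F := fun s => size (C i r s)) s).
by apply: eq_bigr => d _; rewrite !mxE mulrC.
Qed.

Lemma mxeval_bounded : exists2 b : R, 0 <= b & forall z : Cplx R, rn z <= 1 ->
  forall i, cn (mxeval (C i) z) <= b.
Proof.
exists (\sum_i \sum_(d < p) cn (Cd i d)).
  by apply: sumr_ge0 => i _; apply: sumr_ge0 => d _; exact: (nrm_ge0 cnN).
move=> z z1 i; rewrite mxevalE (bigD1 i)//= (le_trans (nrm_sum cnN _ _ _))//.
rewrite ler_wpDr//.
  by apply: sumr_ge0 => j _; apply: sumr_ge0 => d _; exact: (nrm_ge0 cnN).
apply: ler_sum => d _; rewrite /mxnorm; apply: ler_sum => r _.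
apply: ler_sum => s _; rewrite mxE rnM rnX ler_piMl ?rn_ge0//.
by rewrite exprn_ile1 ?rn_ge0.
Qed.

Local Notation E := {ffun 'I_p.+1 -> 'M[bop H]_N}.
Let fE (Y : E) := \sum_s nm (Y s).
Let SE (Y : E) := forall s, mx_in M (Y s).

Let step0 (Y : E) : 'M[bop H]_N :=
  \sum_(d < p) \sum_i tens (Cd i d) (a i) * Y (inord d).

(** A companion operator, here without its factor z: component 0 collects the coefficients of the
    polynomials C_i, the others shift. In [step0] the index d is below p, so [inord d] is d
    itself. *)
Let step (Y : E) : E :=
  [ffun s => if val s is s'.+1 then Y (inord s') else centering phi (step0 Y)].

Let start : E := [ffun s => if s == ord0 then 1 else 0].

Let mx_in_step0 Y : SE Y -> mx_in M (step0 Y).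
Proof.
move=> SY; apply: mx_in_sum => // d _; apply: mx_in_sum => // i _.
by apply: mx_in_mul => //; [exact: vnM|exact: mx_in_tens].
Qed.

Let SE_step Y : SE Y -> SE (step Y).
Proof.
move=> SY [[|s] ls]; rewrite ffunE //=.
by apply: (mx_in_centering _ hM); exact: mx_in_step0.
Qed.

Let step0B Y Z : step0 (Y - Z) = step0 Y - step0 Z.
Proof.
rewrite -sumrB; apply: eq_bigr => d _; rewrite -sumrB; apply: eq_bigr => i _.
by rewrite !ffunE mulrBr.
Qed.

Let stepB Y Z : SE Y -> SE Z -> step (Y - Z) = step Y - step Z.
Proof.
move=> SY SZ; apply/ffunP => -[[|s] ls]; rewrite !ffunE /=; last by rewrite !ffunE.
by rewrite step0B (centeringB hM hphi)//; exact: mx_in_step0.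
Qed.

(** The first term bounds component 0, the added 1 bounds the shift. *)
Let tau := (1 + K) * (\sum_(d < p) \sum_i cn (Cd i d) * opn (a i)) + 1.

Let sum0 : 0 <= \sum_(d < p) \sum_i cn (Cd i d) * opn (a i).
Proof.
apply: sumr_ge0 => d _; apply: sumr_ge0 => i _.
by rewrite mulr_ge0 ?opn_ge0// (nrm_ge0 cnN).
Qed.

Let tau1 : 1 <= tau.
Proof. by rewrite /tau lerDr mulr_ge0// addr_ge0. Qed.

Let fE_step Y : SE Y -> fE (step Y) <= tau * fE Y.
Proof.
move=> SY; rewrite /fE big_ord_recl ffunE /= /tau mulrDl mul1r lerD//.
  rewrite (le_trans (nm_centering hK (mx_in_step0 SY)))//.
  rewrite -mulrA ler_wpM2l ?addr_ge0// (le_trans (nrm_sum nmN _ _ _))//.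
  rewrite mulr_suml ler_sum// => d _; rewrite (le_trans (nrm_sum nmN _ _ _))//.
  rewrite mulr_suml ler_sum// => i _; rewrite (le_trans (nmM _ _))//.
  rewrite ler_pM ?(nrm_ge0 nmN) ?nm_tens// (bigD1 (inord d))//= lerDl.
  by apply: sumr_ge0 => s _; exact: (nrm_ge0 nmN).
rewrite [leRHS]big_ord_recr /= ler_wpDr ?(nrm_ge0 nmN)//.
apply: ler_sum => s _; rewrite ffunE /=.
have -> // : inord s = widen_ord (leqnSn p) s.
by apply: val_inj; rewrite /= inordK// ltnS ltnW.
Qed.

Let stepz z (Y : E) : E := [ffun s => mscale z (step Y s)].

Let step_mscale z Y : SE Y ->
  step [ffun s => mscale z (Y s)] = [ffun s => mscale z (step Y s)].
Proof.
move=> SY; apply/ffunP => -[[|s] ls]; rewrite !ffunE /=; last by rewrite !ffunE.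
rewrite -centering_mscale; last exact: mx_in_step0.
congr centering; rewrite mscale_sum; apply: eq_bigr => d _.
by rewrite mscale_sum; apply: eq_bigr => i _; rewrite ffunE mscaleMr.
Qed.

Let SE_start : SE start.
Proof.
move=> s; rewrite ffunE; case: eqP => _; first exact: mx_in1.
exact: mx_in0.
Qed.

Let SE_iter k : SE (iter k step start).
Proof. by elim: k => //= k; exact: SE_step. Qed.

(** Homogeneity in z: the k-th term of the expansion is z^k times a matrix independent of z, which
    supplies the power series coefficients. *)
Let iter_stepz z k :
  iter k (stepz z) start = [ffun s => mscale (z ^+ k) (iter k step start s)].
Proof.
elim: k => [|k IHk] /=.
  by apply/ffunP => s; rewrite [RHS]ffunE expr0 mscale1.
rewrite IHk /stepz step_mscale; last exact: SE_iter.
by apply/ffunP => s; rewrite !ffunE mscaleA exprS.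
Qed.

(* The degree of [C i] is absorbed by the vector [(U, z U, .., z ^ p U)], which
   satisfies a fixed-point equation linear in [z]. *)
Lemma resolvent_analytic :
  exists c : 'I_n -> nat -> 'M[Cplx R]_N, exists2 d : R, 0 < d &
  forall z : Cplx R, rn z < d -> forall U : 'M[bop H]_N, mx_in M U ->
    U = 1 + centering phi ((\sum_i tens (z *: mxeval (C i) z) (a i)) * U) ->
    forall i r s, series (fun k => c i k r s * z ^+ k) @ \oo -->
      phm phi (U * tens 1 (a i)) r s.
Proof.
exists (fun i k => phm phi (iter k step start ord0 * tens 1 (a i))).
have tau0 : 0 < tau by apply: lt_le_trans tau1.
exists ((2 * tau)^-1); first by rewrite invr_gt0 mulr_gt0.
move=> z zd U MU UE i r s.
have h01 : 0 <= (2^-1 : R) < 1 by apply/andP; split; lra.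
pose V : E := [ffun s : 'I_p.+1 => mscale (z ^+ s) U].
have SV : SE V by move=> k; rewrite ffunE; exact: mx_in_mscale.
have VE : V = start + stepz z V.
  apply/ffunP => -[[|k] lk]; rewrite !ffunE /=; last first.
    rewrite ffunE mscaleA -exprS add0r inordK//.
    exact: ltnW.
  rewrite expr0 mscale1 {1}UE; congr (_ + _).
  rewrite -centering_mscale; last exact: mx_in_step0.
  congr centering; rewrite mscale_sum mulr_suml.
  rewrite (eq_bigr (fun i => \sum_(d < p) mscale z (tens (Cd i d) (a i) * V (inord d)))).
    rewrite exchange_big; apply: eq_bigr => d _ /=.
    by rewrite mscale_sum.
  move=> j _; rewrite mxevalE scaler_sumr tens_suml mulr_suml.
  apply: eq_bigr => d _; rewrite ffunE inordK; last by rewrite ltnS ltnW.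
  by rewrite mscaleMl mscale_tens -mscaleMr mscaleMl mscale_tens !scalerA mulrC.
have zt : rn z * tau <= 2^-1.
  by rewrite -ler_pdivlMr// -invfM ltW.
have dist m : fE (V - \sum_(k < m) iter k (stepz z) start) <= fE V * 2^-1 ^+ m.
  apply: (@resolvent_series R _ fE SE (stepz z) start 2^-1) => //.
  - by move=> k; rewrite ffunE; exact: mx_in0.
  - by move=> Y Z SY SZ k; rewrite !ffunE; exact: mx_inB.
  - by move=> Y SY k; rewrite ffunE; apply: mx_in_mscale; exact: SE_step.
  - move=> Y Z SY SZ; apply/ffunP => k.
    by rewrite /stepz stepB// !ffunE mscaleB.
  - move=> Y SY; apply: (@le_trans _ _ (rn z * (tau * fE Y))).
      rewrite (le_trans _ (ler_wpM2l (rn_ge0 _) (fE_step SY)))// mulr_sumr.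
      by apply: ler_sum => k _; rewrite ffunE nm_mscale.
    by rewrite mulrA ler_wpM2r// sumr_ge0// => k _; exact: (nrm_ge0 nmN).
have Mt X : mx_in M X -> mx_in M (X * tens 1 (a i)).
  by move=> MX; apply: mx_in_mul => //; [exact: vnM|exact: mx_in_tens].
have sumE m : (\sum_(k < m) iter k (stepz z) start : E) ord0 =
    \sum_(k < m) mscale (z ^+ k) (iter k step start ord0).
  by rewrite sum_ffunE; apply: eq_bigr => k _; rewrite iter_stepz ffunE.
apply: (@cvg_geometric_dist _ _ _ _ (K * (fE V * nm (tens 1 (a i)))) _ h01) => m.
have -> : series (fun k => phm phi (iter k step start ord0 * tens 1 (a i)) r s * z ^+ k) m
    = phm phi ((\sum_(k < m) iter k (stepz z) start : E) ord0 * tens 1 (a i)) r s.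
  rewrite /series /= big_mkord sumE mulr_suml (phm_sum hM hphi) ?summxE.
    apply: eq_bigr => k _; rewrite -mscaleMl phm_mscale; last exact/Mt/SE_iter.
    by rewrite [RHS]mxE mulrC.
  by move=> k _; apply: Mt; apply: mx_in_mscale; exact: SE_iter.
have MS : mx_in M ((\sum_(k < m) iter k (stepz z) start : E) ord0).
  rewrite sumE; apply: mx_in_sum => // k _; apply: mx_in_mscale; exact: SE_iter.
have V0 : V ord0 = U by rewrite ffunE expr0 mscale1.
have -> (A B : 'M[Cplx R]_N) : A r s - B r s = (A - B) r s by rewrite !mxE.
rewrite (le_trans (mxnorm_entry _ _ _ (rn_is_norm _)))//.
rewrite -(phmB hM hphi); [|exact: Mt..].
rewrite -mulrBl (le_trans (cn_phm hK _))//; first by apply: Mt; exact: mx_inB.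
rewrite -[leRHS]mulrA ler_wpM2l// (le_trans (nmM _ _))// [leRHS]mulrAC.
apply: ler_wpM2r; first exact: (nrm_ge0 nmN).
apply: le_trans (dist m); rewrite /fE (bigD1 ord0)//= -{1}V0 !ffunE lerDl.
by apply: sumr_ge0 => k _; exact: (nrm_ge0 nmN).
Qed.

End Analyticity.

(** Convergence at w = d/2 bounds the partial sums there by [B0], hence the terms by [2 * B0]. For
    |z| < d/4 the terms are halved geometrically and sum to at most [4 * B0]. Uniqueness uses
    analyticity through this bound. *)
Lemma analytic_at0_bounded (R : realType) (f : Cplx R -> Cplx R) :
  analytic_at0 f -> exists2 b : R, 0 <= b &
    exists2 d : R, 0 < d & forall z, rn z < d -> rn (f z) <= b.
Proof.
move=> [c /near0P[d d0 cf]].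
have d2 : 0 < d / 2 by lra.
pose w : Cplx R := ((d / 2)%:C)%C.
have rw : rn w = d / 2 by rewrite rn_real// ltW.
have cw : series (fun k => c k * w ^+ k) @ \oo --> f w by apply: cf; rewrite rw; lra.
have [n0 n0P] := (cvg_rnP _ _).1 cw 1 ltr01.
pose s := fun m => rn (series (fun k => c k * w ^+ k) m).
pose B0 := rn (f w) + 1 + \sum_(k < n0) s k.
have sB m : s m <= B0.
  rewrite /B0; have S0 : 0 <= \sum_(k < n0) s k by apply: sumr_ge0 => k _; exact: rn_ge0.
  have [mn|nm] := ltnP m n0.
    rewrite (bigD1 (Ordinal mn))//= addrCA lerDl !addr_ge0 ?rn_ge0//.
    by apply: sumr_ge0 => k _; exact: rn_ge0.
  rewrite -[s m]addr0 lerD// /s.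
  rewrite -[series _ m](subrK (f w)) addrC (le_trans (rnD _ _))// lerD2l rn_distC.
  exact: n0P.
have B00 : 0 <= B0 by apply: le_trans (sB 0%N); exact: rn_ge0.
have cB k : rn (c k) * (d / 2) ^+ k <= 2 * B0.
  rewrite -rw -rnX -rnM.
  have -> : c k * w ^+ k = series (fun k => c k * w ^+ k) k.+1 -
      series (fun k => c k * w ^+ k) k.
    by rewrite /series /= big_nat_recr//= addrAC subrr add0r.
  by rewrite (le_trans (rnB _ _))//; have := sB k.+1; have := sB k; rewrite /s; lra.
exists (4 * B0); first by rewrite mulr_ge0.
exists (d / 4) => [|z zd]; first by lra.
apply: (rn_lim_le (cf z _)) => [|m]; first by apply: lt_trans zd _; lra.
rewrite /series /= big_mkord (le_trans (rn_sum _ _ _))//.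
have term k : rn (c k * z ^+ k) <= 2 * B0 * 2^-1 ^+ k.
  rewrite rnM rnX (@le_trans _ _ (rn (c k) * (d / 4) ^+ k))//.
    by rewrite ler_wpM2l ?rn_ge0// lerXn2r ?nnegrE ?rn_ge0 ?ltW//; lra.
  have -> : d / 4 = d / 2 * 2^-1 by field.
  by rewrite exprMn mulrA ler_wpM2r// exprn_ge0//; lra.
apply: (@le_trans _ _ (\sum_(k < m) 2 * B0 * 2^-1 ^+ k)).
  by apply: ler_sum => k _; exact: term.
rewrite -mulr_sumr.
have -> : 4 * B0 = 2 * B0 * 2 by ring.
rewrite ler_wpM2l ?mulr_ge0//.
suff -> : \sum_(k < m) 2^-1 ^+ k = 2 - 2 * 2^-1 ^+ m :> R.
  by rewrite gerBl mulr_ge0// exprn_ge0//; lra.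
elim: m => [|m IHm]; first by rewrite big_ord0 expr0; ring.
by rewrite big_ord_recr /= IHm exprS; field.
Qed.

(** * Scalar compression and uniqueness of the conditional expectation *)

Section Sandwich.
Context (R : realType) (H : hilbertType R) (M : set (bop H)).
Context (phi : bop H -> Cplx R) (N : nat) (u v : 'cV[Cplx R]_N).
Hypothesis hM : von_neumann M.
Hypothesis hphi : faithful_normal_state M phi.
Implicit Types (X : 'M[bop H]_N).

Lemma sandwichE X :
  sandwich u v X = \sum_r \sum_s (u r 0 * v s 0) *: X r s.
Proof.
rewrite /sandwich mxE exchange_big; apply: eq_bigr => s _.
rewrite mxE mulr_suml; apply: eq_bigr => r _; rewrite !mxE.
by rewrite -bop_scaleAl mul1r -bop_scaleAr mulr1 scalerA mulrC.
Qed.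

Lemma sandwich_in (S : set (bop H)) X : norm_closed S -> mx_in S X ->
  S (sandwich u v X).
Proof.
move=> Scl SX; rewrite sandwichE; apply: norm_closed_sum => // r _.
by apply: norm_closed_sum => // s _; exact: norm_closedZ.
Qed.

Lemma phi_sandwich X y : mx_in M X -> M y ->
  phi (sandwich u v X * y) = \sum_r \sum_s u r 0 * v s 0 * phi (X r s * y).
Proof.
move=> MX My; rewrite sandwichE mulr_suml (phi_sum hM hphi) => [|r _].
  apply: eq_bigr => r _; rewrite mulr_suml (phi_sum hM hphi) => [|s _].
    apply: eq_bigr => s _; rewrite -bop_scaleAl (phiZ hM hphi)//.
    exact: vnM.
  by apply: (vnM hM) => //; exact: vnZ.
rewrite mulr_suml; apply: (vn_sum hM) => s _.
by apply: (vnM hM) => //; exact: vnZ.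
Qed.

Lemma phi_sandwich1 X : mx_in M X ->
  phi (sandwich u v X) = (u^T *m phm phi X *m v) 0 0.
Proof.
move=> MX; rewrite -[sandwich u v X]mulr1 phi_sandwich//; last exact: vn1.
rewrite mxE exchange_big; apply: eq_bigr => s _.
by rewrite mxE mulr_suml; apply: eq_bigr => r _; rewrite !mxE mulr1 mulrAC.
Qed.

Lemma cond_exp_unique S w e : vn_gen S `<=` M -> vn_gen S e ->
  (forall y, vn_gen S y -> phi (w * y) = phi (e * y)) ->
  is_cond_exp phi (vn_gen S) w e.
Proof.
move=> SM Se we; split=> // e' [Se' we'].
have [_ Slin _] := vn_gen_norm_closed S.
have Sd : vn_gen S (e - e') by rewrite addrC -scaleN1r; exact: Slin.
have Md := SM _ Sd.
have [y My dy] : exists2 y, M y & is_adjoint (e - e') y.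
  by have [_ _ _ + _] := hM; exact.
have Sy := vn_gen_adjoint Sd dy.
have y0 : y = 0.
  have [_ faith _] := hphi; apply: (faith y (e - e')) => //.
    exact: is_adjoint_sym.
  have Me := SM _ Se; have Me' := SM _ Se'.
  rewrite mulrBl (phiB hM hphi (vnM hM Me My) (vnM hM Me' My)).
  by rewrite -we// -we'// subrr.
have a0 : is_adjoint (0 : bop H) 0 by move=> x z; rewrite [LHS]linear0l [RHS]linear0r.
apply/eqP; rewrite -subr_eq0; apply/eqP.
by apply: is_adjoint_unique _ a0; apply: is_adjoint_sym; rewrite -y0.
Qed.

End Sandwich.

Theorem theorem1p3 (R : realType) (H : hilbertType R) (M : set (bop H))
    (phi : bop H -> Cplx R) (n : nat) (a : 'I_n -> bop H)
    (P : ncpoly R n) (m N : nat) (C : 'I_n -> 'M[{poly Cplx R}]_N)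
    (u v : 'cV[Cplx R]_N) (k : nat)
    (hM : von_neumann M)
    (hphi : faithful_normal_state M phi)
    (hsa : forall i, selfadjoint (a i))
    (hgen : M = vn_gen (range a))
    (hfree : free_elements phi a)
    (hdeg : ncdeg P = m)
    (hlin : resolvent_linearization P m a C u v)
    (hk : (1 <= k < n)%N) :
  exists F : 'I_n -> Cplx R -> 'M[Cplx R]_N,
    [/\ is_solution phi a C F,
        forall G, is_solution phi a C G ->
          \forall z \near (0 : Cplx R), forall i, G i z = F i z,
        \forall z \near (0 : Cplx R),
          let X := 1 - z ^+ m *: nceval P a in
          let Y := 1 - (\sum_(i : 'I_n | (i < k)%N) tens (z *: mxeval (C i) z) (a i)
                 + tens (z *: \sum_(i : 'I_n | (k <= i)%N) mxeval (C i) z *m F i z) 1)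
          in
          [/\ invertible X, invertible Y
            & is_cond_exp phi (vn_gen (a @` [set i : 'I_n | (i < k)%N]))
                (rinv X) (sandwich u v (rinv Y))]
      & \forall z \near (0 : Cplx R),
          let Mgf w := phi (rinv (1 - w *: nceval P a)) in
          Mgf (z ^+ m) =
          (u^T *m invmx (1 - z *: \sum_j mxeval (C j) z *m F j z) *m v) 0 0].
Proof.
have Ma i : M (a i) by rewrite hgen => S [_ aS]; apply: aS; exists i.
have [K K0 hK] := phi_bounded hM hphi.
pose D (z : Cplx R) i := z *: mxeval (C i) z.
pose cn := mxnorm (N := N) (@rn R (Cplx R)).
have Dsmall e : 0 < e -> \forall z \near (0 : Cplx R), forall i, cn (D z i) <= e.
  move=> e0; have [b b0 bP] := mxeval_bounded C.
  have b1 : 0 < b + 1 by rewrite ltr_wpDl.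
  apply/near0P; exists (Num.min 1 (e / (b + 1))).
    by rewrite lt_min ltr01 divr_gt0.
  move=> z; rewrite lt_min => /andP[z1 ze] i.
  apply: (@le_trans _ _ (rn z * cn (mxeval (C i) z))).
    rewrite /cn /mxnorm mulr_sumr ler_sum// => r _.
    by rewrite mulr_sumr ler_sum// => s _; rewrite mxE rnM.
  apply: (@le_trans _ _ (rn z * (b + 1))).
    by rewrite ler_wpM2l ?rn_ge0// (le_trans (bP _ (ltW z1) i))// lerDl.
  by rewrite -ler_pdivlMr// ltW.
have sumD z (Q : pred 'I_n) (G : 'I_n -> 'M[Cplx R]_N) :
    \sum_(j | Q j) D z j *m G j = z *: \sum_(j | Q j) mxeval (C j) z *m G j.
  by rewrite scaler_sumr; apply: eq_bigr => j _; rewrite scalemxAl.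
have systemE z (G : 'I_n -> 'M[Cplx R]_N) : solves phi a (D z) G <->
    forall i, G i = eta_tilde phi (a i) (z *: (invmx (1 - z *: \sum_(j | j != i)
      mxeval (C j) z *m G j) *m mxeval (C i) z)).
  by split=> h i; rewrite {1}h sumD scalemxAr.
pose X z := rinv (1 - \sum_i tens (D z i) (a i) : 'M[bop H]_N).
(* Any small solution must be given by this formula, which is analytic. *)
pose F i z := phm phi (X z * tens 1 (a i)) *m invmx (phm phi (X z)).
(* The neighbourhood depends on c; it is used with the bound of the contraction and with that of an
   analytic competitor. *)
have core (c : R) : 0 <= c -> \forall z \near (0 : Cplx R),
    forall G : 'I_n -> 'M[Cplx R]_N, (forall i, cn (G i) <= c) ->
    solves phi a (D z) G ->
    [/\ forall i, G i = F i z,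
        [/\ is_inverse (1 - \sum_i tens (D z i) (a i)) (X z), mx_in M (X z),
          phm phi (X z) \in unitmx &
          phm phi (X z) = invmx (1 - z *: \sum_j mxeval (C j) z *m G j)] &
        forall J : pred 'I_n, exists XJ, [/\
          is_inverse (1 - (\sum_(i | J i) tens (D z i) (a i) +
            tens (z *: \sum_(i | ~~ J i) mxeval (C i) z *m G i) 1)) XJ,
          mx_in (vn_gen (a @` [set i | J i])) XJ &
          forall y, vn_gen (a @` [set i | J i]) y ->
            forall i j, phi (X z i j * y) = phi (XJ i j * y)]].
  move=> c0; have [e e0 eP] := small_solution N hM hphi Ma hsa hfree K0 hK c0.
  apply: filterS (Dsmall _ e0) => z De G Gc sG.
  have [uG [X' [XV MX pX pXa]] sub] := eP _ _ De Gc sG.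
  have XE : X z = X' by exact: rinvE.
  have uX : phm phi (X z) \in unitmx by rewrite XE pX unitmx_inv.
  split.
  - by move=> i; rewrite /F {1}XE pXa -XE mulmxK.
  - by split=> //; rewrite XE// pX sumD.
  - move=> J; have [X'' [XJ [XV'' XJV XJJ XJP]]] := sub J.
    exists XJ; split=> //; first by rewrite -sumD.
    by rewrite XE (is_inverse_unique XV XV'').
have [kf kf0 [e1 e10 ex]] := solution_exists N hM hphi Ma K0 hK.
(* At each small z the solution given by the contraction coincides with the explicit formula, so
   that F itself is a bounded solution. *)
have good : \forall z \near (0 : Cplx R), [/\ solves phi a (D z) (F^~ z),
    [/\ is_inverse (1 - \sum_i tens (D z i) (a i)) (X z), mx_in M (X z),
      phm phi (X z) \in unitmx &
      phm phi (X z) = invmx (1 - z *: \sum_j mxeval (C j) z *m F j z)] &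
    forall J : pred 'I_n, exists XJ, [/\
      is_inverse (1 - (\sum_(i | J i) tens (D z i) (a i) +
        tens (z *: \sum_(i | ~~ J i) mxeval (C i) z *m F i z) 1)) XJ,
      mx_in (vn_gen (a @` [set i | J i])) XJ &
      forall y, vn_gen (a @` [set i | J i]) y ->
        forall i j, phi (X z i j * y) = phi (XJ i j * y)]].
  apply: filterS (filterI (Dsmall _ e10) (core kf kf0)) => z [De cz].
  have [G Gk sG] := ex _ De.
  have [GF _ _] := cz G Gk sG; have FG : F^~ z = G by apply/funext.
  have Fk i : cn (F i z) <= kf by rewrite -GF.
  have sF : solves phi a (D z) (F^~ z) by rewrite FG.
  by have [_ ? ?] := cz (F^~ z) Fk sF.
have [c [d d0 canal]] := resolvent_analytic hM hphi Ma K0 hK C.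
have genM J : vn_gen (a @` J) `<=` M.
  by move=> x; apply; split=> // _ [i _ <-].
exists F; split.
- split; last first.
    by apply: filterS good => z [sF _ _] i; exact: ((systemE z (F^~ z)).1 sF i).
  move=> i r s; exists (fun l => c i l r s).
  have zd : \forall z \near (0 : Cplx R), rn z < d by apply/near0P; exists d.
  apply: filterS (filterI zd good) => z [{}zd [_ [XV MX uX pX] _]].
  (* Normalizing by phi(U) = 1 absorbs the inverse in the formula for F, which becomes phi(U
     a_i). *)
  set U := X z * tens (invmx (phm phi (X z))) 1.
  have MU : mx_in M U by apply: mx_in_scr => //; exact: vn_norm_closed.
  have -> : F i z r s = phm phi (U * tens 1 (a i)) r s.
    rewrite /F -(phm_scr hM hphi); last first.
      apply: mx_in_mul => //; [exact: vn_norm_closed|exact: vnM|].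
      by apply: mx_in_tens => //; exact: vn_norm_closed.
    by rewrite /U -!mulrA !tensM mul1mx mulmx1 mul1r mulr1.
  apply: (canal z zd U MU).
  set t := \sum_i tens _ _; have XE : (1 - t) * X z = 1 by have [] := XV.
  (* Applying phi identifies the scalar term with 1 - phi(t U), which is the fixed-point equation
     required by [resolvent_analytic]. *)
  have UE : U = t * U + tens (invmx (phm phi (X z))) 1.
    by rewrite -[tens _ _]mul1r -XE -mulrA -/U mulrBl mul1r addrC subrK.
  have MtU : mx_in M (t * U).
    apply: mx_in_mul => //; [exact: vn_norm_closed|exact: vnM|].
    apply: mx_in_sum => [|j _]; first exact: vn_norm_closed.
    by apply: mx_in_tens => //; exact: vn_norm_closed.
  have pU : phm phi U = 1 by rewrite (phm_scr hM hphi)// mulmxV.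
  rewrite /centering; set q := phm phi (t * U).
  have qE : q = 1 - invmx (phm phi (X z)).
    rewrite -pU {1}UE (phmD hphi)//; last first.
      by apply: mx_in_tens; [exact: vn_norm_closed|exact: vn1].
    by rewrite (phm_tens1 hM hphi) addrK.
  by rewrite {1}UE qE tensBl tens11 opprB [RHS]addrCA [1 + _]addrC subrK.
- move=> G [Gan Gsys].
  (* The bounds on the finitely many entries of the competitor are merged into one constant for
     [core]. *)
  have /choice[b bP] (t : 'I_n * 'I_N * 'I_N) : exists b : R, 0 <= b /\
      \forall z \near (0 : Cplx R), rn (G t.1.1 z t.1.2 t.2) <= b.
    have [b b0 [e e0 be]] := analytic_at0_bounded (Gan t.1.1 t.1.2 t.2).
    by exists b; split=> //; apply/near0P; exists e.
  have bnear : \forall z \near (0 : Cplx R), forall t, rn (G t.1.1 z t.1.2 t.2) <= b t.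
    have fb := @filter_forall (Cplx R) ('I_n * 'I_N * 'I_N)%type
      (fun t z => rn (G t.1.1 z t.1.2 t.2) <= b t) (nbhs (0 : Cplx R)) _.
    by apply: fb => t; exact: (bP t).2.
  pose B := \sum_t b t.
  have B0 : 0 <= B by apply: sumr_ge0 => t _; exact: (bP t).1.
  have B1 : 0 <= N%:R * (N%:R * B) by rewrite !mulr_ge0.
  apply: filterS (filterI bnear (filterI Gsys (core _ B1))) => z [bz [sG cz]] i.
  have [||GF _ _] := cz (G^~ z).
  - move=> j; apply: mxnorm_le => r s; apply: (le_trans (bz (j, r, s))).
    rewrite /B (bigD1 (j, r, s))//= lerDl; apply: sumr_ge0 => t _.
    exact: (bP t).1.
  - exact/systemE.
  - exact: GF.
- apply: filterS (filterI hlin good) => z [[iX0 _ X0E] [_ [XV MX uX pX] sub]].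
  set Y0 := 1 - (_ + _).
  have [XJ [XJV XJJ XJP]] := sub (fun i : 'I_n => (i < k)%N).
  have Y0V : is_inverse Y0 XJ.
    have kE : \sum_(i : 'I_n | (k <= i)%N) mxeval (C i) z *m F i z =
        \sum_(i : 'I_n | ~~ (i < k)%N) mxeval (C i) z *m F i z.
      by apply: eq_bigl => i; rewrite leqNgt.
    by rewrite /Y0 kE.
  split=> //; first by exists XJ.
  rewrite (rinvE Y0V) X0E (rinvE XV).
  have kM := genM [set i : 'I_n | (i < k)%N].
  apply: (cond_exp_unique hM hphi kM).
    by apply: sandwich_in => //; exact: vn_gen_norm_closed.
  move=> y Sy; have My := kM y Sy.
  have MXJ : mx_in M XJ by move=> i j; exact: (kM _ (XJJ i j)).
  rewrite !(phi_sandwich u v hM hphi)//.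
  apply: eq_bigr => r _; apply: eq_bigr => s _; congr (_ * _); exact: XJP.
- apply: filterS (filterI hlin good) => z [[_ _ X0E] [_ [XV MX uX pX] _]].
  by rewrite X0E (rinvE XV) (phi_sandwich1 u v hM hphi MX) pX.
Qed.
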